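(* Let $K\ge 0$, let $(\xi^{(n)},p_n)_{n\in\mathbb N}$ satisfy $$\lim_{n\to\infty}\ \sup_{s_i,t_j\in\{-1,1\}}\ \frac1{n^2}\sum_{i,j=1}^n\Big(\frac{\xi^{(n)}_{ij}}{p_n}-1\Big)s_it_j=0,$$ and let $\mu_0\in\mathcal P(\mathbb T)$. Let $\mu^n_t$ be the empirical measure of the oscillator system on the graph $\xi^{(n)}$, and let $\mu_\cdot$ be the solution of the McKean–Vlasov equation with initial condition $\mu_0$ (see context). Suppose that for all $\varepsilon_0>0$ $$\lim_{n\to\infty}\mathbf P\big(\|\mu^n_0-\mu_0\|_{-1}\le\varepsilon_0\big)=1.$$ Then, for every fixed time $T>0$ and for every $\varepsilon>0$, $$\lim_{n\to\infty}\mathbf P\Big(\sup_{t\in[0,T]}\|\mu^n_t-\mu_t\|_{-1}\le\varepsilon\Big)=1.$$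
   Context: $\mathbb T=\mathbb R/2\pi\mathbb Z$, and $\mathcal P(\mathbb T)$ is the space of probability measures on $\mathbb T$. For each $n$, $\xi^{(n)}=(\xi^{(n)}_{ij})_{i,j=1}^n$ is the adjacency matrix of a (directed or undirected, possibly multi-) graph on $\{1,\dots,n\}$, with entries in $\{0,1,\dots,n\}$ and not necessarily symmetric, and $p_n\in(0,1]$. $J(\theta)=-K\sin\theta$. Oscillator system: for $i=1,\dots,n$, $$d\theta^{i,n}_t=\frac1{np_n}\sum_{j=1}^n\xi^{(n)}_{ij}J(\theta^{i,n}_t-\theta^{j,n}_t)\,dt+dB^i_t,\quad t>0,\qquad \theta^{i,n}_0=\theta^i_0,$$ where $(B^i)_{i\in\mathbb N}$ are IID standard Brownian motions on $\mathbb T$. The initial conditions $\theta^i_0\in\mathbb T$ may be deterministic or random; if random they are independent of the Brownian motions. They may depend on the graph (hence on $n$); no independence between the initial conditions and $\xi^{(n)}$ is assumed. $\mathbf P$ is the law of the Brownian motions and the initial conditions. Empirical measure: $\mu^n_t=\frac1n\sum_{j=1}^n\delta_{\theta^{j,n}_t}$. McKean–Vlasov equation: $\mu_\cdot\in C^0([0,T],\mathcal P(\mathbb T))$ for every $T>0$ is the (weak) solution of $\partial_t\mu_t(\theta)=\frac12\partial_\theta^2\mu_t(\theta)-\partial_\theta[\mu_t(\theta)(J*\mu_t)(\theta)]$ with $\mu_t|_{t=0}=\mu_0$, where $*$ is convolution on $\mathbb T$. Norm: $H_1$ is the closure of the $C^1$ zero-mean functions on $\mathbb T$ for $\|\varphi\|_1=(\int_{\mathbb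 T}(\varphi')^2)^{1/2}$, and $H_{-1}$ is its dual, with norm $\|\cdot\|_{-1}$. For $\mu,\nu\in\mathcal P(\mathbb T)$, $\mu-\nu$ is the element $h\mapsto\int h\,d\mu-\int h\,d\nu$ of $H_{-1}$. *)

(* Defs.v *)
From HB Require Import structures.
From mathcomp Require Import all_boot all_order all_algebra generic_quotient ring_quotient.
From mathcomp Require Import all_classical all_reals all_analysis.

Set Implicit Arguments.
Unset Strict Implicit.
Unset Printing Implicit Defensive.

Import Order.TTheory GRing.Theory Num.Theory.
Import numFieldNormedType.Exports.

Local Open Scope classical_set_scope.
Local Open Scope ring_scope.

Definition twopiZ (R : realType) : {pred R} :=
  fun x => `[< exists k : int, x = k%:~R * (2 * pi) >].

Lemma twopiZ_zmod_closed (R : realType) : zmod_closed (@twopiZ R).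
Proof.
split=> [|x y /asboolP[k ->] /asboolP[l ->]]; apply/asboolP.
  by exists 0; rewrite mulr0z mul0r.
by exists (k - l); rewrite intrB mulrBl.
Qed.

HB.instance Definition _ (R : realType) :=
  GRing.isZmodClosed.Build R (@twopiZ R) (@twopiZ_zmod_closed R).

Definition torus (R : realType) : Type := {ideal_quot (@twopiZ R)}.

HB.instance Definition _ (R : realType) := GRing.Zmodule.on (torus R).
HB.instance Definition _ (R : realType) := Quotient.on (torus R).
HB.instance Definition _ (R : realType) := isPointed.Build (torus R) 0.

Section torus_topology.
Variable R : realType.

Definition torus_pi : R -> torus R := \pi_(torus R)%qT.

Definition torus_open (A : set (torus R)) : Prop := open (torus_pi @^-1` A).

Lemma torus_openT : torus_open setT.
Proof. by rewrite /torus_open preimage_setT; exact: openT. Qed.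

Lemma torus_openI : setI_closed torus_open.
Proof. by move=> A B; exact: openI. Qed.

Lemma torus_open_bigcup (I : Type) (f : I -> set (torus R)) :
  (forall i, torus_open (f i)) -> torus_open (\bigcup_i f i).
Proof. by move=> fo; apply: bigcup_open => i _; exact: fo. Qed.

HB.instance Definition _ :=
  isOpenTopological.Build (torus R) torus_openT torus_openI torus_open_bigcup.

End torus_topology.

HB.instance Definition _ (R : realType) :=
  @isMeasurable.Build (sigma_display (@torus_open R)) (torus R)
    <<s (@torus_open R) >> (@sigma_algebra0 _ setT _) (@sigma_algebraC _ _)
    (@sigma_algebra_bigcup _ setT _).

Section torus_calculus.
Variable R : realType.
Notation T := (torus R).
Implicit Types (h : T -> R) (x : T) (mu nu : {measure set T -> \bar R}).

Definition torus_derivable h : Prop :=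
  forall x, derivable (fun e : R => h (x + torus_pi e)) 0 1.

Definition torus_derive h : T -> R :=
  fun x => derive1 (fun e : R => h (x + torus_pi e)) 0.

Definition torus_C1 h : Prop :=
  torus_derivable h /\ continuous (torus_derive h).

Definition torus_smooth h : Prop :=
  forall k, torus_C1 (iter k torus_derive h).

(* not normalized: the length measure has total mass 2pi *)
Definition torus_integral h : R :=
  \int[lebesgue_measure]_(u in `[0, 2 * pi]) h (torus_pi u).

Definition C1_zero_mean h : Prop := torus_C1 h /\ torus_integral h = 0.

Definition C1_norm1 h : R :=
  Num.sqrt (torus_integral (fun x => torus_derive h x ^+ 2)).

(* [h] is in H_1 with norm [c]. By the Poincare inequality, a sequence of C^1
   zero-mean functions that is Cauchy for [C1_norm1] converges uniformly, so
   the elements of the closure H_1 are the pointwise limits of such sequences,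
   and their norm is the limit of the norms. *)
Definition has_H1_norm h (c : R) : Prop :=
  exists u : nat -> T -> R,
    [/\ forall k, C1_zero_mean (u k),
        forall e : R, 0 < e -> exists N : nat, forall k l : nat,
          (N <= k)%N -> (N <= l)%N ->
          C1_norm1 (fun x => u k x - u l x) <= e,
        forall x, u k x @[k --> \oo] --> h x
      & C1_norm1 (u k) @[k --> \oo] --> c].

(* the norm of [mu - nu] in H_{-1} *)
Definition Hm1_dist mu nu : \bar R :=
  ereal_sup [set (`|\int[mu]_x h x - \int[nu]_x h x|)%:E
            | h in [set h | exists2 c : R, c <= 1 & has_H1_norm h c]].

(* [repr x] is a real representative of [x]; sin is 2pi-periodic. *)
Definition coupling (K : R) (x : T) : R := - K * sin (repr x : R).

Definition torus_conv (f : T -> R) mu (x : T) : R := \int[mu]_y f (x - y).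

(* [mu] is weakly continuous in time and solves the equation in the sense of
   distributions, integrated in time; only [mu t] for [0 <= t] matters. *)
Definition is_McKean_Vlasov_solution (K : R) (mu0 : probability T R)
    (mu : R -> probability T R) : Prop :=
  [/\ forall h, continuous h ->
        {within `[0, +oo[, continuous (fun t => \int[mu t]_x h x)},
      forall A, measurable A -> mu 0 A = mu0 A
    & forall h, torus_smooth h -> forall t : R, 0 <= t ->
        \int[mu t]_x h x = \int[mu 0]_x h x +
        \int[lebesgue_measure]_(s in `[0, t])
          (2^-1 * \int[mu s]_x torus_derive (torus_derive h) x +
           \int[mu s]_x (torus_derive h x *
                         torus_conv (coupling K) (mu s) x))].

Definition empirical (n : nat) (x : nat -> T) : {measure set T -> \bar R} :=
  mscale (n%:R^-1)%:nng (msum (fun j => \d_(x j)) n).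

End torus_calculus.

Section probability.
Context (R : realType) (d : measure_display) (Omega : measurableType d).
Variable P : probability Omega R.

(* sigma-algebra generated by the random variables [X j] for [j] in [D] *)
Definition sigma_of (I : Type) (dU : measure_display) (U : measurableType dU)
    (D : set I) (X : I -> Omega -> U) : set (set Omega) :=
  <<s \bigcup_(j in D) preimage_set_system setT (X j) measurable >>.

Definition mutually_independent (I : eqType) (F : I -> set (set Omega)) : Prop :=
  forall (s : seq I) (A : I -> set Omega), uniq s ->
    (forall i, i \in s -> F i (A i)) ->
    P (\bigcap_(i in [set` s]) A i) = (\prod_(i <- s) P (A i))%E.

Definition independent2 (F G : set (set Omega)) : Prop :=
  forall A C, F A -> G C -> P (A `&` C) = (P A * P C)%E.

Definition standard_Brownian_motion (B : R -> Omega -> R) : Prop :=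
  [/\ forall t, 0 <= t -> measurable_fun setT (B t),
      \forall w \ae P, B 0 w = 0 /\ {within `[0, +oo[, continuous (B^~ w)},
      forall s t, 0 <= s -> s < t -> forall A, measurable A ->
        P [set w | A (B t w - B s w)] = normal_prob 0 (Num.sqrt (t - s)) A
    & forall t : nat -> R, 0 <= t 0%N -> {homo t : k l / (k <= l)%N >-> k <= l} ->
        mutually_independent (fun k =>
          sigma_of [set: unit] (fun _ w => B (t k.+1) w - B (t k) w))].

Definition iid_Brownian_motions (B : nat -> R -> Omega -> R) : Prop :=
  (forall i, standard_Brownian_motion (B i)) /\
  mutually_independent (fun i => sigma_of `[0, +oo[ (B i)).

(* Supremum of the probabilities of the events contained in [E]: it is [P E]
   when [E] is an event, see [inner_probE], and the value of the completion
   of [P] when [E] is an event up to a null set. Paths are only assumed to be good almost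
   surely, which does not make the sets of interest measurable unless [P] is
   complete. *)
Definition inner_prob (E : set Omega) : \bar R :=
  ereal_sup [set P A | A in [set A | measurable A /\ A `<=` E]].

Lemma inner_probE (E : set Omega) : measurable E -> inner_prob E = P E.
Proof.
move=> mE; apply/eqP; rewrite eq_le; apply/andP; split.
  apply: ge_ereal_sup => _ [A [mA AE] <-].
  by apply: le_measure; rewrite ?inE.
by apply: ereal_sup_ubound => /=; exists E => //; split => //; exact: subset_refl.
Qed.

End probability.

Definition cut_discrepancy (R : realType) (n : nat) (xi : 'M[nat]_n) (p : R) : R :=
  sup [set v : R | exists s t : 'I_n -> R,
    [/\ forall i, s i = 1 \/ s i = -1,
        forall j, t j = 1 \/ t j = -1
      & v = (n%:R ^+ 2)^-1 *
            \sum_(i < n) \sum_(j < n) ((xi i j)%:R / p - 1) * s i * t j]].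

(* [theta i t] for [i < n] is the i-th oscillator at time [t]. The noise is
   additive, so the equation is an integral equation for each path; the real
   Brownian motions [B i] are projected to the torus. *)
Definition oscillator_system (R : realType) (d : measure_display)
    (Omega : measurableType d) (P : probability Omega R) (K : R) (n : nat)
    (xi : 'M[nat]_n) (p : R) (B : nat -> R -> Omega -> R)
    (theta : nat -> R -> Omega -> torus R) : Prop :=
  [/\ forall (i : 'I_n) t, 0 <= t -> measurable_fun setT (theta i t),
      independent2 P
        (sigma_of [set i | (i < n)%N] (fun i => theta i 0))
        (sigma_of [set it : nat * R | 0 <= it.2] (fun it => B it.1 it.2))
    & \forall w \ae P, forall i : 'I_n,
        {within `[0, +oo[, continuous (fun t => theta i t w)} /\
        forall t, 0 <= t ->
          theta i t w = theta i 0 w +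
            torus_pi (\int[lebesgue_measure]_(s in `[0, t])
              ((n%:R * p)^-1 * \sum_(j < n) (xi i j)%:R *
                 coupling K (theta i s w - theta j s w))) +
            torus_pi (B i t w)].

(* Main.v *)
(** The modes (1/n) sum_i cos (k theta^i + phi) of low order determine the H_{-1}
    distance between probability measures up to a small error: the unit ball of
    H_1 has a common modulus of continuity, so a discrete Fejér quasi-interpolant
    approximates it uniformly by trigonometric polynomials of bounded degree.

    By the Itô formula the empirical modes solve the same quadratic system as the
    modes of the McKean-Vlasov solution, up to a martingale of variance O(1/n)
    and a graph term; since sin (x - y) is a sum of two products, the graph term
    is bounded by the cut discrepancy, whatever the initial data. No stochastic
    integral is needed: the Euler scheme of mesh T/r yields a discrete martingale,
    to which a maximal inequality uniform in r applies, and for fixed n the scheme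
    converges along each path as r tends to infinity.

    The differences (p_k, q_k) of the modes are then compared by the Gronwall
    inequality for sum_(k <= N) (p_k^2 + q_k^2) / k^2: the dissipation absorbs the
    coupling of neighbouring modes, and the modes beyond N contribute O(1/N). *)

Require Import Defs.
From HB Require Import structures.
From mathcomp Require Import all_boot all_order all_algebra.
From mathcomp Require Import all_classical all_reals all_analysis.
From mathcomp Require Import measurable_realfun.
From mathcomp Require Import ring lra zify.

Set Implicit Arguments.
Unset Strict Implicit.
Unset Printing Implicit Defensive.

Import Order.TTheory GRing.Theory Num.Theory.
Import numFieldNormedType.Exports.

Local Open Scope classical_set_scope.
Local Open Scope ring_scope.

(** * Calculus *)

(** The initial data may depend on the graph and single degrees are not controlled, so the graph
    cannot be averaged against the configuration. The graph term is therefore estimated for an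
    arbitrary configuration. The remaining randomness is confined to the residuals of finitely many
    modes: once these are small uniformly in time, the comparison is a deterministic statement about
    one path.

    Three limits are taken in a fixed order. The constants of the Euler scheme involve the sum of
    all weights, so the mesh tends to 0 with [n] and the path fixed; it is enough that the discrete
    martingale stays small for infinitely many meshes. The truncation [N] is chosen before the
    tolerance [eta], because the Gronwall bound contains a term in [eta * N] besides the one in
    [1 / N]. Only then is [n] taken large.

    The residual is small but not differentiable in time. The energy is therefore built from the
    integrated differences of the vector fields, which stay within [eta] of the differences of the
    modes. *)

Section real_functions.
Variable R : realType.
Implicit Types (a b c e k s t x y C T : R) (f g F : R -> R).

Lemma is_derive1_continuous f df x :
  is_derive x 1 f df -> {for x, continuous f}.
Proof.
by move=> [fd _]; apply/differentiable_continuous/derivable1_diffP.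
Qed.

Lemma continuous_sqr (U : topologicalType) (f : U -> R) :
  continuous f -> continuous (fun x : U => f x ^+ 2).
Proof. by move=> fc x; apply: cvgM; exact: fc. Qed.

Lemma continuous_sum (U : topologicalType) (I : Type) (r : seq I) (F : I -> U -> R) :
  (forall i, continuous (F i)) -> continuous (fun x : U => \sum_(i <- r) F i x).
Proof.
move=> Fc; elim: r => [|i r IH] x.
  by under eq_fun do rewrite big_nil; exact: cvg_cst.
by under eq_fun do rewrite big_cons; apply: cvgD; [exact: Fc|exact: IH].
Qed.

Lemma derive_bound_lipschitz f (df : R -> R) C a b :
  (forall x, is_derive x 1 f (df x)) -> (forall x, `|df x| <= C) ->
  `|f a - f b| <= C * `|a - b|.
Proof.
move=> fd dfC.
wlog ab : a b / b <= a.
  by move=> H; have [/H//|/ltW /H] := leP b a; rewrite distrC (distrC b).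
have fc : {within `[b, a], continuous f}.
  by apply: continuous_subspaceT => x; exact: is_derive1_continuous (fd x).
have [c _ ->] := MVT_segment ab (fun x _ => fd x) fc.
by rewrite normrM ler_wpM2r.
Qed.

Lemma sin_lipschitz a b : `|sin a - sin b| <= `|a - b|.
Proof.
rewrite -[leRHS]mul1r; apply: (@derive_bound_lipschitz _ cos) => x //.
exact: cos_max.
Qed.

Lemma cos_lipschitz a b : `|cos a - cos b| <= `|a - b|.
Proof.
rewrite -[leRHS]mul1r; apply: (@derive_bound_lipschitz _ (fun x => - sin x)) => x //.
by rewrite normrN sin_max.
Qed.

Lemma norm_sin_le x : `|sin x| <= `|x|.
Proof. by have := sin_lipschitz x 0; rewrite sin0 !subr0. Qed.

Lemma onem_cosE x : 1 - cos x = 2 * sin (x / 2) ^+ 2.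
Proof.
have -> : cos x = cos (x / 2 + x / 2) by congr cos; field.
by rewrite cosD -!expr2 cos2sin2; ring.
Qed.

Lemma onem_cos_le x : 1 - cos x <= x ^+ 2 / 2.
Proof.
rewrite onem_cosE; have := norm_sin_le (x / 2).
rewrite -(@ler_pXn2r _ 2) ?nnegrE// !real_normK ?num_real// expr_div_n.
move=> h; apply: le_trans (_ : 2 * (x ^+ 2 / 2 ^+ 2) <= _); last by lra.
by rewrite ler_pM2l.
Qed.

Lemma sin_near_id x : `|x - sin x| <= `|x| ^+ 3.
Proof.
have isd y : is_derive y (1 : R) (fun y => y - sin y) (1 - cos y).
  by apply: is_deriveB.
have mvt a : 0 <= a -> `|a - sin a| <= a ^+ 3.
  move=> a0.
  have cs : {within `[0, a], continuous (fun y => y - sin y)}.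
    by apply: continuous_subspaceT => y; exact: is_derive1_continuous (isd y).
  have [c] := MVT_segment a0 (fun x _ => isd x) cs.
  rewrite in_itv/= => /andP[c0 ca]; rewrite sin0 !subr0 => ->.
  rewrite normrM (ger0_norm a0) exprSr ler_wpM2r// ger0_norm ?subr_ge0 ?cos_le1//.
  apply: (le_trans (onem_cos_le c)).
  have : c ^+ 2 <= a ^+ 2 by rewrite ler_pXn2r ?nnegrE// (le_trans c0).
  have := sqr_ge0 c; lra.
have [x0|x0] := leP 0 x; first by rewrite (ger0_norm x0) mvt.
rewrite (ltr0_norm x0); have := mvt (- x); rewrite sinN oppr_ge0 => /(_ (ltW x0)).
by rewrite -opprD normrN.
Qed.

(** From [1 - cos x = 2 sin^2 (x / 2)] and a difference of squares. Only the order 4 matters, so the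
    constant 1 stands in for the sharp [1 / 24]. *)
Lemma cos_taylor2 x : `|1 - cos x - x ^+ 2 / 2| <= x ^+ 4.
Proof.
rewrite onem_cosE.
set y := x / 2; have -> : x = 2 * y by rewrite /y; field.
have -> : 2 * sin y ^+ 2 - (2 * y) ^+ 2 / 2 = - (2 * (y - sin y) * (y + sin y)) by field.
rewrite normrN !normrM (ger0_norm (ler0n R 2)).
have h1 := sin_near_id y.
have h2 : `|y + sin y| <= 2 * `|y|.
  by apply: le_trans (ler_normD _ _) _; have := norm_sin_le y; lra.
have -> : (2 * y) ^+ 4 = 16 * (`|y| ^+ 3 * `|y|).
  rewrite -exprSr exprMn -normrX ger0_norm; last by rewrite -[4%N]/(2 * 2)%N exprM sqr_ge0.
  by congr (_ * _); ring.
have : `|y - sin y| * `|y + sin y| <= `|y| ^+ 3 * (2 * `|y|).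
  by apply: ler_pM.
have : 0 <= `|y| ^+ 3 * `|y| by rewrite mulr_ge0// exprn_ge0.
lra.
Qed.

(** Heine-Cantor through the near-covering form of compactness; only [s] is confined to the
    segment. *)
Lemma segment_unif_continuous f a b e : continuous f -> 0 < e ->
  exists2 d, 0 < d & forall s t, a <= s <= b -> `|t - s| < d -> `|f t - f s| < e.
Proof.
move=> fc e0.
pose P d x := forall t, `|t - x| < d -> `|f t - f x| < e.
have cov : \forall d \near 0^'+, `[a, b] `<=` P d.
  have /compact_near_coveringP := @segment_compact R a b.
  apply => x _.
  have e20 : 0 < e / 2 by rewrite divr_gt0.
  have /cvgrPdist_lt /(_ _ e20)/nbhs_ballP[r /= r0 xr] := fc x.
  near=> y d => t tyd.
  have yx : `|x - y| < r / 2.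
    by near: y; apply: (@cvgr_dist_lt _ R^o _ _ _ id x) => //; rewrite divr_gt0.
  have dr : d < r / 2 by near: d; apply: nbhs_right_lt; rewrite divr_gt0.
  have fx : `|f x - f y| < e / 2 by apply: xr; rewrite /ball/= (lt_trans yx)// ltr_pdivrMr// ltr_pMr// ltr1n.
  have ft : `|f x - f t| < e / 2.
    apply: xr; rewrite /ball/= -(subrKA y).
    apply: le_lt_trans (ler_normD _ _) _; rewrite (distrC y).
    by rewrite [ltRHS]splitr ltrD// (lt_trans tyd).
  rewrite -(subrKA (f x)); apply: le_lt_trans (ler_normD _ _) _.
  by rewrite (distrC (f t)) [ltRHS]splitr ltrD.
near ((0:R)^'+) => d.
exists d; first by near: d; exact: nbhs_right_gt.
move=> s t sab; have : `[a, b] `<=` P d by near: d.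
by apply; rewrite /= in_itv.
Unshelve. all: by end_near. Qed.

Lemma le_expR_mul1D (C : R) (m : nat) : 0 <= C -> (1 + C) ^+ m <= expR (C * m%:R).
Proof.
move=> C0; rewrite mulrC expRM_natl lerXn2r ?nnegrE ?addr_ge0 ?expR_ge0//.
exact: expR_ge1Dx.
Qed.

(** The factor [l] bounds the geometric sum, so that no division by [L] occurs. *)
Lemma discrete_gronwall (u : nat -> R) (L k : R) (m : nat) : 0 <= L -> 0 <= k ->
  u 0%N = 0 ->
  (forall l, (l < m)%N -> u l.+1 <= (1 + L) * u l + k) ->
  forall l, (l <= m)%N -> u l <= l%:R * k * (1 + L) ^+ l.
Proof.
move=> L0 k0 u0 ulS; elim=> [_|l IH lm]; first by rewrite u0 !mul0r.
apply: le_trans (ulS _ lm) _.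
have {}IH : (1 + L) * u l <= (1 + L) * (l%:R * k * (1 + L) ^+ l).
  by rewrite ler_pM2l ?IH ?(ltnW lm)//; lra.
apply: le_trans (lerD IH (lexx k)) _.
rewrite exprS -natr1.
have -> : (l%:R + 1) * k * ((1 + L) * (1 + L) ^+ l) =
    (1 + L) * (l%:R * k * (1 + L) ^+ l) + k * ((1 + L) * (1 + L) ^+ l) by ring.
rewrite lerD2l -{1}[k]mulr1 ler_wpM2l// -exprS exprn_ege1//.
by rewrite lerDl.
Qed.

(** The function [expR (- C * t) * E t - k * t] is nonincreasing because [expR (- C * t) <= 1]. The
    derivative is asked only inside the interval: a function built from [cint f 0] is constant to
    the left of 0, so it need not be derivable at 0. *)
Lemma gronwall (E dE : R -> R) C k T : 0 <= C -> 0 <= k -> 0 <= T -> 0 <= E 0 ->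
  {within `[0, T], continuous E} ->
  (forall t, t \in `]0, T[ -> is_derive t 1 E (dE t)) ->
  (forall t, t \in `]0, T[ -> dE t <= C * E t + k) ->
  forall t, t \in `[0, T] -> E t <= (E 0 + k * T) * expR (C * T).
Proof.
move=> C0 k0 T0 E0 cE dEP dEle t; rewrite in_itv/= => /andP[t0 tT].
pose G := fun t => expR (- C * t) * E t - k * t.
pose dG := fun t => expR (- C * t) * (dE t - C * E t) - k.
have dGP s : s \in `]0, T[ -> is_derive s 1 G (dG s).
  move=> /dEP sE; rewrite /G.
  have -> : dG s = (expR (- C * s) *: dE s + E s *: (expR (- C * s) * (- C * 1))) - k * 1.
    by rewrite /dG /GRing.scale/=; ring.
  have h1 : is_derive s 1 (fun t => expR (- C * t)) (expR (- C * s) * (- C * 1)).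
    apply: is_derive_eq.
    by rewrite /GRing.scale/=; ring.
  apply: is_derive_eq.
  by rewrite /GRing.scale/=; ring.
have cG : {within `[0, T], continuous G}.
  have c1 : {within `[0, T], continuous (fun t => expR (- C * t))}.
    apply: continuous_subspaceT => x.
    apply: continuous_comp; last exact: continuous_expR.
    by apply: cvgM; [exact: cvg_cst|exact: cvg_id].
  have c2 : {within `[0, T], continuous (fun t => k * t)}.
    apply: continuous_subspaceT => x.
    by apply: cvgM; [exact: cvg_cst|exact: cvg_id].
  by move=> x; exact: cvgB (cvgM (c1 x) (cE x)) (c2 x).
have GT : G t <= G 0.
  have dG0 x : x \in `]0, T[ -> derive1 G x <= 0.
    move=> xT; rewrite derive1E; have [_ ->] := dGP _ xT.
    rewrite /dG subr_le0.
    have h : dE x - C * E x <= k by have := dEle _ xT; lra.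
    apply: le_trans (_ : expR (- C * x) * k <= _).
      by rewrite ler_pM2l ?expR_gt0.
    rewrite -[leRHS]mul1r ler_wpM2r// -expR0 ler_expR mulNr oppr_le0 mulr_ge0//.
    by move: xT; rewrite in_itv/= => /andP[/ltW].
  have dGd x : x \in `]0, T[ -> derivable G x 1 by move=> /dGP [].
  by apply: (ler0_derive1_le_cc dGd dG0 cG) => //; rewrite in_itv/= ?lexx ?t0.
move: GT; rewrite /G mulr0 expR0 mul1r mulr0 subr0 => GT.
have e0 : expR (C * t) * expR (- C * t) = 1 by rewrite -expRD mulNr subrr expR0.
have -> : E t = expR (C * t) * (expR (- C * t) * E t) by rewrite mulrA e0 mul1r.
have {}GT : expR (- C * t) * E t <= E 0 + k * T.
  have : k * t <= k * T by rewrite ler_wpM2l.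
  lra.
rewrite mulrC; apply: le_trans (_ : (E 0 + k * T) * expR (C * t) <= _).
  by rewrite ler_pM2r ?expR_gt0.
by rewrite ler_wpM2l ?addr_ge0 ?mulr_ge0// ler_expR ler_wpM2l.
Qed.

End real_functions.

(** * Integrals of continuous functions over segments *)

Section segment_integral.
Variable R : realType.
Implicit Types (a b c k t x T C : R) (f g F : R -> R).

(** Not oriented: the value is 0 when [b < a]. *)
Definition cint f a b : R := \int[lebesgue_measure]_(x in `[a, b]) f x.

Lemma cint_integrable f a b : continuous f ->
  lebesgue_measure.-integrable `[a, b] (EFin \o f).
Proof.
move=> fc; apply: continuous_compact_integrable; first exact: segment_compact.
exact: continuous_subspaceT.
Qed.

Lemma eq_cint f g a b : (forall x, a <= x <= b -> f x = g x) ->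
  cint f a b = cint g a b.
Proof.
by move=> fg; apply: eq_Rintegral => x; rewrite inE/= in_itv/= => /fg.
Qed.

Lemma cint_cst a b c : a <= b -> cint (fun=> c) a b = c * (b - a).
Proof.
rewrite /cint Rintegral_cst; last exact: measurable_itv.
move=> ab; congr (_ * _).
etransitivity; first exact: (congr1 fine (lebesgue_measure_itv `[a, b])).
rewrite /= lte_fin.
by move: ab; rewrite le_eqVlt => /predU1P[->|->]; rewrite ?ltxx ?subrr.
Qed.

Lemma cintxx f a : cint f a a = 0.
Proof. by rewrite /cint set_itv1 Rintegral_set1. Qed.

Lemma cintD f g a b : continuous f -> continuous g ->
  cint (fun x => f x + g x) a b = cint f a b + cint g a b.
Proof. by move=> fc gc; apply: RintegralD => //; exact: cint_integrable. Qed.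

Lemma cintZ f a b k : continuous f -> cint (fun x => k * f x) a b = k * cint f a b.
Proof. by move=> fc; apply: RintegralZl => //; exact: cint_integrable. Qed.

Lemma cintB f g a b : continuous f -> continuous g ->
  cint (fun x => f x - g x) a b = cint f a b - cint g a b.
Proof. by move=> fc gc; apply: RintegralB => //; exact: cint_integrable. Qed.

Lemma le_cint f g a b : continuous f -> continuous g ->
  (forall x, a <= x <= b -> f x <= g x) -> cint f a b <= cint g a b.
Proof.
by move=> fc gc fg; apply: le_Rintegral => //; exact: cint_integrable.
Qed.

Lemma cint_ge0 f a b : (forall x, a <= x <= b -> 0 <= f x) -> 0 <= cint f a b.
Proof. by move=> f0; exact: Rintegral_ge0. Qed.

Lemma norm_cint_le f a b C : continuous f -> a <= b ->
  (forall x, a <= x <= b -> `|f x| <= C) -> `|cint f a b| <= C * (b - a).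
Proof.
move=> fc ab fC; rewrite ler_norml -mulNr -!cint_cst//.
by rewrite !le_cint//; try (by move=> ?; exact: cvg_cst);
  move=> x /fC; rewrite ler_norml => /andP[].
Qed.

Lemma cint_cat f a b c : continuous f -> a <= b -> b <= c ->
  cint f a c = cint f a b + cint f b c.
Proof.
move=> fc ab bc; apply/eqP; rewrite addrC -subr_eq; apply/eqP.
rewrite /cint Rintegral_itvB; [|exact: cint_integrable|by rewrite bnd_simp..].
rewrite Rintegral_itv_obnd_cbnd//.
apply: integrableS (cint_integrable b c fc) => //.
by apply: subset_itvr; rewrite bnd_simp.
Qed.

Lemma cint_is_derive f a t : continuous f -> a < t ->
  is_derive t 1 (cint f a) (f t).
Proof.
move=> fc at_.
have tt1 : t < t + 1 by rewrite ltrDl.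
have [] := continuous_FTC1_closed tt1 (cint_integrable a (t + 1) fc) at_ (fc t).
by rewrite -/(cint f a) derive1E => d e; exact: (DeriveDef d e).
Qed.

Lemma cint_continuous f a b : continuous f -> a <= b ->
  {within `[a, b], continuous (cint f a)}.
Proof.
by move=> fc ab; apply: parameterized_integral_continuous => //; exact: cint_integrable.
Qed.

Lemma cint_FTC2 F f a b : continuous f -> (forall x, is_derive x 1 F (f x)) ->
  a <= b -> cint f a b = F b - F a.
Proof.
move=> fc Ff; rewrite le_eqVlt => /predU1P[->|ab]; first by rewrite cintxx subrr.
rewrite /cint /Rintegral (@continuous_FTC2 _ f F)//.
- exact: continuous_subspaceT.
- split=> [x _| |]; first by have [] := Ff x.
  + by apply: cvg_at_right_filter; exact: is_derive1_continuous (Ff a).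
  + by apply: cvg_at_left_filter; exact: is_derive1_continuous (Ff b).
- by move=> x _; rewrite derive1E; have [_ ->] := Ff x.
Qed.

End segment_integral.

(** * Functions on the torus *)

Section torus_functions.
Variable R : realType.
Notation T := (torus R).
Implicit Types (f : R -> R) (h : T -> R) (x y : T) (c e phi t u v : R) (k n : nat).

Lemma torus_piD u v : torus_pi (u + v) = torus_pi u + torus_pi v.
Proof. exact: Quotient.pi_add. Qed.

Lemma torus_piB u v : torus_pi (u - v) = torus_pi u - torus_pi v.
Proof. by rewrite torus_piD; congr (_ + _); exact: Quotient.pi_opp. Qed.

Lemma torus_pi_repr x : torus_pi (repr x : R) = x.
Proof. exact: reprK. Qed.

Lemma torus_pi_eqP u v :
  reflect (exists m : int, u = v + m%:~R * (2 * pi)) (torus_pi u == torus_pi v).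
Proof.
rewrite /torus_pi -Quotient.idealrBE.
apply: (iffP (asboolP _)) => -[m uv]; exists m.
  by rewrite -uv addrCA subrr addr0.
by rewrite uv addrAC subrr add0r.
Qed.

Definition periodic2pi f := forall u, f (u + 2 * pi) = f u.

Lemma periodic2pi_int f u (m : int) : periodic2pi f -> f (u + m%:~R * (2 * pi)) = f u.
Proof.
move=> fp; elim: m u => [|m IH|m IH] u; first by rewrite mul0r addr0.
  rewrite -[RHS]IH -[RHS]fp; congr f.
  by rewrite intS intrD; ring.
rewrite -[LHS]fp -[RHS]IH; congr f.
by rewrite intS opprD intrD; ring.
Qed.

Lemma periodic2pi_repr f u : periodic2pi f -> f (repr (torus_pi u) : R) = f u.
Proof.
move=> fp; have /eqP/torus_pi_eqP[m ->] := torus_pi_repr (torus_pi u).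
exact: periodic2pi_int.
Qed.

Lemma periodic2pi_reprD f x u : periodic2pi f ->
  f (repr (x + torus_pi u) : R) = f ((repr x : R) + u).
Proof. by move=> fp; rewrite -{1}(torus_pi_repr x) -torus_piD periodic2pi_repr. Qed.

Lemma torus_pi_continuous : continuous (@torus_pi R).
Proof. by apply/continuousP => A oA; exact: oA. Qed.

Lemma torus_continuousP h : continuous (h \o @torus_pi R) -> continuous h.
Proof.
move=> hc; apply/continuousP => A oA.
by move/continuousP : hc => /(_ _ oA); rewrite comp_preimage.
Qed.

Lemma torus_continuous_measurable h : continuous h -> measurable_fun setT h.
Proof.
move=> /continuousP hc; apply: (measurability _ (measurable_realfun.RGenOpens.measurableE R)).
move=> _ [_ [a [b ->] <-]]; rewrite setTI; apply: sub_sigma_algebra.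
exact/hc/interval_open.
Qed.

Lemma periodic_continuous_repr f : periodic2pi f -> continuous f ->
  continuous (fun x => f (repr x : R)).
Proof.
move=> fp fc; apply: torus_continuousP.
by rewrite (_ : _ \o _ = f)//; apply/funext => u /=; exact: periodic2pi_repr.
Qed.

(** Phase 0 gives the cosine and phase [- (pi / 2)] the sine. With a free amplitude and phase, the
    family is closed under derivation. *)
Definition wave c k phi : T -> R := fun x => c * cos (k%:R * (repr x : R) + phi).

Lemma wave_periodic c k phi : periodic2pi (fun u => c * cos (k%:R * u + phi)).
Proof.
move=> u; rewrite mulrDr addrAC; congr (_ * _).
have -> : k%:R * (2 * pi) = (Posz k)%:~R * (2 * pi) :> R by rewrite pmulrn.
by apply: (@periodic2pi_int (fun u => cos u)) => {}u; rewrite mulr_natl cosD2pi.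
Qed.

Lemma is_derive_wave c k phi u :
  is_derive u 1 (fun u => c * cos (k%:R * u + phi)) (c * k%:R * cos (k%:R * u + (phi + pi / 2))).
Proof.
rewrite addrA cosDpihalf.
apply: is_derive_eq.
by rewrite /GRing.scale/=; ring.
Qed.

Lemma wave_continuous c k phi : continuous (wave c k phi).
Proof.
apply: (periodic_continuous_repr (@wave_periodic c k phi)) => u.
exact: is_derive1_continuous (is_derive_wave c k phi u).
Qed.

Lemma wave_measurable c k phi : measurable_fun setT (wave c k phi).
Proof. apply: torus_continuous_measurable; exact: wave_continuous. Qed.

Lemma wave_pi c k phi u : wave c k phi (torus_pi u) = c * cos (k%:R * u + phi).
Proof. exact: (periodic2pi_repr u (@wave_periodic c k phi)). Qed.

Lemma torus_wave_derive c k phi :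
  torus_derive (wave c k phi) = wave (c * k%:R) k (phi + pi / 2).
Proof.
apply/funext => x; rewrite /torus_derive /wave.
rewrite (_ : (fun e => _) = (fun e => c * cos (k%:R * e + (k%:R * (repr x : R) + phi)))); last first.
  apply/funext => e; rewrite (@periodic2pi_reprD _ x e (@wave_periodic c k phi)).
  by rewrite mulrDr -addrA addrCA.
rewrite derive1E; have [_ ->] := is_derive_wave c k (k%:R * (repr x : R) + phi) 0.
by rewrite mulr0 add0r addrA.
Qed.

Lemma wave_torus_C1 c k phi : torus_C1 (wave c k phi).
Proof.
split; last by rewrite torus_wave_derive; exact: wave_continuous.
move=> x; rewrite /wave.
rewrite (_ : (fun e => _) = (fun e => c * cos (k%:R * e + (k%:R * (repr x : R) + phi)))); last first.
  apply/funext => e; rewrite (@periodic2pi_reprD _ x e (@wave_periodic c k phi)).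
  by rewrite mulrDr -addrA addrCA.
by have [] := is_derive_wave c k (k%:R * (repr x : R) + phi) 0.
Qed.

Lemma wave_torus_smooth c k phi : torus_smooth (wave c k phi).
Proof.
move=> n; suff [c' [phi' ->]] : exists c' phi',
    iter n (@torus_derive R) (wave c k phi) = wave c' k phi' by exact: wave_torus_C1.
elim: n => [|n [c' [phi' /= ->]]]; first by exists c, phi.
by exists (c' * k%:R), (phi' + pi / 2); exact: torus_wave_derive.
Qed.

Lemma wave_C1_zero_mean c k phi : (0 < k)%N -> C1_zero_mean (wave c k phi).
Proof.
move=> k0; split; first exact: wave_torus_C1.
rewrite /torus_integral; under eq_Rintegral do rewrite wave_pi.
rewrite -[LHS]/(cint _ _ _).
have kn0 : k%:R != 0 :> R by rewrite pnatr_eq0 -lt0n.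
have dF u : is_derive u (1 : R) (fun u => c / k%:R * cos (k%:R * u + (phi - pi / 2)))
    (c * cos (k%:R * u + phi)).
  by have := is_derive_wave (c / k%:R) k (phi - pi / 2) u; rewrite divfK// subrK.
rewrite (cint_FTC2 _ dF) ?mulr_ge0 ?pi_ge0//.
  have := wave_periodic (c / k%:R) k (phi - pi / 2) 0.
  by rewrite add0r => ->; rewrite subrr.
by move=> u; exact: is_derive1_continuous (is_derive_wave c k phi u).
Qed.

(** Uses only [cos^2 <= 1] and [sqrt (2 pi) <= 2 pi]; the exact factor would be [sqrt pi]. *)
Lemma C1_norm1_wave_le c k phi : C1_norm1 (wave c k phi) <= `|c| * k%:R * (2 * pi).
Proof.
have pi1 : 1 <= 2 * pi :> R by have := @pi_ge2 R; lra.
rewrite /C1_norm1 torus_wave_derive /torus_integral.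
under eq_Rintegral do rewrite wave_pi.
rewrite -[X in Num.sqrt X]/(cint _ _ _).
set I := cint _ _ _.
have I_le : I <= (c * k%:R) ^+ 2 * (2 * pi).
  rewrite /I -[2 * pi in leRHS]subr0 -cint_cst; last by rewrite mulr_ge0// pi_ge0.
  apply: le_cint.
  - apply: continuous_sqr => u.
    exact: is_derive1_continuous (is_derive_wave _ k _ u).
  - by move=> ?; exact: cvg_cst.
  - move=> u _; rewrite exprMn; apply: ler_piMr; first exact: sqr_ge0.
    by rewrite cos2sin2 gerBl sqr_ge0.
apply: le_trans (_ : Num.sqrt ((`|c| * k%:R * (2 * pi)) ^+ 2) <= _).
  rewrite ler_wsqrtr//; apply: le_trans I_le _.
  rewrite [leRHS]exprMn [(`|c| * _) ^+ 2]exprMn real_normK ?num_real// -exprMn.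
  by apply: ler_wpM2l; rewrite ?sqr_ge0// ler_eXnr.
by rewrite sqrtr_sqr ger0_norm// !mulr_ge0// pi_ge0.
Qed.

Lemma coupling_pi K u v : coupling K (torus_pi u - torus_pi v) = - K * sin (u - v).
Proof.
rewrite -torus_piB /coupling; congr (_ * _); apply: (@periodic2pi_repr (fun u => sin u)) => {}u.
by rewrite mulr_natl sinD2pi.
Qed.

(** Expresses the coupling through waves, hence through continuous functions on the torus, although
    its definition goes through [repr]. *)
Lemma couplingE K x y : coupling K (x - y) =
  - K * (wave 1 1 (- (pi / 2)) x * wave 1 1 0 y - wave 1 1 0 x * wave 1 1 (- (pi / 2)) y).
Proof.
rewrite -{1}(torus_pi_repr x) -{1}(torus_pi_repr y) coupling_pi.
by rewrite /wave !mul1r !addr0 !cosBpihalf sinB.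
Qed.

End torus_functions.

(** * Fejér quasi-interpolation *)

Section fejer.
Variable R : realType.
Implicit Types (a c t u v x eta C : R) (f : R -> R).

Lemma sin_neq0_in_pi t : 0 < `|t| < pi -> sin t != 0.
Proof.
move=> tpi; suff : sin `|t| != 0.
  have [t0|t0] := leP 0 t; first by rewrite ger0_norm.
  by rewrite ltr0_norm// sinN oppr_eq0.
by rewrite gt_eqF// sin_gt0_pi.
Qed.

Lemma sum_cos_arithmetic t u n : 2 * sin (t / 2) * (\sum_(m < n) cos (m%:R * t + u)) =
  sin (n%:R * t + u - t / 2) - sin (u - t / 2).
Proof.
elim: n => [|n IH]; first by rewrite big_ord0 mulr0 mul0r add0r subrr.
rewrite big_ord_recr /= mulrDr IH.
have -> : n.+1%:R * t + u - t / 2 = (n%:R * t + u) + t / 2 by rewrite -natr1; field.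
by rewrite (sinD (_ + _) (t / 2)) (sinB (n%:R * t + u)); ring.
Qed.

(** Discrete orthogonality: the quadrature at [M] equispaced nodes is exact for frequencies below
    [M]. The closed form of the sum vanishes by periodicity, and [|p| < M] keeps its denominator
    [sin (t / 2)] away from 0. *)
Lemma sum_cos_equispaced (M : nat) (p : int) v : (`|p| < M)%N ->
  \sum_(m < M) cos (p%:~R * (v - m%:R * (2 * pi / M%:R))) = (p == 0)%:R * M%:R :> R.
Proof.
move=> pM; have M0 : (0 < M)%N by apply: leq_trans pM.
have Mn0 : M%:R != 0 :> R by rewrite pnatr_eq0 -lt0n.
have [->|p0] := eqVneq p 0.
  under eq_bigr do rewrite mul0r cos0.
  by rewrite sumr_const card_ord mul1r.
rewrite mul0r; set t : R := - (p%:~R * (2 * pi / M%:R)).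
have st : sin (t / 2) != 0.
  have e : `|t / 2| = `|p|%N%:R / M%:R * pi.
    have -> : t / 2 = - (p%:~R / M%:R * pi) by rewrite /t; field.
    rewrite normrN !normrM normrV ?unitfE// (ger0_norm (pi_ge0 R)) normr_nat.
    by rewrite natr_absz intr_norm.
  apply: sin_neq0_in_pi; rewrite e mulr_gt0 ?pi_gt0 ?divr_gt0 ?ltr0n ?absz_gt0//=.
  by rewrite -[ltRHS]mul1r ltr_pM2r ?pi_gt0// ltr_pdivrMr ?ltr0n// mul1r ltr_nat.
apply: (mulfI (_ : 2 * sin (t / 2) != 0)); first by rewrite mulf_neq0.
have -> : \sum_(m < M) cos (p%:~R * (v - m%:R * (2 * pi / M%:R))) =
    \sum_(m < M) cos (m%:R * t + p%:~R * v).
  by apply: eq_bigr => m _; congr cos; rewrite /t; ring.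
rewrite mulr0 sum_cos_arithmetic.
have -> : M%:R * t + p%:~R * v - t / 2 = (p%:~R * v - t / 2) + (- p)%:~R * (2 * pi).
  by rewrite /t intrN; field.
rewrite (@periodic2pi_int _ (fun u => sin u)) ?subrr// => u.
by rewrite mulr_natl sinD2pi.
Qed.

(** This is [|sum_(j < N) e^(i j t)|^2 / N]. The square gives positivity, and the double sum lets
    discrete orthogonality act term by term. *)
Definition fejer (N : nat) t : R :=
  N%:R^-1 * \sum_(j < N) \sum_(l < N) cos ((Posz j - Posz l)%:~R * t).

Lemma fejer_ge0 N t : 0 <= fejer N t.
Proof.
rewrite mulr_ge0 ?invr_ge0//.
suff -> : \sum_(j < N) \sum_(l < N) cos ((Posz j - Posz l)%:~R * t) =
  (\sum_(j < N) cos (j%:R * t)) ^+ 2 + (\sum_(j < N) sin (j%:R * t)) ^+ 2.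
  by rewrite addr_ge0 ?sqr_ge0.
rewrite !expr2 !mulr_suml -big_split/=; apply: eq_bigr => j _.
rewrite !mulr_sumr -big_split/=; apply: eq_bigr => l _.
by rewrite intrB mulrBl cosB.
Qed.

Definition equispaced (M m : nat) : R := m%:R * (2 * pi / M%:R).

(** The kernel has frequencies at most [N - 1], and its product with [cos] at most [N]; this is why
    [N.+1] nodes are used. *)
Lemma absz_ord_subD N (j l : 'I_N) (e : int) : (`|e| <= 1)%N ->
  (absz (Posz j - Posz l + e)%R < N.+1)%N.
Proof. by have := ltn_ord j; have := ltn_ord l; lia. Qed.

Lemma sum_fejer N v : (0 < N)%N ->
  \sum_(m < N.+1) fejer N (v - equispaced N.+1 m) = N.+1%:R.
Proof.
move=> N0; rewrite /fejer -mulr_sumr exchange_big/=.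
under eq_bigr do rewrite exchange_big/=.
have -> : \sum_(j < N) \sum_(l < N) \sum_(m < N.+1)
    cos ((Posz j - Posz l)%:~R * (v - equispaced N.+1 m)) =
    \sum_(j < N) N.+1%:R.
  apply: eq_bigr => j _; rewrite (bigD1 j)//= [X in _ + X]big1 => [|l lj].
    rewrite addr0 sum_cos_equispaced ?subrr// mul1r//.
  rewrite sum_cos_equispaced; last by have := @absz_ord_subD N j l 0; rewrite addr0; exact.
  by rewrite subr_eq0 eqz_nat eq_sym [_ == _](negbTE lj) mul0r.
by rewrite sumr_const card_ord mulrnAr -mulrnAl -[_ *+ N]mulr_natr mulVf ?mul1r// pnatr_eq0 -lt0n.
Qed.

Lemma count_succ_pairs N : (0 < N)%N ->
  \sum_(j < N) \sum_(l < N) (Posz j - Posz l + 1 == 0)%:R = N%:R - 1 :> R.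
Proof.
case: N => // N _; rewrite big_ord_recr/= [X in _ + X]big1 ?addr0; last first.
  by move=> l _; case: eqP => // ?; exfalso; have := ltn_ord l; lia.
rewrite (eq_bigr (fun=> 1)) => [|j _].
  by rewrite sumr_const card_ord -natr1 addrK.
rewrite (bigD1 (lift ord0 j))//= [X in _ + X]big1 => [|l].
  by rewrite /bump/= addr0; case: eqP => // /eqP; lia.
move=> /eqP lj; case: eqP => // h; exfalso; apply: lj; apply: val_inj.
by rewrite /= /bump/=; lia.
Qed.

(** In fact an equality: the first Fourier coefficient of the kernel is [1 - 1 / N], since each of
    the shifts 1 and -1 is realised by [N - 1] pairs of indices. *)
Lemma sum_cos_fejer N v : (0 < N)%N ->
  (N.+1%:R * (1 - N%:R^-1) <=
   \sum_(m < N.+1) cos (v - equispaced N.+1 m) * fejer N (v - equispaced N.+1 m)).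
Proof.
move=> N0; have Nn0 : N%:R != 0 :> R by rewrite pnatr_eq0 -lt0n.
have prod (j l : nat) t : cos t * cos ((Posz j - Posz l)%:~R * t) =
   2^-1 * cos ((Posz j - Posz l + 1)%:~R * t) + 2^-1 * cos ((Posz j - Posz l - 1)%:~R * t).
  set a := Posz j - Posz l; rewrite intrD (intrB _ a) mulrDl mulrBl mul1r.
  by rewrite (cosD (a%:~R * t)) (cosB (a%:~R * t)); field.
have -> : \sum_(m < N.+1) cos (v - equispaced N.+1 m) * fejer N (v - equispaced N.+1 m) =
  N%:R^-1 * \sum_(j < N) \sum_(l < N)
   (2^-1 * ((Posz j - Posz l + 1 == 0)%:R * N.+1%:R) +
    2^-1 * ((Posz j - Posz l - 1 == 0)%:R * N.+1%:R)).
  under eq_bigr => m _ do rewrite /fejer mulrCA mulr_sumr.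
  rewrite -mulr_sumr exchange_big /=; congr (_ * _); apply: eq_bigr => j _.
  under eq_bigr do rewrite mulr_sumr.
  rewrite exchange_big; apply: eq_bigr => l _ /=.
  under eq_bigr do rewrite prod.
  rewrite big_split/= -!mulr_sumr !sum_cos_equispaced// absz_ord_subD//.
under eq_bigr do rewrite big_split/= -!mulr_sumr -!mulr_suml.
rewrite big_split/= -!mulr_sumr -!mulr_suml count_succ_pairs// exchange_big/=.
rewrite [X in _ + _ * (X * _)](_ : _ = N%:R - 1); last first.
  rewrite -count_succ_pairs//; apply: eq_bigr => j _; apply: eq_bigr => l _.
  by congr (_ %:R); congr (nat_of_bool _); lia.
by rewrite le_eqVlt; apply/orP; left; apply/eqP; field.
Qed.

(* Korovkin: the kernel is nonnegative with constant mass, so only the mean of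
   [1 - cos] against it matters. *)
Lemma fejer_quasi_interpolant f eta C N u : 0 <= C -> (0 < N)%N ->
  (forall u v, `|f u - f v| <= eta + C * (1 - cos (u - v))) ->
  `|f u - N.+1%:R^-1 * \sum_(m < N.+1) f (equispaced N.+1 m) * fejer N (u - equispaced N.+1 m)|
    <= eta + C / N%:R.
Proof.
move=> C0 N0 fC; have M0 : 0 < N.+1%:R :> R by rewrite ltr0n.
rewrite -(ler_pM2l M0) -{1}(ger0_norm (ltW M0)) -normrM mulrBr mulrA divff ?gt_eqF// mul1r.
rewrite -{1}(sum_fejer u N0) mulr_suml -sumrB.
apply: le_trans (ler_norm_sum _ _ _) _.
apply: le_trans (_ : \sum_(m < N.+1)
    ((eta + C) * fejer N (u - equispaced N.+1 m) -
      C * (cos (u - equispaced N.+1 m) * fejer N (u - equispaced N.+1 m))) <= _).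
  apply: ler_sum => m _; rewrite [X in X - _]mulrC -mulrBl normrM (ger0_norm (fejer_ge0 _ _)).
  apply: le_trans (ler_wpM2r (fejer_ge0 _ _) (fC _ _)) _.
  by rewrite le_eqVlt; apply/orP; left; apply/eqP; ring.
rewrite sumrB -[X in X - _]mulr_sumr -[X in _ - X]mulr_sumr sum_fejer//.
have := ler_wpM2l C0 (sum_cos_fejer u N0).
lra.
Qed.

End fejer.

(** * A common modulus of continuity for the unit ball of H_1 *)

Section H1_functions.
Variable R : realType.
Notation T := (torus R).
Implicit Types (h w : T -> R) (x y : T) (c e eta lam u v : R).

Lemma torus_pi_surj x : exists2 u, 0 <= u <= 2 * pi & torus_pi u = x.
Proof.
have p0 : 0 < 2 * pi :> R by rewrite mulr_gt0// pi_gt0.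
pose r : R := repr x; pose m := Num.floor (r / (2 * pi)).
exists (r - m%:~R * (2 * pi)).
  have /andP[h1 h2] : m%:~R <= r / (2 * pi) < (m + 1)%:~R := Num.Theory.floor_itv (r / (2 * pi)).
  rewrite ler_pdivlMr// in h1; rewrite ltr_pdivrMr// intrD mulrDl mul1r in h2.
  by apply/andP; split; lra.
rewrite -[RHS]torus_pi_repr; apply/eqP/torus_pi_eqP; exists (- m).
by rewrite intrN mulNr.
Qed.

Lemma torus_derivable_pi w u : torus_derivable w ->
  is_derive u 1 (fun u => w (torus_pi u)) (torus_derive w (torus_pi u)).
Proof.
move=> wd; have := wd (torus_pi u); rewrite /torus_derive derive1E.
have E : (fun t => t^-1 *: (w (torus_pi u + torus_pi (t *: 1 + 0)) - w (torus_pi u + torus_pi 0))) =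
  (fun t : R => t^-1 *: (w (torus_pi (t *: 1 + u)) - w (torus_pi u))).
  by apply/funext => t; rewrite -!torus_piD !addr0 (addrC u).
rewrite /derivable /derive /= E => cv.
by apply: DeriveDef.
Qed.

(** Optimising in [lam] would give the Hölder bound [2 sqrt (u - v)]; a free [lam] avoids the root.
    The bound 2 on the norm leaves room for approximating sequences whose norms only converge to
    some [c <= 1]. *)
Lemma C1_increment_le w lam u v : torus_C1 w -> C1_norm1 w <= 2 -> 0 < lam ->
  0 <= v -> v <= u -> u <= 2 * pi ->
  `|w (torus_pi u) - w (torus_pi v)| <= lam * (u - v) / 2 + 2 / lam.
Proof.
move=> [wd wc] w2 l0 v0 vu u2.
pose g a := torus_derive w (torus_pi a).
have gc : continuous g.
  by move=> a; apply: continuous_comp; [exact: torus_pi_continuous|exact: wc].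
have fd a : is_derive a (1 : R) (fun a => w (torus_pi a)) (g a) := torus_derivable_pi a wd.
have g2c := continuous_sqr gc.
have I4 : cint (fun a => g a ^+ 2) 0 (2 * pi) <= 4.
  move: w2; rewrite /C1_norm1 -[torus_integral _]/(cint (fun a => g a ^+ 2) 0 (2 * pi)).
  have I0 : 0 <= cint (fun a => g a ^+ 2) 0 (2 * pi) by apply: cint_ge0 => a _; exact: sqr_ge0.
  move=> s2; rewrite -(sqr_sqrtr I0) (_ : 4 = 2 ^+ 2); last by rewrite -natrX.
  by rewrite ler_pXn2r// nnegrE ?sqrtr_ge0.
have Ivu : cint (fun a => g a ^+ 2) v u <= 4.
  apply: le_trans I4; rewrite (cint_cat g2c v0 (le_trans vu u2)) (cint_cat g2c vu u2).
  have : 0 <= cint (fun a => g a ^+ 2) 0 v by apply: cint_ge0 => a _; exact: sqr_ge0.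
  have : 0 <= cint (fun a => g a ^+ 2) u (2 * pi) by apply: cint_ge0 => a _; exact: sqr_ge0.
  lra.
rewrite -(cint_FTC2 gc fd vu).
(* AM-GM in place of the Cauchy-Schwarz inequality *)
pose G a := lam / 2 + (2 * lam)^-1 * g a ^+ 2.
have c1 : continuous (fun a : R => (2 * lam)^-1 * g a ^+ 2).
  by move=> a; apply: cvgM; [exact: cvg_cst|exact: g2c].
have c0 : continuous (fun _ : R => lam / 2) by move=> a; exact: cvg_cst.
have Gc : continuous G by move=> a; apply: cvgD; [exact: c0|exact: c1].
have gG a : `|g a| <= G a.
  have : 0 <= (lam - `|g a|) ^+ 2 / (2 * lam) by rewrite divr_ge0 ?sqr_ge0// mulr_ge0// ltW.
  suff -> : (lam - `|g a|) ^+ 2 / (2 * lam) = G a - `|g a| by rewrite subr_ge0.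
  rewrite /G sqrrB real_normK ?num_real//; field.
  by rewrite gt_eqF.
apply: le_trans (_ : cint G v u <= _).
  rewrite ler_norml -(mulN1r (cint G v u)) -cintZ//; apply/andP; split; apply: le_cint => //.
  - by move=> a; apply: cvgM; [exact: cvg_cst|exact: Gc].
  - by move=> a _; rewrite mulN1r; have := gG a; rewrite ler_norml => /andP[? _]; lra.
  - by move=> a _; exact: le_trans (ler_norm _) (gG a).
rewrite /G cintD// cint_cst// cintZ//.
have : (2 * lam)^-1 * cint (fun a => g a ^+ 2) v u <= (2 * lam)^-1 * 4.
  by rewrite ler_pM2l// invr_gt0 mulr_gt0.
have -> : (2 * lam)^-1 * 4 = 2 / lam by field; rewrite gt_eqF.
have -> : lam / 2 * (u - v) = lam * (u - v) / 2 by field.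
lra.
Qed.

Lemma H1_increment_le h c lam u v : has_H1_norm h c -> c <= 1 -> 0 < lam ->
  0 <= v -> v <= u -> u <= 2 * pi ->
  `|h (torus_pi u) - h (torus_pi v)| <= lam * (u - v) / 2 + 2 / lam.
Proof.
move=> [w [wC1 _ wh wc]] c1 l0 v0 vu u2.
have cv : `|w k (torus_pi u) - w k (torus_pi v)| @[k --> \oo] -->
    `|h (torus_pi u) - h (torus_pi v)|.
  by apply: cvg_norm; apply: cvgB; exact: wh.
apply: cvgr_to_le cv _.
have : \forall k \near \oo, C1_norm1 (w k) < 2.
  by apply: (cvgr_lt c) => //; lra.
apply: filterS => k /ltW k2; apply: C1_increment_le => //.
by have [] := wC1 k.
Qed.

(** There are three regimes: close points, points close across the period, and far points, where
    [1 - cos] is bounded below. A modulus in [1 - cos] is what can be summed exactly against the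
    Fejér kernel. *)
Lemma H1_modulus eta : 0 < eta -> exists2 C : R, 0 <= C &
  forall h c, has_H1_norm h c -> c <= 1 -> forall u v,
  `|h (torus_pi u) - h (torus_pi v)| <= eta + C * (1 - cos (u - v)).
Proof.
(* This makes [2 / lam = eta / 4], small enough to be paid twice when the increment is split at
   0. *)
move=> e0; pose lam := 8 / eta; have l0 : 0 < lam by rewrite divr_gt0.
pose rho := Num.min (eta / lam) 1.
have r0 : 0 < rho by rewrite lt_min divr_gt0 ?ltr01.
have r1 : rho <= 1 by rewrite ge_min lexx orbT.
have re : lam * rho <= eta by rewrite mulrC -ler_pdivlMr// ge_min lexx.
have pi2 := @pi_ge2 R.
have cr : 0 < 1 - cos rho.
  rewrite subr_gt0 -[ltRHS]cos0 ltr_cos// in_itv/=; lra.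
pose C := (lam * pi + 2 / lam) / (1 - cos rho).
have C0 : 0 <= C.
  apply: divr_ge0 (ltW cr); apply: addr_ge0; last by rewrite divr_ge0// ltW.
  by rewrite mulr_ge0 ?pi_ge0// ltW.
exists C => // h c hc c1.
have l2 : 2 / lam = eta / 4 by rewrite /lam; field; rewrite gt_eqF.
have main u v : 0 <= v -> v <= u -> u <= 2 * pi ->
    `|h (torus_pi u) - h (torus_pi v)| <= eta + C * (1 - cos (u - v)).
  move=> v0 vu u2; have Cc : 0 <= C * (1 - cos (u - v)) by rewrite mulr_ge0// subr_ge0 cos_le1.
  have [zr|rz] := leP (u - v) rho.
    apply: le_trans (H1_increment_le hc c1 l0 v0 vu u2) _.
    have : lam * (u - v) <= lam * rho by rewrite ler_pM2l.
    by rewrite l2; lra.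
  (* Points close across the period are joined through the class of 0 and [2 * pi]. *)
  have [zr|zr] := leP (2 * pi - rho) (u - v).
    have p2 : torus_pi (2 * pi) = torus_pi 0 :> T.
      by apply/eqP/torus_pi_eqP; exists 1; rewrite add0r mul1r.
    have h1 := H1_increment_le hc c1 l0 (le_trans v0 vu) u2 (lexx _).
    have h2 := H1_increment_le hc c1 l0 (lexx 0) v0 (le_trans vu u2).
    rewrite p2 in h1.
    rewrite -(subrKA (h (torus_pi 0))); apply: le_trans (ler_normD _ _) _.
    rewrite distrC; rewrite [X in _ + X]distrC.
    have : lam * (2 * pi - u + v) <= lam * rho by rewrite ler_pM2l//; lra.
    by rewrite l2 in h1 h2; lra.
  apply: le_trans (H1_increment_le hc c1 l0 v0 vu u2) _.
  have cc : cos (u - v) <= cos rho.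
    have [zp|zp] := leP (u - v) pi.
      by apply: ltW; rewrite ltr_cos ?in_itv//=; lra.
    have -> : cos (u - v) = cos (2 * pi - (u - v)).
      by rewrite -[RHS]cosN opprB -[RHS]cosD2pi; congr cos; ring.
    by apply: ltW; rewrite ltr_cos ?in_itv//=; lra.
  have : C * (1 - cos rho) <= C * (1 - cos (u - v)) by rewrite ler_wpM2l//; lra.
  rewrite {1}/C divfK ?gt_eqF//.
  have : lam * (u - v) <= lam * (2 * pi) by rewrite ler_pM2l//; lra.
  lra.
move=> u v.
have [u' u'I Eu] := torus_pi_surj (torus_pi u).
have [v' v'I Ev] := torus_pi_surj (torus_pi v).
have -> : cos (u - v) = cos (u' - v').
  move/eqP/torus_pi_eqP : Eu => [m ->]; move/eqP/torus_pi_eqP : Ev => [m' ->].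
  have -> : u + m%:~R * (2 * pi) - (v + m'%:~R * (2 * pi)) = u - v + (m - m')%:~R * (2 * pi).
    by rewrite intrB; ring.
  by rewrite (@periodic2pi_int _ (fun u => cos u))// => a; rewrite mulr_natl cosD2pi.
rewrite -Eu -Ev; have /andP[? ?] := u'I; have /andP[? ?] := v'I.
have [vu|/ltW uv] := leP v' u'; first exact: main.
by rewrite distrC -cosN opprB; exact: main.
Qed.

End H1_functions.

(** * Fourier modes and the negative Sobolev distance *)

Section unit_mass_integral.
Context (R : realType) (d : measure_display) (T : measurableType d).
Variable (mu : {measure set T -> \bar R}).
Hypothesis mu1 : mu setT = 1%E.
Implicit Types (f g : T -> R) (M c : R).

(** The sigma-algebra is the one carried by the type [T], so that over the type [past q] the same
    predicate expresses adaptedness. *)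
Definition bounded_measurable f := measurable_fun setT f /\ exists M, forall x, `|f x| <= M.

Lemma bounded_measurable_integrable f : bounded_measurable f ->
  mu.-integrable setT (EFin \o f).
Proof.
move=> [mf [M fM]]; apply: measurable_bounded_integrable => //.
  by rewrite mu1 ltry.
exists M; split; first exact: num_real.
by move=> x /ltW Mx y _; exact: le_trans (fM y) Mx.
Qed.

Lemma bounded_measurableD f g : bounded_measurable f -> bounded_measurable g ->
  bounded_measurable (fun x => f x + g x).
Proof.
move=> [mf [M fM]] [mg [N gN]]; split; first exact: measurable_funD.
exists (M + N) => x; apply: le_trans (ler_normD _ _) _; exact: lerD.
Qed.

Lemma bounded_measurableM f g : bounded_measurable f -> bounded_measurable g ->
  bounded_measurable (fun x => f x * g x).
Proof.
move=> [mf [M fM]] [mg [N gN]]; split; first exact: measurable_funM.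
by exists (M * N) => x; rewrite normrM ler_pM.
Qed.

Lemma bounded_measurable_cst c : bounded_measurable (fun=> c).
Proof. by split => //; exists `|c|. Qed.

Lemma bounded_measurableZ c f : bounded_measurable f ->
  bounded_measurable (fun x => c * f x).
Proof. by move=> fb; apply: bounded_measurableM => //; exact: bounded_measurable_cst. Qed.

Lemma bounded_measurable_sum (I : Type) (r : seq I) (F : I -> T -> R) :
  (forall i, bounded_measurable (F i)) ->
  bounded_measurable (fun x => \sum_(i <- r) F i x).
Proof.
move=> Fb; elim: r => [|i r IH].
  by under eq_fun do rewrite big_nil; exact: bounded_measurable_cst.
by under eq_fun do rewrite big_cons; exact: bounded_measurableD.
Qed.

Lemma Rintegral_unit_cst c : \int[mu]_x c = c.
Proof. by rewrite Rintegral_cst// mu1 mulr1. Qed.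

Lemma Rintegral_bmD f g : bounded_measurable f -> bounded_measurable g ->
  \int[mu]_x (f x + g x) = \int[mu]_x f x + \int[mu]_x g x.
Proof. by move=> fb gb; apply: RintegralD => //; exact: bounded_measurable_integrable. Qed.

Lemma Rintegral_bmZ c f : bounded_measurable f ->
  \int[mu]_x (c * f x) = c * \int[mu]_x f x.
Proof. by move=> fb; apply: RintegralZl => //; exact: bounded_measurable_integrable. Qed.

Lemma Rintegral_bm_sum (I : Type) (r : seq I) (F : I -> T -> R) :
  (forall i, bounded_measurable (F i)) ->
  \int[mu]_x (\sum_(i <- r) F i x) = \sum_(i <- r) \int[mu]_x F i x.
Proof.
move=> Fb; elim: r => [|i r IH].
  by under eq_Rintegral do rewrite big_nil; rewrite Rintegral_unit_cst big_nil.
under eq_Rintegral do rewrite big_cons.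
by rewrite Rintegral_bmD// ?IH ?big_cons//; exact: bounded_measurable_sum.
Qed.

Lemma le_Rintegral_bm f g : bounded_measurable f -> bounded_measurable g ->
  (forall x, f x <= g x) -> \int[mu]_x f x <= \int[mu]_x g x.
Proof. by move=> fb gb fg; apply: le_Rintegral => //; exact: bounded_measurable_integrable. Qed.

Lemma norm_Rintegral_bm_le f M : bounded_measurable f -> (forall x, `|f x| <= M) ->
  `|\int[mu]_x f x| <= M.
Proof.
move=> fb fM; rewrite ler_norml; apply/andP; split.
  rewrite -[leLHS]Rintegral_unit_cst; apply: le_Rintegral_bm => [||x] //.
    exact: bounded_measurable_cst.
  by have := fM x; rewrite ler_norml => /andP[].
rewrite -[leRHS]Rintegral_unit_cst; apply: le_Rintegral_bm => [||x] //.
  exact: bounded_measurable_cst.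
by have := fM x; rewrite ler_norml => /andP[].
Qed.

End unit_mass_integral.

Section modes.
Variable R : realType.
Notation T := (torus R).
Implicit Types (h w : T -> R) (x y : T) (c e eta u v phi : R) (k : nat).
Implicit Types mu nu : {measure set T -> \bar R}.

Definition mode mu k phi : R := \int[mu]_x wave 1 k phi x.

Lemma norm_wave_le c k phi x : `|wave c k phi x| <= `|c|.
Proof. by rewrite /wave normrM ler_piMr// cos_max. Qed.

Lemma wave_bm c k phi : bounded_measurable (@wave R c k phi).
Proof.
by split; [exact: wave_measurable|exists `|c| => x; exact: norm_wave_le].
Qed.

Lemma waveE c k phi : @wave R c k phi = fun x => c * wave 1 k phi x.
Proof. by apply/funext => x; rewrite /wave mul1r. Qed.

Lemma Rintegral_wave mu c k phi : mu setT = 1%E ->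
  \int[mu]_x wave c k phi x = c * mode mu k phi.
Proof. by move=> mu1; rewrite waveE Rintegral_bmZ//; exact: wave_bm. Qed.

Lemma norm_mode_le1 mu k phi : mu setT = 1%E -> `|mode mu k phi| <= 1.
Proof.
move=> mu1; apply: norm_Rintegral_bm_le => //; first exact: wave_bm.
by move=> x; rewrite -[leRHS]normr1; exact: norm_wave_le.
Qed.

Lemma mode_phase mu k phi : mu setT = 1%E ->
  mode mu k phi = cos phi * mode mu k 0 - sin phi * mode mu k (- (pi / 2)).
Proof.
move=> mu1; rewrite -!Rintegral_wave// -(mulN1r (\int[mu]_x _)).
rewrite -Rintegral_bmZ//; last exact: wave_bm.
rewrite -Rintegral_bmD//; [|exact: wave_bm|exact/bounded_measurableZ/wave_bm].
congr Rintegral; apply/funext => x.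
by rewrite /wave addr0 cosBpihalf cosD; ring.
Qed.

Lemma mode0 mu phi : mu setT = 1%E -> mode mu 0 phi = cos phi.
Proof.
move=> mu1; rewrite -[RHS](Rintegral_unit_cst mu1); congr Rintegral.
by apply/funext => x; rewrite /wave mul0r add0r mul1r.
Qed.

(** Tests the distance against a wave scaled into the unit ball, with a constant approximating
    sequence. *)
Lemma Hm1_dist_mode mu nu k phi e : mu setT = 1%E -> nu setT = 1%E -> (0 < k)%N ->
  (Hm1_dist mu nu <= e%:E)%E ->
  `|mode mu k phi - mode nu k phi| <= k%:R * (2 * pi) * e.
Proof.
move=> mu1 nu1 k0 He.
have kp0 : 0 < k%:R * (2 * pi) :> R by rewrite !mulr_gt0 ?ltr0n// pi_gt0.
pose c := (k%:R * (2 * pi))^-1 : R.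
have c0 : 0 < c by rewrite invr_gt0.
have H1 : has_H1_norm (wave c k phi) (C1_norm1 (wave c k phi)).
  exists (fun=> wave c k phi); split.
  - by move=> _; exact: wave_C1_zero_mean.
  - move=> e' e'0; exists 0%N => _ _ _ _.
    have -> : (fun x => wave c k phi x - wave c k phi x) = wave 0 k phi.
      by apply/funext => x; rewrite subrr /wave mul0r.
    by apply: le_trans (C1_norm1_wave_le _ _ _) _; rewrite normr0 !mul0r ltW.
  - by move=> x; exact: cvg_cst.
  - exact: cvg_cst.
have : (`|\int[mu]_x wave c k phi x - \int[nu]_x wave c k phi x|%:E <= e%:E)%E.
  apply: le_trans He; apply: ereal_sup_ubound.
  exists (wave c k phi) => //; exists (C1_norm1 (wave c k phi)) => //.
  apply: le_trans (C1_norm1_wave_le _ _ _) _.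
  by rewrite -mulrA gtr0_norm// mulVf// gt_eqF.
rewrite lee_fin !Rintegral_wave// -mulrBr normrM gtr0_norm// /c.
by rewrite ler_pdivrMl.
Qed.

Lemma H1_continuous h c : has_H1_norm h c -> c <= 1 -> continuous h.
Proof.
move=> hc c1; apply: torus_continuousP => u.
apply/(@cvgrPdist_le _ R^o) => e e0.
have e20 : 0 < e / 2 by rewrite divr_gt0.
have [C C0 HC] := H1_modulus e20.
have hm := HC _ _ hc c1.
have C1 : 0 < C + 1 by rewrite ltr_wpDl.
near=> v.
have uv : `|u - v| < Num.min (e / (C + 1)) 1.
  near: v; apply: (@cvgr_dist_lt _ R^o _ _ _ id u) => //.
  by rewrite lt_min divr_gt0//= ltr01.
move: uv; rewrite lt_min => /andP[uv1 uv2].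
apply: le_trans (hm u v) _.
suff : C * (1 - cos (u - v)) <= e / 2 by lra.
apply: le_trans (_ : C * ((u - v) ^+ 2 / 2) <= _); first by rewrite ler_wpM2l ?onem_cos_le.
rewrite mulrA ler_pM2r ?invr_gt0// -real_normK ?num_real// expr2.
apply: le_trans (_ : (C + 1) * (e / (C + 1) * 1) <= _); last by rewrite mulr1 mulrC divfK ?gt_eqF.
rewrite ler_pM ?mulr_ge0// ?lerDl//; apply: ler_pM => //; exact: ltW.
Unshelve. all: by end_near. Qed.

Lemma modes_Hm1_dist eps : 0 < eps -> exists2 N : nat, (0 < N)%N &
  exists2 kap : R, 0 < kap & forall mu nu, mu setT = 1%E -> nu setT = 1%E ->
  (forall k, (0 < k <= N)%N -> `|mode mu k 0 - mode nu k 0| <= kap /\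
     `|mode mu k (- (pi / 2)) - mode nu k (- (pi / 2))| <= kap) ->
  (Hm1_dist mu nu <= eps%:E)%E.
Proof.
(* The approximation costs [2 * eta] for each measure and the modes cost [eta], in all less than
   [eps]. *)
move=> e0; pose eta := eps / 8; have eta0 : 0 < eta by rewrite divr_gt0.
have [C C0 HC] := H1_modulus eta0.
have [N N0 CN] : exists2 N : nat, (0 < N)%N & C / N%:R <= eta.
  exists (Num.bound (C / eta)).+1 => //.
  rewrite ler_pdivrMr ?ltr0n// mulrC -ler_pdivrMr//.
  apply: ltW; apply: lt_trans (archi_boundP (divr_ge0 C0 (ltW eta0))) _.
  by rewrite ltr_nat.
(* [H] bounds [h - h 0] over the whole unit ball, by the modulus and [1 - cos <= 2]. At each node
   the coefficients of the [N^2] modes sum to at most [H * N], and a mode of arbitrary phase moves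
   by at most [2 * kap], whence the choice of [kap]. *)
pose H := eta + C * 2.
have H0 : 0 < H by rewrite ltr_wpDr// mulr_ge0.
pose kap := eta / (2 * H * N%:R).
have kap0 : 0 < kap by rewrite divr_gt0// !mulr_gt0// ltr0n.
exists N => //; exists kap => // mu nu mu1 nu1 mk.
apply: ge_ereal_sup => _ [h [c c1 hc] <-]; rewrite lee_fin.
have hm := HC _ _ hc c1.
pose M := N.+1; pose f u := h (torus_pi u) - h 0.
have fmod u v : `|f u - f v| <= eta + C * (1 - cos (u - v)).
  by rewrite /f opprB addrA subrK.
have fH u : `|f u| <= H.
  rewrite /f; have := hm u 0; rewrite (_ : torus_pi 0 = 0); last first.
    by have := torus_piB (0 : R) 0; rewrite subrr => ->; rewrite subrr.
  move=> /le_trans; apply; rewrite /H lerD2l ler_wpM2l//.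
  by have := @cos_geN1 R (u - 0); lra.
pose W x := M%:R^-1 * \sum_(m < M) f (equispaced R M m) * (N%:R^-1 *
  \sum_(j < N) \sum_(l < N)
    wave 1 `|j - l|%N (- (`|j - l|%N%:R * equispaced R M m)) x).
have Wb m : bounded_measurable (fun x => f (equispaced R M m) * (N%:R^-1 *
    \sum_(j < N) \sum_(l < N)
    wave 1 `|j - l|%N (- (`|j - l|%N%:R * equispaced R M m)) x)).
  do 2 apply: bounded_measurableZ.
  by do 2 apply: bounded_measurable_sum => ?; exact: wave_bm.
have Wbm : bounded_measurable W.
  by apply: bounded_measurableZ; apply: bounded_measurable_sum => m; exact: Wb.
have hW x : `|h x - h 0 - W x| <= 2 * eta.
  have [u _ <-] := torus_pi_surj x.
  have hq := fejer_quasi_interpolant u C0 N0 fmod.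
  rewrite /W (_ : \sum_(m < M) _ = \sum_(m < M)
    f (equispaced R M m) * fejer N (u - equispaced R M m)); last first.
    apply: eq_bigr => m _; rewrite /fejer; congr (_ * (_ * _)).
    apply: eq_bigr => j _; apply: eq_bigr => l _.
    rewrite wave_pi mul1r -mulrBr.
    rewrite natr_absz intr_norm.
    have [p0|p0] := leP 0 ((Posz j - Posz l)%:~R : R); first by rewrite ger0_norm.
    by rewrite ltr0_norm// mulNr cosN.
  by apply: le_trans hq _; lra.
have hb : bounded_measurable h.
  split; first by apply: torus_continuous_measurable; exact: H1_continuous hc c1.
  exists (`|h 0| + H) => x; have [u _ <-] := torus_pi_surj x.
  rewrite -(subrK (h 0) (h (torus_pi u))) addrC.
  by apply: le_trans (ler_normD _ _) _; rewrite lerD2l; exact: fH.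
have h0b : bounded_measurable (fun=> h 0) := @bounded_measurable_cst R _ T (h 0).
have split_int (la : {measure set T -> \bar R}) : la setT = 1%E ->
    `|\int[la]_x h x - h 0 - \int[la]_x W x| <= 2 * eta.
  move=> la1; rewrite -{1}(Rintegral_unit_cst la1 (h 0)).
  have hZ := bounded_measurableZ (-1) h0b; have WZ := bounded_measurableZ (-1) Wbm.
  have hD := bounded_measurableD hb hZ.
  rewrite -(mulN1r (\int[la]_x h 0)) -(mulN1r (\int[la]_x W x)).
  rewrite -(Rintegral_bmZ la1 _ h0b) -(Rintegral_bmZ la1 _ Wbm).
  rewrite -(Rintegral_bmD la1 hb hZ) -(Rintegral_bmD la1 hD WZ).
  apply: (norm_Rintegral_bm_le la1 (bounded_measurableD hD WZ)) => x.
  by rewrite !mulN1r.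
have WE (la : {measure set T -> \bar R}) : la setT = 1%E ->
    \int[la]_x W x = M%:R^-1 * \sum_(m < M) f (equispaced R M m) * (N%:R^-1 *
  \sum_(j < N) \sum_(l < N)
    mode la `|j - l|%N (- (`|j - l|%N%:R * equispaced R M m))).
  move=> la1; rewrite Rintegral_bmZ//; last by apply: bounded_measurable_sum => m; exact: Wb.
  congr (_ * _); rewrite Rintegral_bm_sum//; apply: eq_bigr => m _.
  have jl : forall j l : nat, bounded_measurable
     (@wave R 1 `|j - l|%N (- (`|j - l|%N%:R * equispaced R M m))) by move=> *; exact: wave_bm.
  rewrite Rintegral_bmZ//; last first.
    by apply: bounded_measurableZ; do 2 apply: bounded_measurable_sum => ?.
  congr (_ * _); rewrite Rintegral_bmZ//; last first.
    by do 2 apply: bounded_measurable_sum => ?.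
  congr (_ * _); rewrite Rintegral_bm_sum//; last by move=> ?; apply: bounded_measurable_sum.
  by apply: eq_bigr => j _; rewrite Rintegral_bm_sum.
have mode_close k phi : (k <= N)%N -> `|mode mu k phi - mode nu k phi| <= 2 * kap.
  move=> kN; have [->|k0] := posnP k.
    by rewrite !mode0// subrr normr0 mulr_ge0// ltW.
  have [a b] := mk k (introT andP (conj k0 kN)).
  rewrite (mode_phase k phi mu1) (mode_phase k phi nu1).
  rewrite (_ : _ - _ = cos phi * (mode mu k 0 - mode nu k 0) -
    sin phi * (mode mu k (- (pi / 2)) - mode nu k (- (pi / 2)))); last by ring.
  have -> : 2 * kap = 1 * kap + 1 * kap by ring.
  apply: le_trans (ler_normB _ _) _; rewrite !normrM; apply: lerD.
    by apply: ler_pM => //; exact: cos_max.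
  by apply: ler_pM => //; exact: sin_max.
have Wclose : `|\int[mu]_x W x - \int[nu]_x W x| <= eta.
  rewrite !WE// -mulrBr normrM -sumrB gtr0_norm ?invr_gt0 ?ltr0n//.
  rewrite ler_pdivrMl ?ltr0n// [leRHS]mulr_natl.
  apply: le_trans (ler_norm_sum _ _ _) _.
  apply: le_trans (_ : \sum_(m < M) eta <= _); last by rewrite sumr_const card_ord.
  apply: ler_sum => m _; rewrite -!mulrBr -sumrB.
  rewrite !normrM; apply: le_trans (_ : H * (N%:R^-1 * (N%:R * (N%:R * (2 * kap)))) <= _).
    rewrite ler_pM// ?mulr_ge0// (gtr0_norm (_ : 0 < N%:R^-1)) ?invr_gt0 ?ltr0n//.
    rewrite ler_pM2l ?invr_gt0 ?ltr0n//.
    apply: le_trans (ler_norm_sum _ _ _) _.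
    rewrite mulr_natl -[X in _ *+ X](card_ord N) -sumr_const; apply: ler_sum => j _.
    rewrite -sumrB; apply: le_trans (ler_norm_sum _ _ _) _.
    rewrite mulr_natl -[X in _ *+ X](card_ord N) -sumr_const; apply: ler_sum => l _.
    apply: mode_close; have := ltn_ord j; have := ltn_ord l; lia.
  rewrite /kap le_eqVlt; apply/orP; left; apply/eqP; field.
  by rewrite pnatr_eq0 -lt0n N0 gt_eqF.
have := split_int _ mu1; have := split_int _ nu1; move: Wclose; rewrite !ler_norml /eta.
by move=> /andP[? ?] /andP[? ?] /andP[? ?]; apply/andP; split; lra.
Qed.

End modes.

(** * Gaussian moments *)

Section gaussian.
Variable R : realType.
Variable s : R.
Hypothesis s_gt0 : 0 < s.
Notation Q := (normal_prob 0 s).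
Notation leb := lebesgue_measure.
Local Open Scope ereal_scope.

Let s_neq0 : s != 0%R. Proof. by rewrite gt_eqF. Qed.

Lemma ge0_integral_reflect (f : R -> R) : (forall x, 0 <= f x)%R -> continuous f ->
  \int[leb]_x (f (- x)%R)%:E = \int[leb]_x (f x)%:E.
Proof.
have half (g : R -> R) : (forall x, 0 <= g x)%R -> continuous g ->
  \int[leb]_x (g x)%:E = \int[leb]_(x in `[0%R, +oo[) (g x)%:E +
     \int[leb]_(x in `[0%R, +oo[) (g (- x)%R)%:E.
  move=> g0 cg.
  have mg : measurable_fun [set: R] g by exact: continuous_measurable_fun.
  have mposnums : measurable [set x : R | 0 <= x]%R by rewrite -set_itvcy.
  rewrite -(setUv [set x : R | 0 <= x]%R) ge0_integral_setU//= ; last 4 first.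
    exact: measurableC.
    by apply/measurable_EFinP; rewrite setUv.
    by move=> x _; rewrite lee_fin.
    exact/disj_setPCl.
  rewrite -set_itvcy// setCitvr; congr +%E.
  rewrite integral_itv_bndo_bndc; last exact/measurable_EFinP/measurable_funTS.
  rewrite -{1}oppr0 ge0_integration_by_substitutionNy//.
  exact: continuous_subspaceT.
move=> f0 cf; rewrite half//.
  rewrite [RHS]half// addeC; congr (_ + _).
  by under eq_integral do rewrite opprK.
by move=> x; apply: continuous_comp; [exact: opp_continuous|exact: cf].
Qed.

Lemma ge0_integral_normal_prob (f : R -> R) : (forall x, 0 <= f x)%R ->
  measurable_fun setT f ->
  \int[Q]_x (f x)%:E = \int[leb]_x (f x * normal_pdf 0 s x)%:E.
Proof.
move=> f0 mf; have mEf : measurable_fun setT (EFin \o f) by exact/measurable_EFinP.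
rewrite -(Radon_Nikodym_SigmaFinite.change_of_variables (normal_prob_dominates 0 s))//=.
under [RHS]eq_integral do rewrite EFinM.
apply: ae_eq_integral => //.
- apply: emeasurable_funM => //; apply: (measurable_int leb).
  exact: Radon_Nikodym_SigmaFinite.f_integrable (normal_prob_dominates 0 s).
- apply: emeasurable_funM => //=; apply/measurable_EFinP.
  exact: measurable_normal_pdf.
- apply: ae_eqe_mul2l => /=.
  apply: integral_ae_eq => //=.
  + exact: Radon_Nikodym_SigmaFinite.f_integrable (normal_prob_dominates 0 s).
  + by apply/measurable_EFinP; exact: measurable_normal_pdf.
  + by move=> E _ mE; rewrite -Radon_Nikodym_SigmaFinite.f_integral//; exact: normal_prob_dominates.
Qed.

(** The exponential turns the density of variance [s^2] into [lam] times the density of variance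
    [(lam * s)^2]. The second and fourth moments below are deduced from this identity, without
    integration by parts. *)
Lemma normal_exp_sqr (lam : R) : (0 < lam)%R ->
  \int[Q]_x (expR ((1 - lam ^- 2) / (2 * s ^+ 2) * x ^+ 2))%:E = lam%:E.
Proof.
move=> l0; have ls0 : (lam * s != 0)%R by rewrite mulf_neq0// gt_eqF.
rewrite ge0_integral_normal_prob; last 2 first.
- by move=> x; exact: expR_ge0.
- apply: continuous_measurable_fun => x; apply: continuous_comp; last exact: continuous_expR.
  by apply: cvgM; [exact: cvg_cst|exact: exprn_continuous].
have peakE : (lam * normal_peak (lam * s) = normal_peak s)%R.
  rewrite /normal_peak exprMn -mulrA -mulrnAr sqrtrM ?sqr_ge0//.
  by rewrite sqrtr_sqr gtr0_norm// invfM mulrA divff ?gt_eqF// mul1r.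
have E x : (expR ((1 - lam ^- 2) / (2 * s ^+ 2) * x ^+ 2) * normal_pdf 0 s x =
    lam * normal_pdf 0 (lam * s) x)%R.
  rewrite !normal_pdfE// /normal_fun mulrCA [RHS]mulrA peakE -expRD; congr (_ * expR _)%R.
  by field; rewrite ?s_neq0 gt_eqF.
under eq_integral do rewrite E EFinM.
rewrite ge0_integralZl ?integral_normal_pdf ?mule1//.
- by apply/measurable_EFinP; exact: measurable_normal_pdf.
- by move=> x _; rewrite lee_fin normal_pdf_ge0.
- by rewrite lee_fin ltW.
Qed.

Local Close Scope ereal_scope.

Let mX n : measurable_fun setT (fun x : R => x ^+ n).
Proof. by apply: continuous_measurable_fun => x; exact: exprn_continuous. Qed.

Let X2_ge0 : (0 <= \int[Q]_x (x ^+ 2)%:E)%E.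
Proof. by apply: integral_ge0 => x _; rewrite lee_fin sqr_ge0. Qed.

Let Q1 : Q setT = 1%E. Proof. exact: probability_setT. Qed.

Let m_exp_sqr k : measurable_fun setT (fun x : R => expR (k * x ^+ 2)).
Proof.
apply: continuous_measurable_fun => x; apply: continuous_comp; last exact: continuous_expR.
by apply: cvgM; [exact: cvg_cst|exact: exprn_continuous].
Qed.

Lemma integrable_normal_sqr : Q.-integrable setT (EFin \o (fun x : R => x ^+ 2)).
Proof.
pose k : R := (1 - 2 ^- 2) / (2 * s ^+ 2).
have k0 : 0 < k.
  by rewrite divr_gt0// ?mulr_gt0 ?exprn_gt0// subr_gt0 invf_lt1// expr2; lra.
have kX : (\int[Q]_x (k * x ^+ 2)%:E <= 2%:E)%E.
  rewrite -(@normal_exp_sqr 2)//; apply: ge0_le_integral => //.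
  - by move=> x _; rewrite lee_fin mulr_ge0 ?sqr_ge0// ltW.
  - by apply/measurable_EFinP; apply: measurable_funM.
  - apply/measurable_EFinP; exact: m_exp_sqr.
  - move=> x _; rewrite lee_fin; apply: le_trans (expR_ge1Dx _).
    by rewrite lerDr.
apply/integrableP; split; first exact/measurable_EFinP.
under eq_integral do rewrite /= ger0_norm ?sqr_ge0//.
have kXE : (\int[Q]_x (k * x ^+ 2)%:E = k%:E * \int[Q]_x (x ^+ 2)%:E)%E.
  under eq_integral do rewrite EFinM.
  rewrite ge0_integralZl ?lee_fin ?(ltW k0)//; first exact/measurable_EFinP.
  by move=> x _; rewrite lee_fin sqr_ge0.
move: kX; rewrite kXE.
case: (\int[Q]_x (x ^+ 2)%:E)%E X2_ge0 => [r| |]//= _; rewrite ?ltry//.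
by rewrite gt0_muley ?lte_fin.
Qed.

Let W := \int[Q]_x x ^+ 2.

Let W_ge0 : 0 <= W. Proof. by apply: Rintegral_ge0 => x _; exact: sqr_ge0. Qed.

(* equality holds at [lam = 1], so comparing derivatives there gives the variance *)
Let W_exp lam : 0 < lam -> 1 + (1 - lam ^- 2) / (2 * s ^+ 2) * W <= lam.
Proof.
move=> l0; pose k : R := (1 - lam ^- 2) / (2 * s ^+ 2).
have ie : Q.-integrable setT (EFin \o (fun x => expR (k * x ^+ 2))).
  apply/integrableP; split; first by apply/measurable_EFinP; exact: m_exp_sqr.
  under eq_integral do rewrite /= ger0_norm ?expR_ge0//.
  by rewrite normal_exp_sqr// ltry.
rewrite -/k; have -> : lam = \int[Q]_x expR (k * x ^+ 2) by rewrite /Rintegral normal_exp_sqr.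
have i1 : Q.-integrable setT (EFin \o (fun=> 1 : R)).
  by apply: bounded_measurable_integrable => //; exact: bounded_measurable_cst.
have i2 : Q.-integrable setT (EFin \o (fun x => k * x ^+ 2)).
  have := integrableZl measurableT k integrable_normal_sqr.
  by apply: eq_integrable => // x _; rewrite /= EFinM.
rewrite /W -RintegralZl//; last exact: integrable_normal_sqr.
rewrite -{1}(Rintegral_unit_cst Q1 1).
rewrite -RintegralD//; apply: le_Rintegral => //.
  have := integrableD measurableT i1 i2.
  by apply: eq_integrable => // x _; rewrite /= EFinD.
by move=> x _; exact: expR_ge1Dx.
Qed.

Lemma normal_variance : \int[Q]_x x ^+ 2 = s ^+ 2.
Proof.
have s20 : 0 < s ^+ 2 by rewrite exprn_gt0.
have H t : -1 < t -> t * ((2 + t) * W) <= t * (2 * s ^+ 2 * (1 + t) ^+ 2).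
  move=> t1; have l0 : 0 < 1 + t by lra.
  have h : (1 - (1 + t) ^- 2) / (2 * s ^+ 2) * W <= t by have := W_exp l0; rewrite lerD2l.
  have p0 : 0 < 2 * s ^+ 2 * (1 + t) ^+ 2 by rewrite !mulr_gt0// exprn_gt0.
  have := ler_wpM2l (ltW p0) h.
  have -> : 2 * s ^+ 2 * (1 + t) ^+ 2 * ((1 - (1 + t) ^- 2) / (2 * s ^+ 2) * W) =
    t * ((2 + t) * W) by field; rewrite s_neq0 gt_eqF.
  by move=> /le_trans; apply; rewrite le_eqVlt; apply/orP; left; apply/eqP; ring.
rewrite -/W; apply/eqP; rewrite eq_le; apply/andP; split; apply/ler_addgt0Pl => e e0.
  pose t := Num.min 1 (e / (8 * s ^+ 2)).
  have t0 : 0 < t by rewrite lt_min ltr01 divr_gt0// mulr_gt0.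
  have t1 : t <= 1 by rewrite ge_min lexx.
  have te : t * (8 * s ^+ 2) <= e by rewrite -ler_pdivlMr ?mulr_gt0// ge_min lexx orbT.
  have t1' : -1 < t by lra.
  have := H _ t1'; rewrite ler_pM2l// => h.
  have tt : t * t <= t by rewrite ler_piMr// ltW.
  have tW : 0 <= t * W by rewrite mulr_ge0// ltW.
  have ts : s ^+ 2 * (t * t) <= s ^+ 2 * t by rewrite ler_pM2l.
  rewrite expr2 in h; nra.
pose t := Num.min (1 / 2) (e / (8 * s ^+ 2)).
have t0 : 0 < t by rewrite lt_min !divr_gt0// mulr_gt0.
have t1 : t <= 1 / 2 by rewrite ge_min lexx.
have te : t * (8 * s ^+ 2) <= e by rewrite -ler_pdivlMr ?mulr_gt0// ge_min lexx orbT.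
have t1' : -1 < - t by lra.
have := H _ t1'; rewrite !mulNr lerN2 ler_pM2l// => h.
have tW : 0 <= t * W by rewrite mulr_ge0// ltW.
have ts : 0 <= s ^+ 2 * (t * t) by rewrite !mulr_ge0// ltW.
rewrite expr2 in h; nra.
Qed.

(** Since [y^2 / 4 <= expR y] for [y = 3 x^2 / (8 s^2)], where [expR y] has mean 2, the moment is at
    most [(512 / 9) s^4]. This gives 57 instead of the sharp 3. *)
Lemma normal_fourth_moment : Q.-integrable setT (EFin \o (fun x : R => x ^+ 4)) /\
  \int[Q]_x x ^+ 4 <= 57 * s ^+ 4.
Proof.
have s40 : 0 < s ^+ 4 by rewrite exprn_gt0.
pose k : R := (1 - 2 ^- 2) / (2 * s ^+ 2).
have kE : k = 3 / (8 * s ^+ 2) by rewrite /k; field.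
have X4 (x : R) : 0 <= x ^+ 4 by rewrite -[4%N]/(2 * 2)%N exprM sqr_ge0.
have mX4 : measurable_fun setT (fun x : R => (x ^+ 4)%:E) by exact/measurable_EFinP.
have h : (\int[Q]_x (x ^+ 4)%:E <= (57 * s ^+ 4)%:E)%E.
  have <- : (\int[Q]_x (57 * s ^+ 4 / 2 * expR (k * x ^+ 2))%:E = (57 * s ^+ 4)%:E)%E.
    under eq_integral do rewrite EFinM.
    rewrite ge0_integralZl//; last 2 first.
    - by apply/measurable_EFinP; exact: m_exp_sqr.
    - by rewrite lee_fin; lra.
    by rewrite normal_exp_sqr// -EFinM divfK.
  apply: ge0_le_integral => //.
  - by move=> x _; rewrite lee_fin.
  - by apply/measurable_EFinP; apply: measurable_funM => //; exact: m_exp_sqr.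
  - move=> x _; rewrite lee_fin.
    have y0 : 0 <= k * x ^+ 2 by rewrite kE mulr_ge0 ?sqr_ge0// divr_ge0// mulr_ge0// sqr_ge0.
    have e2 : (k * x ^+ 2) ^+ 2 / 4 <= expR (k * x ^+ 2).
      have -> : expR (k * x ^+ 2) = expR (k * x ^+ 2 / 2) ^+ 2.
        by rewrite -[RHS]expRM_natl; congr expR; field.
      have h1 := expR_ge1Dx (k * x ^+ 2 / 2).
      apply: le_trans (_ : (1 + k * x ^+ 2 / 2) ^+ 2 <= _).
        rewrite -subr_ge0 (_ : _ - _ = 1 + k * x ^+ 2); first lra.
        by field.
      by rewrite ler_pXn2r// nnegrE ?expR_ge0//; lra.
    have := ler_wpM2l (ltW (_ : 0 < 57 * s ^+ 4 / 2)) e2.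
    rewrite divr_gt0 ?mulr_gt0// => /(_ isT); apply: le_trans.
    rewrite kE [leRHS](_ : _ = 513 / 512 * x ^+ 4); last by field.
    by have := X4 x; lra.
split.
  apply/integrableP; split => //.
  under eq_integral do rewrite /= ger0_norm ?X4//.
  by apply: le_lt_trans h _; rewrite ltry.
rewrite -lee_fin /Rintegral fineK//.
rewrite ge0_fin_numE; last by apply: integral_ge0 => x _; rewrite lee_fin.
by apply: le_lt_trans h _; rewrite ltry.
Qed.

(** For [s^2] equal to the mesh, the first bound controls the variance of an Euler step. The second
    identifies its compensator up to the square of the mesh. *)
Lemma normal_cos_bound (k : R) :
  1 - \int[Q]_x cos (k * x) <= k ^+ 2 * s ^+ 2 / 2 /\
  `|1 - \int[Q]_x cos (k * x) - k ^+ 2 * s ^+ 2 / 2| <= 57 * k ^+ 4 * s ^+ 4.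
Proof.
have kc : continuous (fun x : R => cos (k * x)).
  move=> x; apply: continuous_comp; last exact: continuous_cos.
  by apply: cvgM; [exact: cvg_cst|exact: cvg_id].
have cb : bounded_measurable (fun x : R => cos (k * x)).
  by split; [exact: continuous_measurable_fun|exists 1 => x; exact: cos_max].
have ob : bounded_measurable (fun x : R => 1 - cos (k * x)).
  have -> : (fun x : R => 1 - cos (k * x)) = (fun x => 1 + -1 * cos (k * x)).
    by apply/funext => x; rewrite mulN1r.
  by apply: bounded_measurableD; [exact: bounded_measurable_cst|exact: bounded_measurableZ].
have oi := bounded_measurable_integrable Q1 ob.
have -> : 1 - \int[Q]_x cos (k * x) = \int[Q]_x (1 - cos (k * x)).
  rewrite -{1}(Rintegral_unit_cst Q1 1) RintegralB//; apply: bounded_measurable_integrable => //.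
  exact: bounded_measurable_cst.
have i2 : Q.-integrable setT (EFin \o (fun x => k ^+ 2 / 2 * x ^+ 2)).
  have := integrableZl measurableT (k ^+ 2 / 2) integrable_normal_sqr.
  by apply: eq_integrable => // x _; rewrite /= EFinM.
have [i4 m4] := normal_fourth_moment.
have i4' : Q.-integrable setT (EFin \o (fun x => k ^+ 4 * x ^+ 4)).
  have := integrableZl measurableT (k ^+ 4) i4.
  by apply: eq_integrable => // x _; rewrite /= EFinM.
have E2 : k ^+ 2 * s ^+ 2 / 2 = \int[Q]_x (k ^+ 2 / 2 * x ^+ 2).
  rewrite (@RintegralZl _ _ _ Q setT (fun x => x ^+ 2) _ measurableT integrable_normal_sqr).
  by rewrite normal_variance; field.
rewrite E2; split.
  apply: le_Rintegral => // x _.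
  by apply: le_trans (onem_cos_le _) _; rewrite exprMn mulrAC.
rewrite -RintegralB//.
have id : Q.-integrable setT (EFin \o (fun x => 1 - cos (k * x) - k ^+ 2 / 2 * x ^+ 2)).
  have := integrableB measurableT oi i2.
  by apply: eq_integrable => // x _; rewrite /= EFinB.
apply: le_trans (le_normr_Rintegral _ _) _ => //.
apply: le_trans (_ : \int[Q]_x (k ^+ 4 * x ^+ 4) <= _).
  apply: le_Rintegral => //.
    by have /integrable_abse := id; apply: eq_integrable.
  move=> x _; have := cos_taylor2 (k * x).
  by rewrite !exprMn mulrAC.
have k40 : 0 <= k ^+ 4 by rewrite -[4%N]/(2 * 2)%N exprM sqr_ge0.
rewrite RintegralZl// -mulrA mulrCA.
exact: ler_wpM2l.
Qed.

(** Oddness of the sine. Reflection is stated for nonnegative integrands, so it is applied to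
    [1 + sin]. *)
Lemma normal_sin (k : R) : \int[Q]_x sin (k * x) = 0.
Proof.
have self_opp (a : R) : a = - a -> a = 0 by lra.
have kc c : continuous (fun x : R => sin (c * x)).
  move=> x; apply: continuous_comp; last exact: continuous_sin.
  by apply: cvgM; [exact: cvg_cst|exact: cvg_id].
have sb c : bounded_measurable (fun x : R => sin (c * x)).
  by split; [exact: continuous_measurable_fun|exists 1 => x; exact: sin_max].
have c1 := @bounded_measurable_cst R _ R 1.
have E c : 1 + \int[Q]_x sin (c * x) =
    fine (\int[leb]_x ((1 + sin (c * x)) * normal_pdf 0 s x)%:E)%E.
  rewrite -{1}(Rintegral_unit_cst Q1 1) -(Rintegral_bmD Q1 c1 (sb c)) /Rintegral.
  rewrite ge0_integral_normal_prob//; last by have [] := bounded_measurableD c1 (sb c).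
have EN : 1 + \int[Q]_x sin (k * x) = 1 + \int[Q]_x sin (- k * x).
  rewrite !E -ge0_integral_reflect.
  - apply: (congr1 fine); apply: eq_integral => x _; apply: (congr1 EFin).
    rewrite mulNr mulrN; congr (_ * _).
    by rewrite !normal_pdfE// /normal_fun !subr0 sqrrN.
  - by move=> x; rewrite mulr_ge0 ?normal_pdf_ge0//; have := @sin_geN1 R (k * x); lra.
  - move=> x; apply: cvgM; last exact: continuous_normal_pdf.
    by apply: cvgD; [exact: cvg_cst|exact: kc].
have : \int[Q]_x sin (- k * x) = - \int[Q]_x sin (k * x).
  rewrite -[RHS]mulN1r -(Rintegral_bmZ Q1 _ (sb k)); apply: eq_Rintegral => x _.
  by rewrite mulNr sinN mulN1r.
by move: EN => /addrI -> odd; exact: self_opp.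
Qed.

End gaussian.

(** * A maximal inequality for martingales *)

Section independence.
Context (R : realType) (d : measure_display) (Omega : measurableType d).
Variable P : probability Omega R.
Implicit Types (Z Y : Omega -> R).

(** Independence identifies the joint law with a product measure, and Fubini factors the
    integral. *)
Lemma independent_Rintegral_mul Z Y : bounded_measurable Z -> bounded_measurable Y ->
  (forall A C : set R, measurable A -> measurable C ->
    P (Z @^-1` A `&` Y @^-1` C) = (P (Z @^-1` A) * P (Y @^-1` C))%E) ->
  \int[P]_w (Z w * Y w) = \int[P]_w Z w * \int[P]_w Y w.
Proof.
move=> Zb Yb ind; have P1 : P setT = 1%E := probability_setT P.
have [mZ _] := Zb; have [mY _] := Yb.
have mZY : measurable_fun setT (fun w => (Z w, Y w)) by exact: measurable_fun_pair.
pose Z' : {RV P >-> R} := mfun_Sub (mem_set mZ).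
pose Y' : {RV P >-> R} := mfun_Sub (mem_set mY).
pose ZY : {mfun Omega >-> (R * R)%type} := mfun_Sub (mem_set mZY).
pose m1 := distribution P Z'; pose m2 := distribution P Y'.
pose m := distribution P ZY.
have mE X : measurable X -> (m1 \x m2)%E X = m X.
  apply: product_measure_unique => A B mA mB.
  rewrite /m /m1 /m2 /distribution /pushforward.
  exact: (ind A B mA mB).
pose h (z : R * R) := (z.1 * z.2)%:E.
have mh : measurable_fun setT h.
  by apply/measurable_EFinP; apply: measurable_funM; [exact: measurable_fst|exact: measurable_snd].
have ZYi : P.-integrable setT (h \o ZY).
  exact: (bounded_measurable_integrable P1 (bounded_measurableM Zb Yb)).
have hm : m.-integrable setT h by apply: integrable_pushforward => //.
have hm12 : (m1 \x m2)%E.-integrable setT h.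
  apply/integrableP; split => //.
  rewrite (eq_measure_integral m); first by case/integrableP : hm.
  by move=> A mA _; exact: mE.
have E1 : (\int[P]_w (Z w * Y w)%:E = \int[(m1 \x m2)%E]_z h z)%E.
  rewrite (eq_measure_integral m); last by move=> A mA _; exact: mE.
  by rewrite /m /distribution integral_pushforward.
have Zi := bounded_measurable_integrable P1 Zb.
have Yi := bounded_measurable_integrable P1 Yb.
have Zint : (\int[m1]_x x%:E = \int[P]_w (Z w)%:E)%E.
  by rewrite /m1 /distribution integral_pushforward.
have Yint : (\int[m2]_x x%:E = \int[P]_w (Y w)%:E)%E.
  by rewrite /m2 /distribution integral_pushforward.
have m2i : m2.-integrable setT (EFin : R -> \bar R) by apply: integrable_pushforward.
have m1i : m1.-integrable setT (EFin : R -> \bar R) by apply: integrable_pushforward.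
have Yf : (\int[P]_w (Y w)%:E = (\int[P]_w Y w)%:E)%E.
  by rewrite /Rintegral fineK//; exact: integrable_fin_num.
rewrite [LHS]/Rintegral E1 -integral12_prod_meas1//.
rewrite [in X in _ = X * _]/Rintegral -[X in _ = _ * X]/(fine (_%:E)) -Yf -fineM; last 2 first.
- exact: integrable_fin_num.
- exact: integrable_fin_num.
congr fine; rewrite /fubini_F /h /=.
under eq_integral => x _.
  rewrite (_ : (fun y => (x * y)%:E) = (fun y => x%:E * y%:E)%E); last first.
    by apply/funext => y; rewrite EFinM.
  rewrite integralZl// Yint Yf.
  over.
by rewrite integralZr// Zint Yf.
Qed.

(** * The filtration generated by the initial data and successive noises *)

Section filtration.
Variables (S0 : set (set Omega)) (xi : nat -> Omega -> R) (Q : nat).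
Hypothesis S0_sigma : sigma_algebra setT S0.
Hypothesis S0_measurable : S0 `<=` measurable.
Hypothesis mxi : forall q, measurable_fun setT (xi q).
Hypothesis indep : forall q C (A : nat -> set R), (q <= Q)%N -> S0 C ->
  (forall j, measurable (A j)) ->
  P (C `&` \bigcap_(j in `I_q) (xi j @^-1` A j)) =
  (P C * \prod_(j < q) P (xi j @^-1` A j))%E.

(* [S0] carries the initial data and [xi j] is the noise of step [j] *)
Definition past_rect q : set (set Omega) :=
  [set E | exists C (A : nat -> set R), [/\ S0 C, forall j, measurable (A j) &
    E = C `&` \bigcap_(j in `I_q) (xi j @^-1` A j)]].

Notation past q := (g_sigma_algebraType (past_rect q)).

Let mxi_pre j (A : set R) : measurable A -> measurable (xi j @^-1` A).
Proof. by move=> mA; rewrite -[X in measurable X]setTI; exact: mxi. Qed.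

Let S0_TI : S0 setT /\ setI_closed S0.
Proof.
have /(sigma_algebraP (fun X _ => @subsetT _ X))[S0T _ _ S0I] := S0_sigma.
by split.
Qed.
Let S0_T := S0_TI.1.
Let S0_I := S0_TI.2.

Lemma past_rect_measurable q : past_rect q `<=` measurable.
Proof.
move=> _ [C [A [/S0_measurable mC mA ->]]]; apply: measurableI => //.
by apply: bigcap_measurableType => j _; exact: mxi_pre.
Qed.

Lemma past_measurable q : <<s past_rect q >> `<=` @measurable d Omega.
Proof.
apply: smallest_sub; last exact: past_rect_measurable.
exact: sigma_algebra_measurable.
Qed.

Lemma past_rectI q : setI_closed (past_rect q).
Proof.
move=> _ _ [C [A [SC mA ->]]] [C' [A' [SC' mA' ->]]].
exists (C `&` C'), (fun j => A j `&` A' j); split.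
- exact: S0_I.
- by move=> j; exact: measurableI.
- by rewrite setIACA -bigcapI.
Qed.

Lemma past_rectS q : past_rect q `<=` past_rect q.+1.
Proof.
move=> _ [C [A [SC mA ->]]].
exists C, (fun j => if (j < q)%N then A j else setT); split => //.
  by move=> j; case: ifP.
apply/seteqP; split => w [Cw Aw]; split => // j /= jq.
  by case: ifP => //; exact: Aw.
by have := Aw j; rewrite /= jq; apply; exact: ltnW.
Qed.

(** The finite measures [P (_ & xi q in A)] and [P (xi q in A) * P _] agree on rectangles, which
    form a pi-system, hence on the sigma-algebra they generate. *)
Lemma past_independent q E (A : set R) : (q < Q)%N -> <<s past_rect q >> E ->
  measurable A -> P (E `&` xi q @^-1` A) = (P E * P (xi q @^-1` A))%E.
Proof.
move=> qQ sE mA; have mxA := mxi_pre q mA.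
pose p := fine (P (xi q @^-1` A)).
have pE : p%:E = P (xi q @^-1` A) by rewrite fineK// fin_num_measure.
have p0 : 0 <= p by rewrite fine_ge0.
rewrite muleC -pE -[LHS]/(mrestr P mxA E) -[RHS]/(mscale (NngNum p0) P E).
have T0 : past_rect q setT.
  exists setT, (fun=> setT); split => //.
  by rewrite setTI; apply/seteqP; split.
apply: (@g_sigma_algebra_measure_unique _ R Omega (past_rect q) _ (fun=> setT)) => //.
- exact: past_rect_measurable.
- by apply/seteqP; split => // w _; exists 0%N.
- exact: past_rectI.
- move=> _ [C [B [SC mB ->]]].
  transitivity (p%:E * P (C `&` \bigcap_(j in `I_q) (xi j @^-1` B j)))%E; last by [].
  rewrite /mrestr pE.
  pose B' j := if (j < q)%N then B j else A.
  have mB' j : measurable (B' j) by rewrite /B'; case: ifP.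
  have := @indep q.+1 C B' qQ SC mB'.
  have -> : C `&` \bigcap_(j in `I_q.+1) (xi j @^-1` B' j) =
      C `&` \bigcap_(j in `I_q) (xi j @^-1` B j) `&` xi q @^-1` A.
    apply/seteqP; split => w.
      move=> [Cw Bw]; split; first split => //.
        by move=> j /= jq; have := Bw j; rewrite /B' /= jq; apply; exact: ltnW.
      by have := Bw q; rewrite /B' /= ltnn; apply.
    move=> [[Cw Bw] Aw]; split => // j /=; rewrite ltnS leq_eqVlt => /predU1P[->|jq].
      by rewrite /B' ltnn.
    by rewrite /B' jq; exact: Bw.
  move=> h; apply: etrans h _.
  rewrite (indep (ltnW qQ) SC mB) big_ord_recr/= {2}/B' ltnn.
  rewrite muleA muleC; congr (_ * (_ * _))%E; apply: eq_bigr => j _.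
  by rewrite /B' ltn_ord.
- move=> _; apply: (_ : P (setT `&` xi q @^-1` A) < +oo)%E.
  apply: le_lt_trans (probability_le1 _ _) _; last by rewrite ltry.
  exact: measurableI.
Qed.

Lemma past_bounded_measurableS q Z : @bounded_measurable R _ (past q) Z ->
  @bounded_measurable R _ (past q.+1) Z.
Proof.
move=> [mZ bZ]; split => // _ A mA.
have := mZ measurableT _ mA.
by apply: sub_sigma_algebra2; exact: past_rectS.
Qed.

Lemma past_bounded_measurable q Z : @bounded_measurable R _ (past q) Z ->
  bounded_measurable Z.
Proof.
move=> [mZ bZ]; split => // _ A mA.
by apply: past_measurable; exact: mZ measurableT _ mA.
Qed.

Lemma past_xi j q : (j < q)%N -> measurable_fun setT (xi j : past q -> R).
Proof.
move=> jq _ A mA; rewrite setTI; apply: sub_sigma_algebra.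
exists setT, (fun i => if i == j then A else setT); split.
- exact: S0_T.
- by move=> i; case: ifP.
- rewrite setTI; apply/seteqP; split => w /=.
    by move=> Aw i /= iq; case: ifP => // /eqP ->.
  by move=> /(_ j jq); rewrite /= eqxx.
Qed.

Lemma past_S0 q Z : (forall A, measurable A -> S0 (Z @^-1` A)) ->
  measurable_fun setT (Z : past q -> R).
Proof.
move=> SZ _ A mA; rewrite setTI; apply: sub_sigma_algebra.
exists (Z @^-1` A), (fun=> setT); split => //; first exact: SZ.
by rewrite (_ : \bigcap_(j in `I_q) _ = setT) ?setIT//; apply/seteqP; split.
Qed.

Lemma past_orthogonal q Z (f : R -> R) : (q < Q)%N ->
  @bounded_measurable R _ (past q) Z -> bounded_measurable f ->
  \int[P]_w f (xi q w) = 0 -> \int[P]_w (Z w * f (xi q w)) = 0.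
Proof.
move=> qQ Zb [mf [M fM]] f0.
have fb : bounded_measurable (fun w => f (xi q w)).
  by split; [exact: measurableT_comp|exists M].
rewrite independent_Rintegral_mul//; first by rewrite f0 mulr0.
  exact: past_bounded_measurable Zb.
move=> A C mA mC.
have mfC : measurable (f @^-1` C) by rewrite -[X in measurable X]setTI; exact: mf.
apply: (past_independent qQ _ mfC).
by have [mZ _] := Zb; have := mZ measurableT _ mA; rewrite setTI.
Qed.

Section maximal_inequality.
Variables (f g : R -> R) (u v : nat -> Omega -> R) (alpha V eta : R).
Hypothesis fb : bounded_measurable f.
Hypothesis gb : bounded_measurable g.
Hypothesis f0 : forall q, (q < Q)%N -> \int[P]_w f (xi q w) = 0.
Hypothesis g0 : forall q, (q < Q)%N -> \int[P]_w g (xi q w) = 0.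
Hypothesis ub : forall q, (q < Q)%N -> @bounded_measurable R _ (past q) (u q).
Hypothesis vb : forall q, (q < Q)%N -> @bounded_measurable R _ (past q) (v q).
Hypothesis u1 : forall q w, `|u q w| <= 1.
Hypothesis v1 : forall q w, `|v q w| <= 1.
Hypothesis fgV : forall q, (q < Q)%N -> \int[P]_w (f (xi q w) ^+ 2 + g (xi q w) ^+ 2) <= V.
Hypothesis eta_gt0 : 0 < eta.

(** The addition formula for the cosine puts every Euler step in this form: [u], [v] are known from
    the past, [f], [g] are centred functions of the fresh noise. Orthogonality then follows from
    independence, without conditional expectations. *)
Definition mart_diff q w := alpha * (u q w * f (xi q w) + v q w * g (xi q w)).

(* the martingale stopped when it leaves ]-eta, eta[ *)
Fixpoint stopped q w : R := if q is q'.+1 then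
    stopped q' w + (if `|stopped q' w| < eta then 1 else 0) * mart_diff q' w
  else 0.

(** Once outside []-eta, eta[] the stopped process is frozen. If its final value lies inside, it was
    never stopped and coincides with the martingale at all earlier times, so one value controls the
    maximum. *)
Lemma stopped_bound w : `|stopped Q w| < eta ->
  forall m, (m <= Q)%N -> `|\sum_(q < m) mart_diff q w| < eta.
Proof.
have stay m : eta <= `|stopped m w| -> eta <= `|stopped m.+1 w|.
  by move=> em; rewrite /= ltNge em/= mul0r addr0.
have stays m m' : (m <= m')%N -> eta <= `|stopped m w| -> eta <= `|stopped m' w|.
  by move=> /subnK <-; elim: (m' - m)%N => // k IH /IH; exact: stay.
move=> SQ m mQ.
have lt m' : (m' <= Q)%N -> `|stopped m' w| < eta.
  by move=> mQ'; rewrite ltNge; apply/negP => /(stays _ _ mQ'); rewrite leNgt SQ.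
suff <- : stopped m w = \sum_(q < m) mart_diff q w by exact: lt.
elim: m mQ => [|m IH] mQ; first by rewrite big_ord0.
by rewrite big_ord_recr/= lt ?(ltnW mQ)// mul1r IH// ltnW.
Qed.

Let P1 : P setT = 1%E. Proof. exact: probability_setT. Qed.

Let f_past q : (q < Q)%N -> @bounded_measurable R _ (past q.+1) (fun w => f (xi q w)).
Proof.
move=> qQ; have [mf [M fM]] := fb; split; last by exists M => w.
by apply: measurableT_comp; [exact: mf|exact: past_xi].
Qed.

Let g_past q : (q < Q)%N -> @bounded_measurable R _ (past q.+1) (fun w => g (xi q w)).
Proof.
move=> qQ; have [mg [M gM]] := gb; split; last by exists M => w.
by apply: measurableT_comp; [exact: mg|exact: past_xi].
Qed.

Let mart_diff_past q : (q < Q)%N -> @bounded_measurable R _ (past q.+1) (mart_diff q).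
Proof.
move=> qQ; apply: bounded_measurableZ; apply: bounded_measurableD; apply: bounded_measurableM.
- by apply: past_bounded_measurableS; exact: ub.
- exact: f_past.
- by apply: past_bounded_measurableS; exact: vb.
- exact: g_past.
Qed.

Definition alive q w : R := if `|stopped q w| < eta then 1 else 0.

Let alive_past q : @bounded_measurable R _ (past q) (stopped q) ->
  @bounded_measurable R _ (past q) (alive q).
Proof.
move=> [mN _]; split; last first.
  by exists 1 => w; rewrite /alive; case: ifP; rewrite ?normr1// normr0.
apply: measurable_fun_ifT => //.
apply: measurable_fun_ltr => //.
exact: measurableT_comp.
Qed.

Lemma stopped_past q : (q <= Q)%N -> @bounded_measurable R _ (past q) (stopped q).
Proof.
elim: q => [_|q IH qQ]; first exact: bounded_measurable_cst.
have Nb := IH (ltnW qQ).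
apply: bounded_measurableD; first exact: past_bounded_measurableS.
apply: bounded_measurableM; last exact: mart_diff_past.
by apply: past_bounded_measurableS; exact: alive_past.
Qed.

Let orthogonal q : (q < Q)%N ->
  \int[P]_w (stopped q w * (alive q w * mart_diff q w)) = 0.
Proof.
move=> qQ; have Nb := stopped_past (ltnW qQ); have Ab := alive_past Nb.
pose Zu w := alpha * (stopped q w * alive q w * u q w).
pose Zv w := alpha * (stopped q w * alive q w * v q w).
have Zub : @bounded_measurable R _ (past q) Zu.
  apply: bounded_measurableZ; apply: bounded_measurableM; last exact: ub.
  exact: bounded_measurableM.
have Zvb : @bounded_measurable R _ (past q) Zv.
  apply: bounded_measurableZ; apply: bounded_measurableM; last exact: vb.
  exact: bounded_measurableM.
have fqb := past_bounded_measurable (f_past qQ).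
have gqb := past_bounded_measurable (g_past qQ).
have -> : (fun w => stopped q w * (alive q w * mart_diff q w)) =
  (fun w => Zu w * f (xi q w) + Zv w * g (xi q w)).
  by apply/funext => w; rewrite /Zu /Zv /mart_diff; ring.
rewrite (Rintegral_bmD P1 (bounded_measurableM (past_bounded_measurable Zub) fqb)
  (bounded_measurableM (past_bounded_measurable Zvb) gqb)).
rewrite (past_orthogonal qQ Zub fb (f0 qQ)) (past_orthogonal qQ Zvb gb (g0 qQ)).
by rewrite addr0.
Qed.

Let mart_diff_sqr q : (q < Q)%N ->
  \int[P]_w ((alive q w * mart_diff q w) ^+ 2) <= 2 * alpha ^+ 2 * V.
Proof.
move=> qQ; have fqb := past_bounded_measurable (f_past qQ).
have gqb := past_bounded_measurable (g_past qQ).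
have sqb (h : Omega -> R) : bounded_measurable h -> bounded_measurable (fun w => h w ^+ 2).
  by move=> hb; exact: bounded_measurableM.
have sb := bounded_measurableD (sqb _ fqb) (sqb _ gqb).
apply: le_trans (_ : \int[P]_w (2 * alpha ^+ 2 * (f (xi q w) ^+ 2 + g (xi q w) ^+ 2)) <= _).
  apply: (le_Rintegral_bm P1).
  - apply: sqb; apply: past_bounded_measurable (_ : @bounded_measurable R _ (past q.+1) _).
    apply: bounded_measurableM; last exact: mart_diff_past.
    by apply: past_bounded_measurableS; apply: alive_past; exact: stopped_past (ltnW qQ).
  - exact: bounded_measurableZ.
  move=> w; rewrite exprMn /mart_diff exprMn.
  have a1 : alive q w ^+ 2 <= 1.
    by rewrite /alive; case: ifP; rewrite ?expr1n ?expr0n.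
  apply: le_trans (ler_wpM2r _ a1) _; first by rewrite mulr_ge0// sqr_ge0.
  rewrite mul1r [leRHS](_ : _ = alpha ^+ 2 * (2 * (f (xi q w) ^+ 2 + g (xi q w) ^+ 2))); last by ring.
  apply: ler_wpM2l; first exact: sqr_ge0.
  have sq (a b : R) : `|a| <= 1 -> (a * b) ^+ 2 <= b ^+ 2.
    move=> a1'; rewrite exprMn ler_piMl ?sqr_ge0// -real_normK ?num_real//.
    by rewrite exprn_ile1.
  have su := sq _ (f (xi q w)) (u1 q w); have sv := sq _ (g (xi q w)) (v1 q w).
  have := sqr_ge0 (u q w * f (xi q w) - v q w * g (xi q w)).
  rewrite sqrrB sqrrD; lra.
rewrite (Rintegral_bmZ P1 _ sb) ler_wpM2l ?fgV//.
by rewrite mulr_ge0// sqr_ge0.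
Qed.

Lemma stopped_sqr q : (q <= Q)%N ->
  \int[P]_w (stopped q w ^+ 2) <= q%:R * (2 * alpha ^+ 2 * V).
Proof.
elim: q => [_|q IH qQ].
  rewrite mul0r; under eq_Rintegral do rewrite /= expr0n.
  by rewrite (Rintegral_unit_cst P1).
have Nb := past_bounded_measurable (stopped_past (ltnW qQ)).
have Db : bounded_measurable (fun w => alive q w * mart_diff q w).
  apply: past_bounded_measurable (_ : @bounded_measurable R _ (past q.+1) _).
  apply: bounded_measurableM; last exact: mart_diff_past.
  by apply: past_bounded_measurableS; apply: alive_past; exact: stopped_past (ltnW qQ).
have -> : (fun w => stopped q.+1 w ^+ 2) = (fun w =>
   stopped q w ^+ 2 + (2 * (stopped q w * (alive q w * mart_diff q w)) +
   (alive q w * mart_diff q w) ^+ 2)).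
  by apply/funext => w; rewrite /= -/(alive q w); ring.
have N2b := bounded_measurableM Nb Nb; have D2b := bounded_measurableM Db Db.
have NDb := bounded_measurableM Nb Db.
rewrite (Rintegral_bmD P1 N2b (bounded_measurableD (bounded_measurableZ 2 NDb) D2b)).
rewrite (Rintegral_bmD P1 (bounded_measurableZ 2 NDb) D2b) (Rintegral_bmZ P1 _ NDb).
rewrite orthogonal// mulr0 add0r -natr1 mulrDl mul1r.
by apply: lerD; [exact: IH (ltnW qQ)|exact: mart_diff_sqr].
Qed.

Definition survival : set Omega := [set w | `|stopped Q w| < eta].

Lemma measurable_survival : measurable survival.
Proof.
have [mN _] := past_bounded_measurable (stopped_past (leqnn Q)).
have : measurable_fun setT (fun w => `|stopped Q w| < eta).
  by apply: measurable_fun_ltr => //; exact: measurableT_comp.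
by move/(_ measurableT [set true] I); rewrite setTI.
Qed.

(** Chebyshev's inequality for the final value of the stopped martingale, whose second moment is at
    most the sum of those of its orthogonal differences. *)
Lemma stopped_maximal :
  ((1 - Q%:R * (2 * alpha ^+ 2 * V) / eta ^+ 2)%:E <= P survival)%E.
Proof.
set S := survival; have mS : measurable S := measurable_survival.
have Nb := past_bounded_measurable (stopped_past (leqnn Q)).
have e2 : 0 < eta ^+ 2 by rewrite exprn_gt0.
have iS : \int[P]_w (\1_S w : R) = fine (P S).
  by rewrite /Rintegral integral_indic// setIT.
rewrite -[leRHS]fineK ?fin_num_measure// lee_fin -iS lerBlDr -lerBlDl.
have Ib : bounded_measurable (\1_S : Omega -> R).
  split; first exact: measurable_indic.
  by exists 1 => w; rewrite indicE; case: (_ \in _); rewrite ?normr1 ?normr0.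
rewrite -{1}(Rintegral_unit_cst P1 1) -(mulN1r (\int[P]_w _)) -(Rintegral_bmZ P1 _ Ib).
have cb : bounded_measurable (fun _ : Omega => 1 : R) by exact: bounded_measurable_cst.
rewrite -(Rintegral_bmD P1 cb (bounded_measurableZ (-1) Ib)).
apply: le_trans (_ : \int[P]_w ((eta ^+ 2)^-1 * stopped Q w ^+ 2) <= _).
  apply: (le_Rintegral_bm P1).
  - exact: (bounded_measurableD cb (bounded_measurableZ (-1) Ib)).
  - by apply: bounded_measurableZ; exact: bounded_measurableM.
  move=> w; rewrite indicE mulN1r.
  have [wS|wS] := boolP (w \in S); first by rewrite subrr mulr_ge0 ?invr_ge0 ?sqr_ge0.
  rewrite subr0 mulrC ler_pdivlMr// mul1r -[leRHS]real_normK ?num_real//.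
  rewrite ler_pXn2r ?nnegrE ?(ltW eta_gt0)//.
  by rewrite leNgt; apply/negP => ?; move/negP: wS; apply; rewrite inE.
rewrite (Rintegral_bmZ P1 _ (bounded_measurableM Nb Nb)) mulrC ler_pM2r ?invr_gt0//.
exact: stopped_sqr.
Qed.

End maximal_inequality.
End filtration.
End independence.

(** * The Euler scheme *)

Section brownian_increments.
Context (R : realType) (d : measure_display) (Omega : measurableType d).
Variable P : probability Omega R.
Variable B : nat -> R -> Omega -> R.
Hypothesis B_iid : iid_Brownian_motions P B.
Variables (n : nat) (delta : R) (S0 : set (set Omega)).
Hypothesis n_gt0 : (0 < n)%N.
Hypothesis delta_gt0 : 0 < delta.
Hypothesis S0_indep : independent2 P S0
  (sigma_of [set it : nat * R | 0 <= it.2] (fun it => B it.1 it.2)).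

(* increments over steps of length [delta], ordered first by step and then by particle *)
Definition incr q w : R :=
  B (q %% n) (delta * (q %/ n).+1%:R) w - B (q %% n) (delta * (q %/ n)%:R) w.

Let step l : R := delta * l%:R.

Let step_ge0 l : 0 <= step l. Proof. by rewrite mulr_ge0// ltW. Qed.

Let B_measurable i t : 0 <= t -> measurable_fun setT (B i t).
Proof. by have [/(_ i)[+ _ _ _] _] := B_iid; exact. Qed.

Lemma incr_measurable q : measurable_fun setT (incr q).
Proof. by apply: measurable_funB; apply: B_measurable; exact: step_ge0. Qed.

Lemma incr_law q (A : set R) : measurable A ->
  P (incr q @^-1` A) = normal_prob 0 (Num.sqrt delta) A.
Proof.
move=> mA; have [/(_ (q %% n)%N)[_ _ + _] _] := B_iid.
move=> /(_ (step (q %/ n)) (step (q %/ n).+1) (step_ge0 _)).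
have -> : step (q %/ n).+1 - step (q %/ n) = delta.
  by rewrite /step -mulrBr -natrB// subSnn mulr1.
by apply => //; rewrite /step ltr_pM2l// ltr_nat.
Qed.

Lemma incr_Rintegral q (f : R -> R) : bounded_measurable f ->
  \int[P]_w f (incr q w) = \int[normal_prob 0 (Num.sqrt delta)]_x f x.
Proof.
move=> [mf [M fM]].
have mX : measurable_fun setT (incr q : Omega -> measurableTypeR R) := incr_measurable q.
pose X : {RV P >-> measurableTypeR R} := @mfun_Sub _ _ Omega (measurableTypeR R) (incr q) (mem_set mX).
have mEf : measurable_fun setT (EFin \o f : measurableTypeR R -> \bar R) by exact/measurable_EFinP.
apply: (congr1 fine); transitivity (\int[distribution P X]_x (f x)%:E)%E; last first.
  by apply: eq_measure_integral => A mA _; exact: incr_law.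
rewrite /distribution integral_pushforward//.
apply: bounded_measurable_integrable; first exact: probability_setT.
by split; [exact: measurableT_comp mf (incr_measurable q)|exists M => w].
Qed.

Lemma sigma_of_bigcap (I : choiceType) (J : set I) (X : I -> Omega -> R) (r : seq nat)
    (s t : nat -> I) (A : nat -> set R) :
  (forall l, J (s l) /\ J (t l)) -> (forall l, measurable (A l)) ->
  sigma_of J X (\bigcap_(l in [set` r]) ((fun w => X (t l) w - X (s l) w) @^-1` A l)).
Proof.
move=> Jst mA.
pose G := \bigcup_(j in J) preimage_set_system setT (X j) measurable.
have mX j : J j -> measurable_fun setT (X j : g_sigma_algebraType G -> R).
  by move=> Jj _ C mC; apply: sub_sigma_algebra; exists j => //; exists C.
have := @bigcap_measurableType _ (g_sigma_algebraType G)
  (fun l => (fun w => X (t l) w - X (s l) w) @^-1` A l) [set` r].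
apply=> l _.
rewrite -[X in measurable X]setTI.
have [Js Jt] := Jst l.
by apply: (measurable_funB (mX _ Jt) (mX _ Js)) => //; exact: mA.
Qed.

Let steps q i := [seq (j %/ n)%N | j <- iota 0 q & (j %% n)%N == i].

Let steps_uniq q i : uniq (steps q i).
Proof.
rewrite map_inj_in_uniq ?filter_uniq ?iota_uniq// => j j'.
rewrite !mem_filter => /andP[/eqP ji _] /andP[/eqP j'i _] jj'.
by rewrite (divn_eq j n) (divn_eq j' n) jj' ji j'i.
Qed.

(** The initial data split off by hypothesis. The increments are regrouped by particle through
    [j = l * n + i]; independence of the Brownian motions separates the particles, and independence
    of increments separates the steps of each particle. *)
Lemma incr_indep q C (A : nat -> set R) : S0 C -> (forall j, measurable (A j)) ->
  P (C `&` \bigcap_(j in `I_q) (incr j @^-1` A j)) =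
  (P C * \prod_(j < q) P (incr j @^-1` A j))%E.
Proof.
move=> S0C mA; set E := \bigcap_(j in `I_q) _.
have [Bstd Bind] := B_iid.
rewrite S0_indep//; last first.
  rewrite /E (_ : `I_q = [set` iota 0 q]); last first.
    by apply/seteqP; split => j /=; rewrite mem_iota.
  apply: (@sigma_of_bigcap (nat * R)%type _ _ _ (fun l => ((l %% n)%N, step (l %/ n)))
    (fun l => ((l %% n)%N, step (l %/ n).+1))) => // l.
  by split; exact: step_ge0.
congr (_ * _)%E.
pose dB i l w := B i (step l.+1) w - B i (step l) w.
pose Ei i := \bigcap_(l in [set` steps q i]) (dB i l @^-1` A (l * n + i)%N).
have -> : E = \bigcap_(i in [set` iota 0 n]) Ei i.
  apply/seteqP; split => w.
    move=> Ew i; rewrite /= mem_iota /= add0n => im l /mapP[j].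
    rewrite mem_filter mem_iota /= add0n => /andP[/eqP ji jq] lE.
    by rewrite lE -ji -divn_eq; exact: Ew.
  move=> Ew j /= jq; have jn : (j %% n < n)%N by rewrite ltn_mod.
  have := Ew (j %% n)%N; rewrite /= mem_iota => /(_ jn (j %/ n)%N).
  rewrite -divn_eq; apply; apply/mapP; exists j => //.
  by rewrite mem_filter eqxx mem_iota.
rewrite Bind ?iota_uniq//; last first.
  move=> i _; apply: sigma_of_bigcap => // l.
  by split; rewrite /= in_itv/= andbT step_ge0.
have EiE i : P (Ei i) = (\prod_(j <- iota 0 q | (j %% n)%N == i) P (incr j @^-1` A j))%E.
  have [_ _ _ incr_ind] := Bstd i.
  rewrite (incr_ind step (step_ge0 0)) ?steps_uniq//.
  - rewrite /steps big_map big_filter; apply: eq_bigr => j /eqP ji.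
    by rewrite -{2}ji -divn_eq /incr /step ji.
  - by move=> k l kl; rewrite /step ler_pM2l// ler_nat.
  - move=> l _; apply: sub_sigma_algebra; exists tt => //.
    by exists (A (l * n + i)%N) => //; rewrite setTI.
under eq_bigr do rewrite EiE.
rewrite -[in RHS](big_mkord xpredT (fun j => P (incr j @^-1` A j))) /index_iota subn0.
rewrite [RHS](partition_big (fun j => Ordinal (ltn_pmod j n_gt0)) xpredT)//=.
have -> : iota 0 n = index_iota 0 n by rewrite /index_iota subn0.
rewrite big_mkord.
by apply: eq_bigr => i _; apply: eq_bigl => j; rewrite -val_eqE.
Qed.

End brownian_increments.

(** * The Euler scheme along a fixed path *)

Section euler_scheme.
Variable R : realType.

Lemma cos_taylor1 (a h : R) : `|cos (a + h) - cos a + h * sin a| <= h ^+ 2.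
Proof.
have D b : is_derive b (1 : R) (fun t : R => cos (a + t) + t * sin a) (- sin (a + b) + sin a).
  apply: is_derive_eq.
  by rewrite /GRing.scale/=; ring.
have bnd c : 0 <= c -> forall s, (s = 1 \/ s = -1) ->
    `|cos (a + s * c) - cos a + (s * c) * sin a| <= c ^+ 2.
  move=> c0 s s1.
  have Ds b : is_derive b (1 : R) (fun t : R => cos (a + s * t) + s * t * sin a)
      (s * (- sin (a + s * b) + sin a)).
    apply: is_derive_eq.
    by rewrite /GRing.scale/=; ring.
  have cs : {within `[0, c], continuous (fun t => cos (a + s * t) + s * t * sin a)}.
    by apply: continuous_subspaceT => y; exact: is_derive1_continuous (Ds y).
  have [b] := MVT_segment c0 (fun x _ => Ds x) cs.
  rewrite in_itv/= mulr0 addr0 mul0r addr0 subr0 => /andP[b0 bc].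
  rewrite addrAC => ->.
  have s1n : `|s| = 1 by case: s1 => ->; rewrite ?normrN normr1.
  rewrite !normrM s1n mul1r (ger0_norm c0) expr2 ler_wpM2r//.
  rewrite addrC; apply: le_trans (sin_lipschitz _ _) _.
  by rewrite opprD addrA subrr add0r normrN normrM s1n mul1r ger0_norm.
have [h0|h0] := leP 0 h.
  by have := bnd h h0 1 (or_introl erefl); rewrite mul1r.
have := bnd (- h) _ (-1) (or_intror erefl); rewrite mulN1r opprK sqrrN; apply.
by rewrite oppr_ge0 ltW.
Qed.

Lemma family_unif_continuous (I : finType) (f : I -> R -> R) (a b e : R) :
  (forall i, continuous (f i)) -> 0 < e ->
  exists2 dl, 0 < dl & forall i s t, a <= s <= b -> `|t - s| < dl -> `|f i t - f i s| < e.
Proof.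
move=> fc e0.
have /choice[dl dlP] : forall i, exists dl, 0 < dl /\
    forall s t, a <= s <= b -> `|t - s| < dl -> `|f i t - f i s| < e.
  by move=> i; have [dl dl0 H] := segment_unif_continuous a b (fc i) e0; exists dl.
exists (\big[Num.min/1]_i dl i).
  by elim/big_ind : _ => // [x y x0 y0|i _]; [rewrite lt_min x0|have [] := dlP i].
move=> i s t sab st; have [_] := dlP i; apply => //.
apply: lt_le_trans st _; exact: bigmin_le_cond.
Qed.

Variables (n : nat) (a : 'I_n -> 'I_n -> R).

Definition drift (x : 'I_n -> R) i : R := \sum_j a i j * sin (x i - x j).

(** A crude constant depending on the whole graph. It enters only estimates in which [n] is fixed
    and the mesh tends to 0. *)
Definition drift_norm : R := \sum_i \sum_j `|a i j|.
Notation L := drift_norm.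

Let row_le i : \sum_j `|a i j| <= L.
Proof. by rewrite /L [leRHS](bigD1 i)//= lerDl sumr_ge0// => j _; rewrite sumr_ge0. Qed.

Lemma drift_norm_ge0 : 0 <= L.
Proof. by rewrite sumr_ge0// => i _; rewrite sumr_ge0. Qed.
Let L0 := drift_norm_ge0.

Lemma norm_drift_le x i : `|drift x i| <= L.
Proof.
apply: le_trans (row_le i); apply: le_trans (ler_norm_sum _ _ _) _.
by apply: ler_sum => j _; rewrite normrM ler_piMr// sin_max.
Qed.

Lemma drift_lipschitz x y i :
  `|drift x i - drift y i| <= 2 * (\sum_j `|a i j|) * \sum_j `|x j - y j|.
Proof.
rewrite /drift -sumrB [2 * _]mulr_sumr [leRHS]mulr_suml.
apply: le_trans (ler_norm_sum _ _ _) _; apply: ler_sum => j _.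
rewrite -mulrBr normrM mulrAC mulrC ler_wpM2r//.
apply: le_trans (sin_lipschitz _ _) _.
have -> : x i - x j - (y i - y j) = (x i - y i) - (x j - y j) by ring.
apply: le_trans (ler_normB _ _) _.
have le1 l : `|x l - y l| <= \sum_j `|x j - y j|.
  by rewrite [leRHS](bigD1 l)//= lerDl sumr_ge0.
by rewrite mulrDl mul1r lerD.
Qed.

Variables (delta : R) (b : nat -> 'I_n -> R) (x0 : 'I_n -> R).
Hypothesis delta_gt0 : 0 < delta.

Fixpoint euler l : 'I_n -> R := if l is l'.+1 then
  fun i => euler l' i + delta * drift (euler l') i + b l' i else x0.

(** The position after the drift and before the noise of the step. It is determined by the past, so
    [c * cos (k * predrift l i + phi)] is an exact compensator and not merely an approximate one. *)
Definition predrift l i : R := euler l i + delta * drift (euler l) i.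

Variables (x : 'I_n -> R -> R) (beta : 'I_n -> R -> R).
Hypothesis xc : forall i, continuous (x i).
Hypothesis x_eq : forall i t, 0 <= t ->
  x i t = x0 i + cint (fun s => drift (x^~ s) i) 0 t + beta i t.
Hypothesis bE : forall l i, b l i = beta i (delta * l.+1%:R) - beta i (delta * l%:R).
Hypothesis beta0 : forall i, beta i 0 = 0.

Lemma drift_path_continuous i : continuous (fun s => drift (x^~ s) i).
Proof.
apply: continuous_sum => j s; apply: cvgM; first exact: cvg_cst.
apply: continuous_comp; last exact: continuous_sin.
by apply: cvgB; exact: xc.
Qed.

Let dc := drift_path_continuous.
Let step l : R := delta * l%:R.

Let stepS l : step l.+1 = step l + delta.
Proof. by rewrite /step -natr1 mulrDr mulr1. Qed.

Let step_ge0 l : 0 <= step l. Proof. by rewrite mulr_ge0// ltW. Qed.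

Let stepSle l : step l <= step l.+1. Proof. by rewrite stepS lerDl ltW. Qed.

Lemma path_step l i : x i (step l.+1) =
  x i (step l) + cint (fun s => drift (x^~ s) i) (step l) (step l.+1) + b l i.
Proof.
rewrite !x_eq// (cint_cat (@dc i) (step_ge0 l) (stepSle l)) bE -/(step l) -/(step l.+1).
by ring.
Qed.

Definition euler_error l : R := \sum_i `|euler l i - x i (step l)|.

Lemma cint_step_close (f : R -> R) om l : continuous f ->
  (forall s, step l <= s <= step l.+1 -> `|f s - f (step l)| <= om) ->
  `|cint f (step l) (step l.+1) - delta * f (step l)| <= delta * om.
Proof.
move=> fc fom.
have cc : continuous (fun _ : R => f (step l)) by move=> ?; exact: cvg_cst.
have -> : delta * f (step l) = cint (fun=> f (step l)) (step l) (step l.+1).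
  by rewrite cint_cst// stepS addrAC subrr add0r mulrC.
rewrite -cintB//; apply: le_trans (norm_cint_le _ (stepSle l) fom) _.
  by move=> s; apply: cvgB; [exact: fc|exact: cc].
by rewrite stepS addrAC subrr add0r mulrC.
Qed.

(** The noise is additive and cancels exactly between the scheme and the path. The local error is
    thus only the oscillation [om] of the drift over a step. *)
Lemma euler_error_le om m : 0 <= om ->
  (forall l i s, (l < m)%N -> step l <= s <= step l.+1 ->
    `|drift (x^~ s) i - drift (x^~ (step l)) i| <= om) ->
  forall l, (l <= m)%N -> euler_error l <= step l * (n%:R * om) * expR (2 * L * step l).
Proof.
move=> om0 omP l lm.
have k0 : 0 <= delta * (n%:R * om) by rewrite !mulr_ge0// ltW.
have Ld : 0 <= 2 * L * delta by rewrite mulr_ge0 ?mulr_ge0 ?L0// ltW.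
have e0 : euler_error 0 = 0.
  rewrite /euler_error big1// => i _ /=.
  by rewrite /step mulr0 x_eq// cintxx beta0 !addr0 subrr normr0.
have eS l' : (l' < m)%N ->
    euler_error l'.+1 <= (1 + 2 * L * delta) * euler_error l' + delta * (n%:R * om).
  move=> lm'.
  have term i : `|euler l'.+1 i - x i (step l'.+1)| <=
      `|euler l' i - x i (step l')| + delta * (2 * (\sum_j `|a i j|) * euler_error l') +
      delta * om.
    rewrite path_step /=.
    set I := cint _ _ _.
    have -> : euler l' i + delta * drift (euler l') i + b l' i - (x i (step l') + I + b l' i) =
      (euler l' i - x i (step l')) + delta * (drift (euler l') i - drift (x^~ (step l')) i) -
      (I - delta * drift (x^~ (step l')) i) by ring.
    apply: le_trans (ler_normB _ _) _; apply: lerD.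
      apply: le_trans (ler_normD _ _) _; rewrite lerD2l normrM gtr0_norm//.
      by rewrite ler_pM2l//; exact: drift_lipschitz.
    by apply: cint_step_close => // s; exact: omP.
  apply: le_trans (ler_sum _ (fun i _ => term i)) _.
  rewrite !big_split/= sumr_const card_ord -!mulr_sumr -mulr_suml -mulr_sumr.
  rewrite -/(euler_error l') -/L -mulr_natl.
  by rewrite le_eqVlt; apply/orP; left; apply/eqP; ring.
apply: le_trans (discrete_gronwall Ld k0 e0 eS lm) _.
have -> : l%:R * (delta * (n%:R * om)) = step l * (n%:R * om) by rewrite /step; ring.
apply: ler_wpM2l; first by apply: mulr_ge0; [exact: step_ge0|exact: mulr_ge0].
apply: le_trans (le_expR_mul1D l Ld) _.
by rewrite ler_expR /step mulrA.
Qed.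

Variables (k phi : R).
Hypothesis k_ge0 : 0 <= k.

Definition mean_cos (y : 'I_n -> R) : R := n%:R^-1 * \sum_i cos (k * y i + phi).

(* drift of the Ito formula for [mean_cos] *)
Definition gen (y : 'I_n -> R) : R := n%:R^-1 *
  \sum_i (- (k ^+ 2 / 2) * cos (k * y i + phi) - k * sin (k * y i + phi) * drift y i).

Definition residual t : R :=
  mean_cos (x^~ t) - mean_cos (x^~ 0) - cint (fun s => gen (x^~ s)) 0 t.

(* a martingale when [c] is the mean of [cos (k b)] for the centred noise [b] *)
Definition euler_mart (c : R) m : R := \sum_(l < m) n%:R^-1 *
  \sum_i (cos (k * euler l.+1 i + phi) - c * cos (k * predrift l i + phi)).

Hypothesis n_gt0 : (0 < n)%N.

Let mean_le (F : 'I_n -> R) C : (forall i, `|F i| <= C) -> `|n%:R^-1 * \sum_i F i| <= C.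
Proof.
move=> FC; rewrite normrM ger0_norm ?invr_ge0// ler_pdivrMl ?ltr0n//.
apply: le_trans (ler_norm_sum _ _ _) _; apply: le_trans (ler_sum _ (fun i _ => FC i)) _.
by rewrite sumr_const card_ord mulr_natl.
Qed.

Lemma path_gen_continuous : continuous (fun s => gen (x^~ s)).
Proof.
have kc i : continuous (fun s => k * x i s + phi).
  move=> s; apply: cvgD; last exact: cvg_cst.
  by apply: cvgM; [exact: cvg_cst|exact: xc].
move=> s; apply: cvgM; first exact: cvg_cst.
apply: continuous_sum => i {}s; apply: cvgB; apply: cvgM.
- exact: cvg_cst.
- by apply: (continuous_comp (kc i s)); exact: continuous_cos.
- apply: cvgM; first exact: cvg_cst.
  by apply: (continuous_comp (kc i s)); exact: continuous_sin.
- exact: dc.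
Qed.

Let err_i l i : `|euler l i - x i (step l)| <= euler_error l.
Proof. by rewrite /euler_error [leRHS](bigD1 i)//= lerDl sumr_ge0. Qed.

Let mean_cos_close l : `|mean_cos (euler l) - mean_cos (x^~ (step l))| <= k * euler_error l.
Proof.
rewrite /mean_cos -mulrBr -sumrB; apply: mean_le => i.
apply: le_trans (cos_lipschitz _ _) _.
rewrite opprD addrACA subrr addr0 -mulrBr normrM ger0_norm//.
by apply: ler_wpM2l => //; exact: err_i.
Qed.

Let gen_close l : `|gen (euler l) - gen (x^~ (step l))| <=
  (k ^+ 3 / 2 + k * (2 * L + k * L)) * euler_error l.
Proof.
rewrite /gen -mulrBr -sumrB; apply: mean_le => i.
set y := euler l; set z := x^~ (step l).
have yz : `|k * y i + phi - (k * z i + phi)| <= k * euler_error l.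
  rewrite opprD addrACA subrr addr0 -mulrBr normrM ger0_norm//.
  by apply: ler_wpM2l => //; exact: err_i.
have -> : - (k ^+ 2 / 2) * cos (k * y i + phi) - k * sin (k * y i + phi) * drift y i -
   (- (k ^+ 2 / 2) * cos (k * z i + phi) - k * sin (k * z i + phi) * drift z i) =
  - (k ^+ 2 / 2) * (cos (k * y i + phi) - cos (k * z i + phi)) -
  k * (sin (k * y i + phi) * (drift y i - drift z i) +
    (sin (k * y i + phi) - sin (k * z i + phi)) * drift z i) by ring.
have c1 := le_trans (cos_lipschitz _ _) yz; have s1 := le_trans (sin_lipschitz _ _) yz.
have k2 : 0 <= k ^+ 2 / 2 by rewrite divr_ge0// sqr_ge0.
have E0 : 0 <= euler_error l by exact: le_trans (err_i l i).
apply: le_trans (ler_normB _ _) _; rewrite [leRHS]mulrDl; apply: lerD.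
  rewrite normrM normrN (ger0_norm k2).
  apply: le_trans (ler_wpM2l k2 c1) _.
  by rewrite le_eqVlt; apply/orP; left; apply/eqP; field.
rewrite normrM (ger0_norm k_ge0) -mulrA ler_wpM2l// [leRHS]mulrDl.
apply: le_trans (ler_normD _ _) _; apply: lerD.
  rewrite normrM -[leRHS]mul1r; apply: ler_pM => //; first exact: sin_max.
  apply: le_trans (drift_lipschitz _ _ _) _.
  by rewrite ler_wpM2r// ler_wpM2l//.
rewrite normrM mulrAC; apply: ler_pM => //; exact: norm_drift_le.
Qed.

(** One step of the Ito formula: the defect [1 - c] gives the second-order term, a first-order
    expansion of the cosine at the predrift gives the transport term, and all remainders are of
    order [delta^2]. *)
Let step_close c C l : `|1 - c - k ^+ 2 * delta / 2| <= C * delta ^+ 2 ->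
  `|n%:R^-1 * (\sum_i (c * cos (k * predrift l i + phi) - cos (k * euler l i + phi))) -
     delta * gen (euler l)| <= (C + k ^+ 3 * L / 2 + (k * L) ^+ 2) * delta ^+ 2.
Proof.
move=> cC; rewrite /gen (mulrCA delta) -mulrBr mulr_sumr -sumrB; apply: mean_le => i.
set y := euler l i; set g := drift (euler l) i; rewrite /predrift -/y -/g.
have h1 := cos_taylor1 (k * y + phi) (k * (delta * g)).
have -> : k * (y + delta * g) + phi = k * y + phi + k * (delta * g) by ring.
set al := k * y + phi in h1 *; set h := k * (delta * g) in h1 *.
have gL : `|g| <= L by exact: norm_drift_le.
have hL : `|h| <= k * L * delta.
  rewrite /h !normrM (ger0_norm k_ge0) (gtr0_norm delta_gt0).
  by rewrite -mulrA ler_wpM2l// mulrC ler_wpM2r// ltW.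
have h2L : h ^+ 2 <= (k * L) ^+ 2 * delta ^+ 2.
  rewrite -exprMn -real_normK ?num_real// ler_pXn2r// nnegrE//.
  by rewrite !mulr_ge0// ltW.
have -> : c * cos (al + h) - cos al - delta * (- (k ^+ 2 / 2) * cos al - k * sin al * g) =
  - ((1 - c - k ^+ 2 * delta / 2) * cos (al + h)) -
  k ^+ 2 * delta / 2 * (cos (al + h) - cos al) +
  (cos (al + h) - cos al + h * sin al) by rewrite /h; field.
rewrite [leRHS]mulrDl [X in _ <= X + _]mulrDl.
apply: le_trans (ler_normD _ _) _; apply: lerD; last exact: le_trans h1 h2L.
apply: le_trans (ler_normB _ _) _; apply: lerD.
  rewrite normrN normrM -[leRHS]mulr1; apply: ler_pM => //; exact: cos_max.
have kd : 0 <= k ^+ 2 * delta / 2 by rewrite divr_ge0// mulr_ge0 ?sqr_ge0// ltW.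
rewrite normrM ger0_norm//.
have c1 : `|cos (al + h) - cos al| <= k * L * delta.
  by apply: le_trans (cos_lipschitz _ _) _; rewrite addrAC subrr add0r.
apply: le_trans (ler_wpM2l kd c1) _.
by rewrite le_eqVlt; apply/orP; left; apply/eqP; field.
Qed.

(** Telescoping [mean_cos] along the scheme expresses the martingale as an increment minus the
    compensators, and these form a Riemann sum of [gen] along the path. *)
Lemma euler_mart_residual c C om e m :
  `|1 - c - k ^+ 2 * delta / 2| <= C * delta ^+ 2 ->
  (forall l s, (l < m)%N -> step l <= s <= step l.+1 ->
    `|gen (x^~ s) - gen (x^~ (step l))| <= om) ->
  (forall l, (l <= m)%N -> euler_error l <= e) ->
  forall l, (l <= m)%N -> `|euler_mart c l - residual (step l)| <=
    k * e + step l * ((C + k ^+ 3 * L / 2 + (k * L) ^+ 2) * delta +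
      (k ^+ 3 / 2 + k * (2 * L + k * L)) * e + om).
Proof.
move=> cC omP eP.
set C1 := C + _ + _; set C2 := k ^+ 3 / 2 + _.
have C20 : 0 <= C2.
  by rewrite addr_ge0 ?divr_ge0 ?exprn_ge0// mulr_ge0// addr_ge0// mulr_ge0.
pose F := fun s => gen (x^~ s).
pose S l := \sum_(l' < l) n%:R^-1 *
  (\sum_i (c * cos (k * predrift l' i + phi) - cos (k * euler l' i + phi))).
have Sle l : (l <= m)%N -> `|S l - cint F 0 (step l)| <=
    step l * (C1 * delta + C2 * e + om).
  elim: l => [_|l IH lm].
    by rewrite /S big_ord0 /step mulr0 cintxx subrr normr0 mul0r.
  rewrite /S big_ord_recr/= -/(S l) (cint_cat path_gen_continuous (step_ge0 l) (stepSle l)).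
  set s := _ * \sum_i _; set I := cint F (step l) _.
  rewrite stepS [leRHS]mulrDl.
  have -> : S l + s - (cint F 0 (step l) + I) = (S l - cint F 0 (step l)) + (s - I) by ring.
  apply: le_trans (ler_normD _ _) _; apply: lerD; first exact: IH (ltnW lm).
  have -> : s - I = (s - delta * gen (euler l)) + delta * (gen (euler l) - F (step l)) -
     (I - delta * F (step l)) by ring.
  apply: le_trans (ler_normB _ _) _; rewrite [leRHS]mulrDr; apply: lerD; last first.
    by apply: cint_step_close => [|s']; [exact: path_gen_continuous|exact: omP].
  apply: le_trans (ler_normD _ _) _; rewrite [leRHS]mulrDr; apply: lerD.
    apply: le_trans (step_close l cC) _.
    by rewrite le_eqVlt; apply/orP; left; apply/eqP; rewrite /C1; ring.
  rewrite normrM gtr0_norm// ler_pM2l//.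
  apply: le_trans (gen_close l) _.
  by rewrite ler_wpM2l// eP// ltnW.
move=> l lm.
have ME l' : euler_mart c l' = mean_cos (euler l') - mean_cos (euler 0) - S l'.
  elim: l' => [|l' IH]; first by rewrite /euler_mart /S !big_ord0 subrr subr0.
  rewrite /euler_mart /S !big_ord_recr/= -/(euler_mart c l') -/(S l') IH /mean_cos.
  rewrite sumrB mulrBr sumrB mulrBr /=; ring.
have E0 : mean_cos (euler 0) = mean_cos (x^~ 0).
  rewrite /mean_cos; congr (_ * _); apply: eq_bigr => i _.
  by rewrite /= x_eq// cintxx beta0 !addr0.
rewrite ME E0 /residual -/F.
have -> : mean_cos (euler l) - mean_cos (x^~ 0) - S l -
    (mean_cos (x^~ (step l)) - mean_cos (x^~ 0) - cint F 0 (step l)) =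
  (mean_cos (euler l) - mean_cos (x^~ (step l))) - (S l - cint F 0 (step l)) by ring.
apply: le_trans (ler_normB _ _) _; apply: lerD; last exact: Sle.
apply: le_trans (mean_cos_close l) _.
by rewrite ler_wpM2l// eP.
Qed.

End euler_scheme.

(** * Passage to the limit in the mesh along a fixed path *)

Section residual_limit.
Variables (R : realType) (n : nat) (a : 'I_n -> 'I_n -> R) (x0 : 'I_n -> R).
Variables (x : 'I_n -> R -> R) (beta : 'I_n -> R -> R) (k phi T eta C : R) (c : nat -> R).
Hypothesis n_gt0 : (0 < n)%N.
Hypothesis xc : forall i, continuous (x i).
Hypothesis x_eq : forall i t, 0 <= t ->
  x i t = x0 i + cint (fun s => drift a (x^~ s) i) 0 t + beta i t.
Hypothesis beta0 : forall i, beta i 0 = 0.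
Hypothesis k_ge0 : 0 <= k.
Hypothesis T_gt0 : 0 < T.

Definition mesh (r : nat) : R := T / r%:R.

Definition noise_step r l i : R :=
  beta i (mesh r * l.+1%:R) - beta i (mesh r * l%:R).

Hypothesis C_ge0 : 0 <= C.
Hypothesis cC : forall r, (0 < r)%N -> `|1 - c r - k ^+ 2 * mesh r / 2| <= C * mesh r ^+ 2.
Hypothesis freq : forall r0, exists2 r, (r0 < r)%N & forall m, (m <= r)%N ->
  `|euler_mart a (mesh r) (noise_step r) x0 k phi (c r) m| < eta.

Notation L := (drift_norm a).

Let norm_gen_le y : `|gen a k phi y| <= k ^+ 2 / 2 + k * L.
Proof.
rewrite /gen normrM ger0_norm ?invr_ge0// ler_pdivrMl ?ltr0n//.
apply: le_trans (ler_norm_sum _ _ _) _.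
apply: le_trans (_ : \sum_(i < n) (k ^+ 2 / 2 + k * L) <= _); last first.
  by rewrite sumr_const card_ord mulr_natl.
apply: ler_sum => i _.
apply: le_trans (ler_normB _ _) _; apply: lerD.
  have k2 : 0 <= k ^+ 2 / 2 by rewrite divr_ge0// sqr_ge0.
  by rewrite normrM normrN (ger0_norm k2) ler_piMr// cos_max.
rewrite -mulrA normrM (ger0_norm k_ge0) ler_wpM2l// normrM -[leRHS]mul1r.
by apply: ler_pM => //; [exact: sin_max|exact: norm_drift_le].
Qed.

(** [freq] bounds the martingale for arbitrarily large [r] only. This suffices: the graph and the
    path are fixed, so the errors of the scheme tend to 0 with no rate uniform in them. *)
Lemma residual_le t : 0 <= t <= T -> `|residual a x k phi t| <= eta.
Proof.
move=> /andP[t0 tT]; apply/ler_addgt0Pl => e e0.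
have L0 := drift_norm_ge0 a.
have e8 : 0 < e / 8 by rewrite divr_gt0.
pose C1 := C + k ^+ 3 * L / 2 + (k * L) ^+ 2.
pose C2 := k ^+ 3 / 2 + k * (2 * L + k * L).
have C10 : 0 <= C1.
  by rewrite !addr_ge0 ?sqr_ge0// divr_ge0// mulr_ge0// exprn_ge0.
have C20 : 0 <= C2.
  by rewrite addr_ge0 ?divr_ge0 ?exprn_ge0// mulr_ge0// addr_ge0// mulr_ge0.
pose E := T * n%:R * expR (2 * L * T).
have E0 : 0 <= E by rewrite !mulr_ge0 ?expR_ge0// ltW.
pose G := k ^+ 2 / 2 + k * L.
have G0 : 0 <= G by rewrite addr_ge0 ?divr_ge0 ?sqr_ge0// mulr_ge0.
(* The Euler error is at most [E * om1]; this choice makes its total contribution, direct and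
   through [gen], at most [e / 8]. *)
pose om1 := (e / 8) / ((k + T * C2) * E + 1).
have den0 : 0 < (k + T * C2) * E + 1.
  by rewrite ltr_wpDl// mulr_ge0// addr_ge0// mulr_ge0// ltW.
have om10 : 0 < om1 by rewrite divr_gt0.
pose om2 := (e / 8) / T.
have om20 : 0 < om2 by rewrite divr_gt0.
have dcont i : continuous (fun s => drift a (x^~ s) i) by exact: drift_path_continuous.
have [d1 d10 H1] := family_unif_continuous 0 T dcont om10.
have gcont : continuous (fun s => gen a k phi (x^~ s)) by exact: path_gen_continuous.
have [d2 d20 H2] := segment_unif_continuous 0 T gcont om20.
have mcont : continuous (fun s => mean_cos k phi (x^~ s)).
  move=> s; apply: cvgM; first exact: cvg_cst.
  apply: continuous_sum => i {}s.
  apply: continuous_comp; last exact: continuous_cos.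
  apply: cvgD; last exact: cvg_cst.
  by apply: cvgM; [exact: cvg_cst|exact: xc].
have [d3 d30 H3] := segment_unif_continuous 0 T mcont e8.
(* The mesh has to resolve the three moduli of continuity, absorb the quadratic errors of the steps,
   and make the integral of [gen] over an incomplete step negligible. *)
pose dl := Num.min (Num.min d1 d2) (Num.min d3 (Num.min ((e / 8) / (T * C1 + 1)) ((e / 8) / (G + 1)))).
have TC1 : 0 < T * C1 + 1 by rewrite ltr_wpDl// mulr_ge0// ltW.
have G1 : 0 < G + 1 by rewrite ltr_wpDl.
have dl0 : 0 < dl by rewrite !lt_min d10 d20 d30 !divr_gt0.
have [r r0 Hr] := freq (Num.bound (T / dl)).
have rgt0 : (0 < r)%N by exact: leq_ltn_trans r0.
have rR : 0 < r%:R :> R by rewrite ltr0n.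
have mdl : mesh r < dl.
  rewrite /mesh ltr_pdivrMr// mulrC -ltr_pdivrMr//.
  apply: lt_trans (archi_boundP _) _; first by rewrite divr_ge0// ltW.
  by rewrite ltr_nat.
have m0 : 0 < mesh r by rewrite divr_gt0.
have : [/\ mesh r < d1, mesh r < d2, mesh r < d3, mesh r * (T * C1 + 1) <= e / 8 &
    mesh r * (G + 1) <= e / 8].
  move: mdl; rewrite !lt_min => /andP[/andP[? ?] /andP[? /andP[h4 h5]]]; split => //.
    by rewrite -ler_pdivlMr// ltW.
  by rewrite -ler_pdivlMr// ltW.
move=> [md1 md2 md3 mC1 mG].
have stepT l : (l <= r)%N -> mesh r * l%:R <= T.
  move=> lr; rewrite /mesh mulrAC ler_pdivrMr// ler_pM2l//.
  by rewrite ler_nat.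
have close l s : mesh r * l%:R <= s <= mesh r * l.+1%:R -> `|s - mesh r * l%:R| <= mesh r.
  move=> /andP[h1 h2]; rewrite ger0_norm ?subr_ge0//.
  by move: h2; rewrite -natr1 mulrDr mulr1; lra.
have step0 l : 0 <= mesh r * l%:R by rewrite mulr_ge0// ltW.
have bE l i : noise_step r l i = beta i (mesh r * l.+1%:R) - beta i (mesh r * l%:R) by [].
have om1P l i s : (l < r)%N -> mesh r * l%:R <= s <= mesh r * l.+1%:R ->
    `|drift a (x^~ s) i - drift a (x^~ (mesh r * l%:R)) i| <= om1.
  move=> lr sl; apply: ltW; apply: H1; first by rewrite step0 stepT// ltnW.
  by apply: le_lt_trans (close _ _ sl) _.
have om2P l s : (l < r)%N -> mesh r * l%:R <= s <= mesh r * l.+1%:R ->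
    `|gen a k phi (x^~ s) - gen a k phi (x^~ (mesh r * l%:R))| <= om2.
  move=> lr sl; apply: ltW; apply: H2; first by rewrite step0 stepT// ltnW.
  by apply: le_lt_trans (close _ _ sl) _.
have errP l : (l <= r)%N ->
    euler_error a (mesh r) (noise_step r) x0 x l <= E * om1.
  move=> lr; apply: le_trans (euler_error_le m0 xc x_eq bE beta0 (ltW om10) om1P lr) _.
  have -> : E * om1 = T * (n%:R * om1) * expR (2 * L * T) by rewrite /E; ring.
  have no : 0 <= n%:R * om1 by rewrite mulr_ge0// ltW.
  apply: ler_pM; rewrite ?expR_ge0//; first by rewrite mulr_ge0.
    by rewrite ler_wpM2r// stepT.
  by rewrite ler_expR ler_wpM2l ?stepT// mulr_ge0.
have main l (lr : (l <= r)%N) :=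
  @euler_mart_residual R n a (mesh r) (noise_step r) x0 m0 x beta xc x_eq beta0
    k phi k_ge0 n_gt0 (c r) C om2 (E * om1) r (cC rgt0) om2P errP l lr.
pose l := Num.truncn (t / mesh r).
have /andP[l1 l2] : l%:R <= t / mesh r < l.+1%:R.
  by apply: truncn_itv; rewrite divr_ge0// ltW.
have tl1 : mesh r * l%:R <= t by rewrite mulrC -ler_pdivlMr.
have tl2 : t <= mesh r * l.+1%:R by rewrite mulrC -ler_pdivrMr// ltW.
have lr : (l <= r)%N.
  rewrite -(ler_nat R); apply: le_trans l1 _.
  by rewrite /mesh invf_div mulrCA ler_piMr// ler_pdivrMr// mul1r.
have tl : `|t - mesh r * l%:R| <= mesh r by apply: close; rewrite tl1 tl2.
have rl : `|residual a x k phi t - residual a x k phi (mesh r * l%:R)| <= e / 4.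
  rewrite /residual (cint_cat gcont (step0 l) tl1).
  set I := cint _ (mesh r * _) t.
  have -> : mean_cos k phi (x^~ t) - mean_cos k phi (x^~ 0) -
     (cint (fun s => gen a k phi (x^~ s)) 0 (mesh r * l%:R) + I) -
     (mean_cos k phi (x^~ (mesh r * l%:R)) - mean_cos k phi (x^~ 0) -
     cint (fun s => gen a k phi (x^~ s)) 0 (mesh r * l%:R)) =
    (mean_cos k phi (x^~ t) - mean_cos k phi (x^~ (mesh r * l%:R))) - I by ring.
  apply: le_trans (ler_normB _ _) _.
  have h1 : `|mean_cos k phi (x^~ t) - mean_cos k phi (x^~ (mesh r * l%:R))| <= e / 8.
    apply: ltW; apply: H3; first by rewrite step0 stepT.
    by apply: le_lt_trans tl _.
  have h2 : `|I| <= G * (t - mesh r * l%:R).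
    by apply: norm_cint_le => // s _; exact: norm_gen_le.
  have h3 : G * (t - mesh r * l%:R) <= e / 8.
    apply: le_trans mG; rewrite mulrC; apply: ler_pM => //.
    - by rewrite subr_ge0.
    - by apply: le_trans (ler_norm _) tl.
    - by rewrite lerDl.
  lra.
have := main l lr; have := Hr l lr.
set M := euler_mart _ _ _ _ _ _ _ _; set Rl := residual _ _ _ _ (mesh r * _) in rl *.
rewrite -/C1 -/C2 => Ml MR.
have bnd : k * (E * om1) + mesh r * l%:R * (C1 * mesh r + C2 * (E * om1) + om2) <= 3 * (e / 8).
  have sT := stepT l lr.
  apply: le_trans (_ : k * (E * om1) + T * (C1 * mesh r + C2 * (E * om1) + om2) <= _).
    rewrite lerD2l; apply: ler_wpM2r => //.
    apply: addr_ge0 (ltW om20); apply: addr_ge0; first by rewrite mulr_ge0// ltW.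
    by rewrite mulr_ge0// mulr_ge0// ltW.
  have a1 : ((k + T * C2) * E) * om1 <= e / 8.
    apply: le_trans (_ : ((k + T * C2) * E + 1) * om1 <= _).
      by rewrite ler_wpM2r ?(ltW om10)// lerDl.
    by rewrite /om1 mulrC divfK// gt_eqF.
  have a2 : T * om2 = e / 8 by rewrite /om2 mulrC divfK// gt_eqF.
  have a3 : T * C1 * mesh r <= e / 8.
    apply: le_trans mC1; rewrite mulrC ler_wpM2l ?(ltW m0)// lerDl//.
  have -> : k * (E * om1) + T * (C1 * mesh r + C2 * (E * om1) + om2) =
    ((k + T * C2) * E) * om1 + T * C1 * mesh r + T * om2 by ring.
  lra.
have -> : residual a x k phi t = (residual a x k phi t - Rl) - (M - Rl) + M by ring.
apply: le_trans (ler_normD _ _) _.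
have := ler_normB (residual a x k phi t - Rl) (M - Rl).
lra.
Qed.

End residual_limit.

(** * Probability that the discrete martingale stays small *)

Section euler_probability.
Context (R : realType) (d : measure_display) (Omega : measurableType d).
Variable P : probability Omega R.
Variable B : nat -> R -> Omega -> R.
Hypothesis B_iid : iid_Brownian_motions P B.
Variables (n : nat) (theta0 : nat -> Omega -> torus R) (a : 'I_n -> 'I_n -> R).
Hypothesis n_gt0 : (0 < n)%N.
Hypothesis theta0_measurable : forall i : 'I_n, measurable_fun setT (theta0 i).
Hypothesis theta0_indep : independent2 P (sigma_of [set i | (i < n)%N] theta0)
  (sigma_of [set it : nat * R | 0 <= it.2] (fun it => B it.1 it.2)).
Variables (k : nat) (phi T eta : R).
Hypothesis T_gt0 : 0 < T.
Hypothesis eta_gt0 : 0 < eta.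

Notation S0 := (sigma_of [set i | (i < n)%N] theta0).

Definition start w (i : 'I_n) : R := repr (theta0 i w).

Definition noise r w (l : nat) (i : 'I_n) : R :=
  B i (mesh T r * l.+1%:R) w - B i (mesh T r * l%:R) w.

Definition cos_mean r : R := \int[normal_prob 0 (Num.sqrt (mesh T r))]_x cos (k%:R * x).

Definition euler_at r w := euler a (mesh T r) (noise r w) (start w).
Definition predrift_at r w := predrift a (mesh T r) (noise r w) (start w).

Section fixed_mesh.
Variable r : nat.
Hypothesis r_gt0 : (0 < r)%N.
Notation delta := (mesh T r).
Notation xi := (incr B n delta).
Notation past q := (g_sigma_algebraType (past_rect S0 xi q)).

Let delta_gt0 : 0 < delta. Proof. by rewrite divr_gt0// ltr0n. Qed.

Lemma S0_sigma : sigma_algebra setT S0. Proof. exact: smallest_sigma_algebra. Qed.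

Lemma S0_measurable : S0 `<=` measurable.
Proof.
apply: smallest_sub; first exact: sigma_algebra_measurable.
by move=> _ [i /= ni [A mA <-]]; exact: (theta0_measurable (Ordinal ni)).
Qed.

Let xim q : measurable_fun setT (xi q).
Proof. exact: (incr_measurable B_iid n delta_gt0 q). Qed.

Let xi_indep q C (A : nat -> set R) : (q <= r * n)%N -> S0 C ->
  (forall j, measurable (A j)) ->
  P (C `&` \bigcap_(j in `I_q) (xi j @^-1` A j)) =
  (P C * \prod_(j < q) P (xi j @^-1` A j))%E.
Proof. by move=> _; exact: (incr_indep B_iid n_gt0 delta_gt0 theta0_indep). Qed.

Lemma past_measurable_le q q' (Z : Omega -> R) : (q <= q')%N ->
  measurable_fun setT (Z : past q -> R) -> measurable_fun setT (Z : past q' -> R).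
Proof.
move=> /subnK <-; elim: (q' - q)%N => // m IH /IH mZ _ A mA; rewrite addSn.
have := mZ measurableT _ mA.
by apply: sub_sigma_algebra2; exact: past_rectS.
Qed.

Let wave_past q (i : 'I_n) c j psi :
  measurable_fun setT ((fun w => wave c j psi (theta0 i w)) : past q -> R).
Proof.
apply: past_S0 => A mA; apply: sub_sigma_algebra; exists (val i) => //=.
exists (wave c j psi @^-1` A); last by rewrite setTI.
rewrite -[X in measurable X]setTI; exact: wave_measurable.
Qed.

Let incr_noise w l (i : 'I_n) : xi (l * n + i) w = noise r w l i.
Proof.
rewrite /incr /noise modnMDl modn_small// divnMDl// divn_small// addn0.
by [].
Qed.

(* [repr] is not known to be measurable: the starting points may enter only
   through periodic functions. *)
Definition displacement l (i : 'I_n) w : R := euler_at r w l i - start w i.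

Let drift_past q l i : (forall j, measurable_fun setT (displacement l j : past q -> R)) ->
  measurable_fun setT ((fun w => drift a (euler_at r w l) i) : past q -> R).
Proof.
move=> mV; apply: measurable_sum => j; apply: measurable_funM => //.
(* The addition formulas separate the starting points, which come in through waves and hence
   measurably, from the adapted displacements. *)
have -> : (fun w => sin (euler_at r w l i - euler_at r w l j)) = (fun w =>
  (wave 1 1 (- (pi / 2)) (theta0 i w) * wave 1 1 0 (theta0 j w) -
   wave 1 1 0 (theta0 i w) * wave 1 1 (- (pi / 2)) (theta0 j w)) *
   cos (displacement l i w - displacement l j w) +
  (wave 1 1 0 (theta0 i w) * wave 1 1 0 (theta0 j w) +
   wave 1 1 (- (pi / 2)) (theta0 i w) * wave 1 1 (- (pi / 2)) (theta0 j w)) *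
   sin (displacement l i w - displacement l j w)).
  apply/funext => w; rewrite /wave !mul1r !addr0 !cosBpihalf -!/(start w _) -sinB -cosB -sinD.
  by congr sin; rewrite /displacement; ring.
have mD : measurable_fun setT ((fun w => displacement l i w - displacement l j w) : past q -> R).
  by apply: measurable_funB; exact: mV.
have mc : measurable_fun setT (@cos R) by apply: continuous_measurable_fun; exact: continuous_cos.
have ms : measurable_fun setT (@sin R) by apply: continuous_measurable_fun; exact: continuous_sin.
by apply: measurable_funD; apply: measurable_funM; (exact: measurableT_comp ||
  (apply: measurable_funB || apply: measurable_funD); apply: measurable_funM; exact: wave_past).
Qed.

Lemma displacement_past l i : measurable_fun setT (displacement l i : past (l * n) -> R).
Proof.
elim: l i => [|l IH] i.
  rewrite (_ : displacement 0 i = fun=> 0)//.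
  by apply/funext => w; rewrite /displacement /= subrr.
have lenS : (l * n <= l.+1 * n)%N by rewrite leq_mul2r leqnSn orbT.
rewrite (_ : displacement l.+1 i = (fun w => displacement l i w +
    delta * drift a (euler_at r w l) i + xi (l * n + i) w)); last first.
  by apply/funext => w; rewrite /displacement incr_noise /=; ring.
apply: measurable_funD; first apply: measurable_funD.
- exact: past_measurable_le lenS (IH i).
- apply: measurable_funM => //.
  exact: past_measurable_le lenS (drift_past i IH).
- by apply: past_xi => //; [exact: S0_sigma|rewrite mulSnr ltn_add2l].
Qed.

Let ordq q : 'I_n := Ordinal (ltn_pmod q n_gt0).

(** Index [q] stands for particle [q %% n] at step [q %/ n]. For [psi = phi + pi / 2] the cosine
    becomes [- sin], so the two carriers are the coefficients in the expansion of the cosine after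
    the noise. *)
Definition carrier psi q w : R := cos (k%:R * predrift_at r w (q %/ n) (ordq q) + psi).

Let carrier_past psi q : @bounded_measurable R _ (past q) (carrier psi q).
Proof.
split; last by exists 1 => w; exact: cos_max.
(* The position before the noise of step [q %/ n] depends only on completed steps, whose increments
   have indices below [q]. *)
have qn : (q %/ n * n <= q)%N by exact: leq_divM.
set i := ordq q; set l := (q %/ n)%N in qn *.
pose Y w := k%:R * (displacement l i w + delta * drift a (euler_at r w l) i) + psi.
have mY : measurable_fun setT (Y : past q -> R).
  apply: measurable_funD => //; apply: measurable_funM => //; apply: measurable_funD.
    exact: past_measurable_le qn (@displacement_past l i).
  apply: measurable_funM => //.
  exact: past_measurable_le qn (drift_past i (@displacement_past l)).
rewrite (_ : carrier psi q = fun w => wave 1 k 0 (theta0 i w) * cos (Y w) -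
   wave 1 k (- (pi / 2)) (theta0 i w) * sin (Y w)); last first.
  apply/funext => w; rewrite /wave !mul1r !addr0 cosBpihalf -cosD /carrier; congr cos.
  by rewrite /Y /displacement /predrift_at /predrift -/(euler_at r w) -/i -/l /start; ring.
have mc : measurable_fun setT (@cos R) by apply: continuous_measurable_fun; exact: continuous_cos.
have ms : measurable_fun setT (@sin R) by apply: continuous_measurable_fun; exact: continuous_sin.
by apply: measurable_funB; apply: measurable_funM; (exact: wave_past || exact: measurableT_comp).
Qed.

Let f (z : R) : R := cos (k%:R * z) - cos_mean r.
Let g (z : R) : R := sin (k%:R * z).

Let cosk_bm : bounded_measurable (fun z : R => cos (k%:R * z)).
Proof.
split; last by exists 1 => z; exact: cos_max.
apply: continuous_measurable_fun => z; apply: continuous_comp; last exact: continuous_cos.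
by apply: cvgM; [exact: cvg_cst|exact: cvg_id].
Qed.

Let g_bm : bounded_measurable g.
Proof.
split; last by exists 1 => z; exact: sin_max.
apply: continuous_measurable_fun => z; apply: continuous_comp; last exact: continuous_sin.
by apply: cvgM; [exact: cvg_cst|exact: cvg_id].
Qed.

Let cst_bm (c : R) : bounded_measurable (fun _ : R => c).
Proof. exact: bounded_measurable_cst. Qed.

Let f_bm : bounded_measurable f.
Proof.
have := bounded_measurableD cosk_bm (cst_bm (- cos_mean r)).
exact.
Qed.

Let sd_gt0 : 0 < Num.sqrt delta. Proof. by rewrite sqrtr_gt0. Qed.
Let P1 : P setT = 1%E. Proof. exact: probability_setT. Qed.
Let Q1 : normal_prob 0 (Num.sqrt delta) setT = 1%E. Proof. exact: probability_setT. Qed.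

Let f0 q : (q < r * n)%N -> \int[P]_w f (xi q w) = 0.
Proof.
move=> _; rewrite (incr_Rintegral B_iid n delta_gt0 q f_bm).
rewrite (Rintegral_bmD Q1 cosk_bm (cst_bm (- cos_mean r))).
by rewrite (Rintegral_unit_cst Q1) /cos_mean subrr.
Qed.

Let g0 q : (q < r * n)%N -> \int[P]_w g (xi q w) = 0.
Proof. by move=> _; rewrite (incr_Rintegral B_iid n delta_gt0 q g_bm); exact: normal_sin. Qed.

(** With [c = cos_mean r] the integral equals [1 - c^2], which is at most [2 * (1 - c)] and hence at
    most [k^2 * delta]. *)
Let fgV q : (q < r * n)%N ->
  \int[P]_w (f (xi q w) ^+ 2 + g (xi q w) ^+ 2) <= k%:R ^+ 2 * delta.
Proof.
move=> _.
have fgb : bounded_measurable (fun z => f z ^+ 2 + g z ^+ 2).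
  by apply: bounded_measurableD; exact: bounded_measurableM.
rewrite (incr_Rintegral B_iid n delta_gt0 q fgb).
have -> : (fun z => f z ^+ 2 + g z ^+ 2) =
    (fun z => (1 + cos_mean r ^+ 2) + (- 2 * cos_mean r) * cos (k%:R * z)).
  apply/funext => z; rewrite /f /g sin2cos2; ring.
rewrite (Rintegral_bmD Q1 (cst_bm _) (bounded_measurableZ _ cosk_bm)).
rewrite (Rintegral_unit_cst Q1) (Rintegral_bmZ Q1 _ cosk_bm) -/(cos_mean r).
have [h _] := normal_cos_bound sd_gt0 k%:R.
rewrite -/(cos_mean r) sqr_sqrtr ?(ltW delta_gt0)// in h.
have c1 : `|cos_mean r| <= 1.
  by apply: (norm_Rintegral_bm_le Q1 cosk_bm) => z; exact: cos_max.
move: c1; rewrite ler_norml => /andP[c1 c2].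
have : 0 <= (1 - cos_mean r) ^+ 2 by exact: sqr_ge0.
have -> : 1 + cos_mean r ^+ 2 + - 2 * cos_mean r * cos_mean r = (1 - cos_mean r) * (1 + cos_mean r) by ring.
move=> _; apply: le_trans (_ : (1 - cos_mean r) * 2 <= _).
  by rewrite ler_wpM2l//; lra.
lra.
Qed.

Definition alpha : R := n%:R^-1.

Notation mdiff := (mart_diff xi f g (carrier phi) (carrier (phi + pi / 2)) alpha).

Let mdiff_sum m w : \sum_(q < m * n) mdiff q w =
  euler_mart a delta (noise r w) (start w) k%:R phi (cos_mean r) m.
Proof.
rewrite /euler_mart; elim: m => [|m IH]; first by rewrite mul0n !big_ord0.
rewrite mulSnr big_split_ord big_ord_recr/= -IH; congr (_ + _).
rewrite mulr_sumr; apply: eq_bigr => i _; rewrite /mart_diff -/alpha; congr (_ * _).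
have di : ((m * n + i) %/ n = m)%N by rewrite divnMDl// divn_small// addn0.
have oi : ordq (m * n + i) = i.
  by apply: val_inj; rewrite /= modnMDl modn_small.
rewrite /carrier di oi incr_noise addrA cosDpihalf /f /g /predrift_at.
set Y := predrift _ _ _ _ _ _.
have -> : k%:R * (euler a delta (noise r w) (start w) m i +
    delta * drift a (euler a delta (noise r w) (start w) m) i + noise r w m i) + phi =
    (k%:R * Y + phi) + k%:R * noise r w m i by rewrite /Y /predrift; ring.
rewrite (cosD (k%:R * Y + phi)); ring.
Qed.

Definition survive : set Omega :=
  survival xi (r * n) f g (carrier phi) (carrier (phi + pi / 2)) alpha eta.

Let carrier1 psi q w : `|carrier psi q w| <= 1. Proof. exact: cos_max. Qed.

Lemma survive_measurable : measurable survive.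
Proof.
apply: (@measurable_survival R d Omega S0 xi (r * n)) => //.
- exact: S0_sigma.
- exact: S0_measurable.
Qed.

Lemma survive_bound w m : survive w -> (m <= r)%N ->
  `|euler_mart a delta (noise r w) (start w) k%:R phi (cos_mean r) m| < eta.
Proof.
move=> sw mr; rewrite -mdiff_sum.
by apply: (stopped_bound sw); rewrite leq_mul2r mr orbT.
Qed.

(** There are [r * n] differences, of second moment at most [2 k^2 T / (n^2 r)] each: the mesh
    cancels and a factor [1 / n] remains. *)
Lemma survive_prob :
  ((1 - 2 * k%:R ^+ 2 * T / (n%:R * eta ^+ 2))%:E <= P survive)%E.
Proof.
have := @stopped_maximal R d Omega P S0 xi (r * n) S0_sigma S0_measurable xim xi_indep
  f g (carrier phi) (carrier (phi + pi / 2)) alpha (k%:R ^+ 2 * delta) eta f_bm g_bm f0 g0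
  (fun q _ => carrier_past phi q) (fun q _ => carrier_past (phi + pi / 2) q)
  (carrier1 phi) (carrier1 (phi + pi / 2)) fgV eta_gt0.
congr (is_true (_%:E <= _)%E); congr (1 - _).
rewrite natrM /alpha /mesh; field.
by rewrite gt_eqF//= !pnatr_eq0 -!lt0n n_gt0 r_gt0.
Qed.

End fixed_mesh.

Definition survive_after r0 : set Omega :=
  \bigcup_(r in [set r | (r0 < r)%N]) survive r.

(* small for infinitely many meshes: this suffices to let the mesh tend to 0
   along each path, at no cost in probability *)
Definition survive_io : set Omega := \bigcap_r0 survive_after r0.

Lemma survive_after_measurable r0 : measurable (survive_after r0).
Proof.
apply: bigcup_measurable => r /= r0r; apply: survive_measurable.
exact: leq_ltn_trans r0r.
Qed.

Lemma survive_io_measurable : measurable survive_io.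
Proof. by apply: bigcapT_measurable => r0; exact: survive_after_measurable. Qed.

(** The events [survive_after] decrease to [survive_io] and each contains some [survive r], so
    continuity from above preserves the bound, whatever the dependence between meshes. *)
Lemma survive_io_prob :
  ((1 - 2 * k%:R ^+ 2 * T / (n%:R * eta ^+ 2))%:E <= P survive_io)%E.
Proof.
have cv : P (survive_after r0) @[r0 --> \oo] --> P survive_io.
  apply: nonincreasing_cvg_mu.
  - apply: le_lt_trans (probability_le1 _ (survive_after_measurable _)) _.
    by rewrite ltry.
  - exact: survive_after_measurable.
  - exact: survive_io_measurable.
  - move=> r1 r2 r12; apply/subsetPset => w [r /= r2r sr].
    by exists r => //=; exact: leq_ltn_trans r2r.
rewrite -(cvg_lim _ cv)//; apply: lime_ge; first by apply/cvg_ex; eexists; exact: cv.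
apply: nearW => r0.
apply: le_trans (survive_prob (ltn0Sn r0)) _.
apply: le_measure; rewrite ?inE.
- exact: survive_measurable.
- exact: survive_after_measurable.
- by move=> w sw; exists r0.+1 => //=.
Qed.

Lemma survive_io_residual w (x : 'I_n -> R -> R) :
  survive_io w -> (forall i, continuous (x i)) ->
  (forall i t, 0 <= t ->
    x i t = start w i + cint (fun s => drift a (x^~ s) i) 0 t + B i t w) ->
  (forall i : 'I_n, B i 0 w = 0) ->
  forall t, 0 <= t <= T -> `|residual a x k%:R phi t| <= eta.
Proof.
move=> sw xc x_eq B0 t tT.
apply: (@residual_le R n a (start w) x (fun i t => B i t w) k%:R phi T eta
  (57 * k%:R ^+ 4) cos_mean) => //.
- move=> r r0; have m0 : 0 < mesh T r by rewrite divr_gt0// ltr0n.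
  have s0 : 0 < Num.sqrt (mesh T r) by rewrite sqrtr_gt0.
  have s2 : Num.sqrt (mesh T r) ^+ 2 = mesh T r by rewrite sqr_sqrtr// ltW.
  have s4 : Num.sqrt (mesh T r) ^+ 4 = mesh T r ^+ 2.
    by rewrite -[4%N]/(2 * 2)%N exprM s2.
  by have [_] := normal_cos_bound s0 k%:R; rewrite s2 s4.
- move=> r0; have [r /= r0r sr] := sw r0 I.
  exists r => // m mr; have rgt0 : (0 < r)%N by exact: leq_ltn_trans r0r.
  exact: survive_bound sr mr.
Qed.

End euler_probability.

(** * Stability of the modes *)

Section mode_stability.
Variable R : realType.
Implicit Types (K eta : R) (A B : nat -> R).

(* the Fourier modes of a solution of the McKean-Vlasov equation solve
   [A k.+1' = field_cos K A B k] and [B k.+1' = field_sin K A B k] *)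
Definition field_cos K A B (k : nat) : R :=
  - (k.+1%:R ^+ 2 / 2) * A k.+1 +
  K * k.+1%:R / 2 * (A 1%N * (A k - A k.+2) - B 1%N * (B k.+2 + B k)).

Definition field_sin K A B (k : nat) : R :=
  - (k.+1%:R ^+ 2 / 2) * B k.+1 -
  K * k.+1%:R / 2 * (A 1%N * (B k.+2 - B k) - B 1%N * (A k.+2 + A k)).

(* [e] is 1 for the last mode, whose right neighbour is only known to be
   bounded, and 0 otherwise. *)
Lemma mode_energy_rate K eta ki p q rho sig Ga Gb z1 zl zr y1 yl yr W1 Wl Wr e :
  0 <= K -> 0 <= eta -> 0 <= ki <= 1 -> 0 <= e -> `|rho| <= eta -> `|sig| <= eta ->
  `|p| <= 3 -> `|q| <= 3 ->
  `|Ga| <= 2 * z1 + zl + zr -> `|Gb| <= 2 * z1 + zl + zr ->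
  z1 <= y1 + 2 * eta -> zl <= yl + 2 * eta -> zr <= yr + 2 * eta + 4 * e ->
  y1 ^+ 2 <= 2 * W1 -> yl ^+ 2 <= 2 * Wl -> yr ^+ 2 <= 2 * Wr ->
  - p * (p + rho) - q * (q + sig) + K * ki * (p * Ga + q * Gb) <=
   - (3 / 4) * (p ^+ 2 + q ^+ 2) + 4^-1 * (Wl + Wr) + 8 * K ^+ 2 * (ki ^+ 2 * (p ^+ 2 + q ^+ 2)) +
   16 * K ^+ 2 * W1 * ki ^+ 2 + (6 + 48 * K) * eta + 24 * K * (ki * e).
Proof.
move=> K0 eta0 /andP[ki0 ki1] e0 rhoe sige p3 q3 GaB GbB z1B zlB zrB y1W ylW yrW.
set y := `|p| + `|q|.
have y0 : 0 <= y by rewrite addr_ge0.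
have y6 : y <= 6 by rewrite /y; lra.
have yW : y ^+ 2 <= 2 * (p ^+ 2 + q ^+ 2).
  have := sqr_ge0 (`|p| - `|q|).
  rewrite /y sqrrB sqrrD !real_normK ?num_real//; lra.
set z := 2 * z1 + zl + zr in GaB GbB.
have zB : z <= 2 * y1 + yl + yr + 8 * eta + 4 * e by rewrite /z; lra.
have pG : p * Ga + q * Gb <= y * (2 * y1 + yl + yr + 8 * eta + 4 * e).
  apply: le_trans (_ : y * z <= _); last by rewrite ler_wpM2l.
  rewrite /y mulrDl; apply: lerD; apply: le_trans (ler_norm _) _;
    by rewrite normrM ler_wpM2l.
set c := K * ki.
have c0 : 0 <= c by rewrite mulr_ge0.
have cK : c <= K by rewrite /c ler_piMr.
have cpG : c * (p * Ga + q * Gb) <= c * (y * (2 * y1 + yl + yr + 8 * eta + 4 * e)).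
  by rewrite ler_wpM2l.
(* Weighted AM-GM. Each neighbour is charged at most a quarter of its [W], and the product with [y1]
   uses a quarter of the dissipation, which leaves [3 / 4]. *)
have t1 := sqr_ge0 (yl - 4 * c * y).
have t2 := sqr_ge0 (yr - 4 * c * y).
have t3 := sqr_ge0 (y - 8 * c * y1).
have cy : c * y <= K * 6 by apply: ler_pM.
have t4 : c * y * (8 * eta) <= K * 6 * (8 * eta) by rewrite ler_wpM2r// mulr_ge0.
have t5 : c * y * (4 * e) <= c * 6 * (4 * e).
  by rewrite ler_wpM2r ?mulr_ge0// ler_wpM2l.
have t6 : - p * rho - q * sig <= 6 * eta.
  apply: le_trans (_ : y * eta <= _); last by rewrite ler_wpM2r.
  rewrite /y mulrDl; apply: lerD; apply: le_trans (ler_norm _) _.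
    by rewrite normrM normrN ler_wpM2l.
  by rewrite normrN normrM ler_wpM2l.
have cW1 : c ^+ 2 * y1 ^+ 2 <= c ^+ 2 * (2 * W1) by rewrite ler_wpM2l ?sqr_ge0.
have cWy : c ^+ 2 * y ^+ 2 <= c ^+ 2 * (2 * (p ^+ 2 + q ^+ 2)) by rewrite ler_wpM2l ?sqr_ge0.
have -> : 8 * K ^+ 2 * (ki ^+ 2 * (p ^+ 2 + q ^+ 2)) = 8 * (c ^+ 2 * (p ^+ 2 + q ^+ 2)).
  by rewrite /c; ring.
have -> : 16 * K ^+ 2 * W1 * ki ^+ 2 = 16 * (c ^+ 2 * W1) by rewrite /c; ring.
have -> : 24 * K * (ki * e) = 24 * (c * e) by rewrite /c; ring.
have e1 : (yl - 4 * c * y) ^+ 2 = yl ^+ 2 - 8 * (c * y * yl) + 16 * (c ^+ 2 * y ^+ 2) by ring.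
have e2 : (yr - 4 * c * y) ^+ 2 = yr ^+ 2 - 8 * (c * y * yr) + 16 * (c ^+ 2 * y ^+ 2) by ring.
have e3 : (y - 8 * c * y1) ^+ 2 = y ^+ 2 - 16 * (c * y * y1) + 64 * (c ^+ 2 * y1 ^+ 2) by ring.
rewrite e1 in t1; rewrite e2 in t2; rewrite e3 in t3.
have e4 : c * (y * (2 * y1 + yl + yr + 8 * eta + 4 * e)) =
  2 * (c * y * y1) + c * y * yl + c * y * yr + c * y * (8 * eta) + c * y * (4 * e) by ring.
rewrite e4 in cpG.
have e5 : - p * (p + rho) - q * (q + sig) = - (p ^+ 2 + q ^+ 2) + (- p * rho - q * sig) by ring.
rewrite e5.
have e6 : c * 6 * (4 * e) = 24 * (c * e) by ring.
rewrite e6 in t5.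
have e7 : K * 6 * (8 * eta) = 48 * (K * eta) by ring.
rewrite e7 in t4.
have -> : (6 + 48 * K) * eta = 6 * eta + 48 * (K * eta) by ring.
clear e1 e2 e3 e4 e5 e6 e7 cy zB pG GaB GbB z1B zlB zrB p3 q3 rhoe sige y6 y0 cK.
move: t1 t2 t3 t4 t5 t6 cW1 cWy cpG yW y1W ylW yrW.
(* The conclusion is linear in the monomials, which are abstracted for [lra]. *)
set X1 := c * y * yl; set X2 := c * y * yr; set X3 := c * y * y1.
set X4 := c * y * _; set X5 := c * y * _; set X6 := c * (_ + _).
set X7 := - p * _ - _; set X8 := c ^+ 2 * y ^+ 2; set X9 := c ^+ 2 * y1 ^+ 2.
have -> : c ^+ 2 * (2 * W1) = 2 * (c ^+ 2 * W1) by ring.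
have -> : c ^+ 2 * (2 * (p ^+ 2 + q ^+ 2)) = 2 * (c ^+ 2 * (p ^+ 2 + q ^+ 2)) by ring.
set Y1 := c ^+ 2 * W1; set Y2 := c ^+ 2 * (_ + _); set Y3 := y ^+ 2; set Y4 := y1 ^+ 2.
set Y5 := yl ^+ 2; set Y6 := yr ^+ 2; set Y7 := p ^+ 2 + q ^+ 2; set Y8 := c * e; set Y9 := K * eta.
move=> *; lra.
Qed.

Lemma sum_inv_sqr (m : nat) : \sum_(j < m) (j.+1%:R ^- 2 : R) <= 2.
Proof.
suff h : \sum_(j < m.+1) (j.+1%:R ^- 2 : R) <= 2 - m.+1%:R^-1.
  apply: le_trans (_ : \sum_(j < m.+1) (j.+1%:R ^- 2 : R) <= _).
    by rewrite big_ord_recr/= lerDl invr_ge0 exprn_ge0.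
  by apply: le_trans h _; rewrite gerBl.
elim: m => [|m IH].
  by rewrite big_ord_recl big_ord0 expr1n invr1 addr0; lra.
rewrite big_ord_recr/=; apply: le_trans (lerD IH (lexx _)) _.
have m0 : 0 < m.+1%:R :> R by rewrite ltr0n.
have -> : m.+2%:R = m.+1%:R + 1 :> R by rewrite -natr1.
set x : R := m.+1%:R in m0 *.
rewrite -subr_ge0.
have -> : 2 - (x + 1)^-1 - (2 - x^-1 + (x + 1) ^- 2) = (x * (x + 1) ^+ 2)^-1.
  by field; rewrite !gt_eqF.
by rewrite invr_ge0 mulr_ge0 ?sqr_ge0// ltW.
Qed.

Lemma field_cos_sub K A B a b k : field_cos K A B k - field_cos K a b k =
  - (k.+1%:R ^+ 2 / 2) * (A k.+1 - a k.+1) + K * k.+1%:R / 2 *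
   ((A 1%N - a 1%N) * (A k - A k.+2) + a 1%N * ((A k - a k) - (A k.+2 - a k.+2)) -
    (B 1%N - b 1%N) * (B k.+2 + B k) - b 1%N * ((B k.+2 - b k.+2) + (B k - b k))).
Proof. by rewrite /field_cos; ring. Qed.

Lemma field_sin_sub K A B a b k : field_sin K A B k - field_sin K a b k =
  - (k.+1%:R ^+ 2 / 2) * (B k.+1 - b k.+1) + K * k.+1%:R / 2 *
   - ((A 1%N - a 1%N) * (B k.+2 - B k) + a 1%N * ((B k.+2 - b k.+2) - (B k - b k)) -
    (B 1%N - b 1%N) * (A k.+2 + A k) - b 1%N * ((A k.+2 - a k.+2) + (A k - a k))).
Proof. by rewrite /field_sin; ring. Qed.

(* [x1, x2] and [y1, y2] are modes bounded by 1, the other arguments differences of modes *)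
Lemma bilinear_bound (d1 d2 x1 x2 a1 b1 e1 e2 y1 y2 f1 f2 : R) :
  `|x1| <= 1 -> `|x2| <= 1 -> `|y1| <= 1 -> `|y2| <= 1 -> `|a1| <= 1 -> `|b1| <= 1 ->
  `|d1 * (x1 + x2) + a1 * (e1 + e2) - d2 * (y1 + y2) - b1 * (f1 + f2)| <=
    2 * (`|d1| + `|d2|) + (`|e1| + `|f2|) + (`|e2| + `|f1|).
Proof.
move=> x11 x21 y11 y21 a11 b11.
have h (u v w : R) : `|v| <= 1 -> `|w| <= 1 -> `|u * (v + w)| <= 2 * `|u|.
  move=> v1 w1; rewrite normrM mulrC ler_wpM2r//.
  by apply: le_trans (ler_normD _ _) _; lra.
have h' (u v w : R) : `|u| <= 1 -> `|u * (v + w)| <= `|v| + `|w|.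
  move=> u1; rewrite normrM -[leRHS]mul1r ler_pM//.
  exact: ler_normD.
apply: le_trans (ler_normB _ _) _; have := h' _ f1 f2 b11.
have := ler_normB (d1 * (x1 + x2) + a1 * (e1 + e2)) (d2 * (y1 + y2)).
have := ler_normD (d1 * (x1 + x2)) (a1 * (e1 + e2)).
have := h d1 _ _ x11 x21; have := h d2 _ _ y11 y21; have := h' _ e1 e2 a11.
lra.
Qed.

Lemma sqr_add_norm_le (p q : R) : (`|p| + `|q|) ^+ 2 <= 2 * (p ^+ 2 + q ^+ 2).
Proof.
have := sqr_ge0 (`|p| - `|q|).
rewrite sqrrB sqrrD !real_normK ?num_real//; lra.
Qed.

Lemma field_continuous K (u v : nat -> R -> R) k : (forall k, continuous (u k)) ->
  (forall k, continuous (v k)) ->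
  continuous (fun s => field_cos K (u^~ s) (v^~ s) k) /\
  continuous (fun s => field_sin K (u^~ s) (v^~ s) k).
Proof.
move=> uc vc; split=> s.
  apply: cvgD; apply: cvgM; try exact: cvg_cst; first exact: uc.
  apply: cvgB; apply: cvgM; [exact: uc|apply: cvgB|exact: vc|apply: cvgD]; (exact: uc || exact: vc).
apply: cvgB; apply: cvgM; try exact: cvg_cst; first exact: vc.
apply: cvgB; apply: cvgM; [exact: uc|apply: cvgB|exact: vc|apply: cvgD]; (exact: uc || exact: vc).
Qed.

(** * Comparison of approximate and exact solutions of the mode system *)

Section comparison.
Variables (K eta T : R) (N : nat) (A B a b : nat -> R -> R).
Hypotheses (K_ge0 : 0 <= K) (eta_ge0 : 0 <= eta) (eta_le1 : eta <= 1).
Hypotheses (T_ge0 : 0 <= T) (N_gt0 : (0 < N)%N).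
Hypotheses (Ac : forall k, continuous (A k)) (Bc : forall k, continuous (B k)).
Hypotheses (ac : forall k, continuous (a k)) (bc : forall k, continuous (b k)).
Hypotheses (A1 : forall k t, `|A k t| <= 1) (B1 : forall k t, `|B k t| <= 1).
Hypotheses (a1 : forall k t, `|a k t| <= 1) (b1 : forall k t, `|b k t| <= 1).
Hypotheses (Aa0 : forall t, A 0%N t = a 0%N t) (Bb0 : forall t, B 0%N t = b 0%N t).
Hypothesis A_init : forall k, (k < N)%N -> `|A k.+1 0 - a k.+1 0| <= eta.
Hypothesis B_init : forall k, (k < N)%N -> `|B k.+1 0 - b k.+1 0| <= eta.
Notation FA k := (fun s => field_cos K (A^~ s) (B^~ s) k).
Notation FB k := (fun s => field_sin K (A^~ s) (B^~ s) k).
Notation Fa k := (fun s => field_cos K (a^~ s) (b^~ s) k).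
Notation Fb k := (fun s => field_sin K (a^~ s) (b^~ s) k).
Hypothesis A_eq : forall k t, (k < N)%N -> 0 <= t <= T ->
  `|A k.+1 t - A k.+1 0 - cint (FA k) 0 t| <= eta.
Hypothesis B_eq : forall k t, (k < N)%N -> 0 <= t <= T ->
  `|B k.+1 t - B k.+1 0 - cint (FB k) 0 t| <= eta.
Hypothesis a_eq : forall k t, 0 <= t -> a k.+1 t = a k.+1 0 + cint (Fa k) 0 t.
Hypothesis b_eq : forall k t, 0 <= t -> b k.+1 t = b k.+1 0 + cint (Fb k) 0 t.

Let HA k s := FA k s - Fa k s.
Let HB k s := FB k s - Fb k s.

Let HAc k : continuous (HA k).
Proof.
by move=> s; apply: cvgB; [exact: (field_continuous K k Ac Bc).1|exact: (field_continuous K k ac bc).1].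
Qed.

Let HBc k : continuous (HB k).
Proof.
by move=> s; apply: cvgB; [exact: (field_continuous K k Ac Bc).2|exact: (field_continuous K k ac bc).2].
Qed.

(** The differentiable part of the difference of modes: it omits the error in the integral equation
    of [A], which is small but may be as rough as a Brownian path. *)
Let p k t := (A k.+1 0 - a k.+1 0) + cint (HA k) 0 t.
Let q k t := (B k.+1 0 - b k.+1 0) + cint (HB k) 0 t.

Let p_close k t : (k < N)%N -> 0 <= t <= T -> `|A k.+1 t - a k.+1 t - p k t| <= eta.
Proof.
move=> kN tT; have /andP[t0 _] := tT; have := A_eq kN tT.
rewrite (a_eq k t0) /p /HA cintB; [|exact: (field_continuous K k Ac Bc).1|exact: (field_continuous K k ac bc).1].
set I := cint (FA k) 0 t; set J := cint (Fa k) 0 t.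
by rewrite (_ : _ - (a k.+1 0 + J) - _ = A k.+1 t - A k.+1 0 - I)//; ring.
Qed.

Let q_close k t : (k < N)%N -> 0 <= t <= T -> `|B k.+1 t - b k.+1 t - q k t| <= eta.
Proof.
move=> kN tT; have /andP[t0 _] := tT; have := B_eq kN tT.
rewrite (b_eq k t0) /q /HB cintB; [|exact: (field_continuous K k Ac Bc).2|exact: (field_continuous K k ac bc).2].
set I := cint (FB k) 0 t; set J := cint (Fb k) 0 t.
by rewrite (_ : _ - (b k.+1 0 + J) - _ = B k.+1 t - B k.+1 0 - I)//; ring.
Qed.

(* indexed by the mode, and truncated outside of the modes [1, N] *)
Let W k t : R := if (0 < k <= N)%N then p k.-1 t ^+ 2 + q k.-1 t ^+ 2 else 0.
Let y k t : R := if (0 < k <= N)%N then `|p k.-1 t| + `|q k.-1 t| else 0.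
Let z k t : R := `|A k t - a k t| + `|B k t - b k t|.

Let W_ge0 k t : 0 <= W k t.
Proof. by rewrite /W; case: ifP => // _; rewrite addr_ge0// sqr_ge0. Qed.

Let yW k t : y k t ^+ 2 <= 2 * W k t.
Proof.
rewrite /y /W; case: ifP => _; first exact: sqr_add_norm_le.
by rewrite expr0n mulr0.
Qed.

Let z_y k t : (k <= N)%N -> 0 <= t <= T -> z k t <= y k t + 2 * eta.
Proof.
move=> kN tT; rewrite /z /y; case: k kN => [|k] kN.
  by rewrite ltnn/= Aa0 Bb0 !subrr normr0 !add0r mulr_ge0.
rewrite /= kN.
have := p_close kN tT; have := q_close kN tT.
have := ler_normD (A k.+1 t - a k.+1 t - p k t) (p k t); rewrite subrK.
have := ler_normD (B k.+1 t - b k.+1 t - q k t) (q k t); rewrite subrK.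
lra.
Qed.

Let z_le4 k t : z k t <= 4.
Proof.
rewrite /z; have := ler_normB (A k t) (a k t); have := ler_normB (B k t) (b k t).
have := A1 k t; have := B1 k t; have := a1 k t; have := b1 k t; lra.
Qed.

(* The weights turn the factor [k] of the nonlinear term into [1 / k], which the
   dissipation absorbs. *)
Definition energy (t : R) : R := \sum_(k < N) k.+1%:R ^- 2 * (p k t ^+ 2 + q k t ^+ 2).

Let denergy (t : R) : R := \sum_(k < N) k.+1%:R ^- 2 *
  (2 * (p k t * HA k t) + 2 * (q k t * HB k t)).

Let energy_is_derive (t : R) : 0 < t -> is_derive t 1 energy (denergy t).
Proof.
move=> t0.
have pd k : is_derive t (1 : R) (p k) (HA k t).
  rewrite -[HA k t]add0r; apply: is_deriveD; exact: cint_is_derive.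
have qd k : is_derive t (1 : R) (q k) (HB k t).
  rewrite -[HB k t]add0r; apply: is_deriveD; exact: cint_is_derive.
have term k : is_derive t (1 : R) (fun t => k.+1%:R ^- 2 * (p k t ^+ 2 + q k t ^+ 2))
   (k.+1%:R ^- 2 * (2 * (p k t * HA k t) + 2 * (q k t * HB k t))).
  apply: is_derive_eq.
  by rewrite /GRing.scale/=; ring.
suff h m : is_derive t (1 : R) (fun t => \sum_(k < m) k.+1%:R ^- 2 * (p k t ^+ 2 + q k t ^+ 2))
    (\sum_(k < m) k.+1%:R ^- 2 * (2 * (p k t * HA k t) + 2 * (q k t * HB k t))) by exact: h.
elim: m => [|m IH].
  under eq_fun do rewrite big_ord0.
  by rewrite big_ord0; exact: is_derive_cst.
under eq_fun do rewrite big_ord_recr/=.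
by rewrite big_ord_recr/=; apply: is_deriveD.
Qed.

Let energy_continuous : {within `[0, T], continuous energy}.
Proof.
have pc k : {within `[0, T], continuous (p k)}.
  have c := cint_continuous (@HAc k) T_ge0.
  by move=> s; apply: cvgD; [exact: cvg_cst|exact: c].
have qc k : {within `[0, T], continuous (q k)}.
  have c := cint_continuous (@HBc k) T_ge0.
  by move=> s; apply: cvgD; [exact: cvg_cst|exact: c].
apply: (@continuous_sum R (subspace `[0, T]) 'I_N) => k s.
apply: cvgM; first exact: cvg_cst.
by apply: cvgD; apply: cvgM; (exact: pc || exact: qc).
Qed.

(** The constant is [40 = 8 + 2 * 16]: the terms in [16 K^2 W 1] carry the weights [k^-2], whose sum
    is at most 2, and [W 1] is at most the energy because the first weight is 1. *)
Let energy_rate t : 0 <= t <= T ->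
  denergy t <= 40 * K ^+ 2 * energy t + ((6 + 48 * K) * eta * N%:R + 24 * K / N%:R).
Proof.
move=> tT.
have term k : (k < N)%N -> k.+1%:R ^- 2 * (2 * (p k t * HA k t) + 2 * (q k t * HB k t)) <=
   - (3 / 4) * W k.+1 t + 4^-1 * (W k t + W k.+2 t) + 8 * K ^+ 2 * (k.+1%:R ^- 2 * W k.+1 t) +
   16 * K ^+ 2 * W 1%N t * k.+1%:R ^- 2 + (6 + 48 * K) * eta +
   24 * K * (k.+1%:R^-1 * (k.+1 == N)%:R).
  move=> kN; have k0 : 0 < k.+1%:R :> R by rewrite ltr0n.
  pose D j := A j t - a j t; pose D' j := B j t - b j t.
  pose Ga := D 1%N * (A k t + - A k.+2 t) + a 1%N t * (D k + - D k.+2) -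
    D' 1%N * (B k.+2 t + B k t) - b 1%N t * (D' k.+2 + D' k).
  pose Gb := - (D 1%N * (B k.+2 t + - B k t) + a 1%N t * (D' k.+2 + - D' k) -
    D' 1%N * (A k.+2 t + A k t) - b 1%N t * (D k.+2 + D k)).
  have HAE : HA k t = - (k.+1%:R ^+ 2 / 2) * (p k t + (D k.+1 - p k t)) + K * k.+1%:R / 2 * Ga.
    by rewrite /HA field_cos_sub /Ga /D /D'; ring.
  have HBE : HB k t = - (k.+1%:R ^+ 2 / 2) * (q k t + (D' k.+1 - q k t)) + K * k.+1%:R / 2 * Gb.
    by rewrite /HB field_sin_sub /Gb /D /D'; ring.
  have -> : k.+1%:R ^- 2 * (2 * (p k t * HA k t) + 2 * (q k t * HB k t)) =
     - p k t * (p k t + (D k.+1 - p k t)) - q k t * (q k t + (D' k.+1 - q k t)) +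
     K * k.+1%:R^-1 * (p k t * Ga + q k t * Gb).
    by rewrite HAE HBE; field; rewrite gt_eqF.
  have WE : W k.+1 t = p k t ^+ 2 + q k t ^+ 2 by rewrite /W /= kN.
  rewrite WE.
  have p3 : `|p k t| <= 3.
    have pc : `|D k.+1 - p k t| <= eta by exact: p_close.
    have Dle : `|D k.+1| <= 2.
      apply: le_trans (ler_normB _ _) _.
      by have := A1 k.+1 t; have := a1 k.+1 t; lra.
    have -> : p k t = D k.+1 - (D k.+1 - p k t) by ring.
    apply: le_trans (ler_normB _ _) (le_trans (lerD Dle pc) _).
    by rewrite (_ : 3 = 2 + 1 :> R) ?lerD2l//; ring.
  have q3 : `|q k t| <= 3.
    have pc : `|D' k.+1 - q k t| <= eta by exact: q_close.
    have Dle : `|D' k.+1| <= 2.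
      apply: le_trans (ler_normB _ _) _.
      by have := B1 k.+1 t; have := b1 k.+1 t; lra.
    have -> : q k t = D' k.+1 - (D' k.+1 - q k t) by ring.
    apply: le_trans (ler_normB _ _) (le_trans (lerD Dle pc) _).
    by rewrite (_ : 3 = 2 + 1 :> R) ?lerD2l//; ring.
  have ki : 0 <= (k.+1%:R^-1 : R) <= 1.
    by apply/andP; split; [by rewrite invr_ge0|by rewrite invf_le1// ler1n].
  rewrite [k.+1%:R ^- 2](_ : _ = k.+1%:R^-1 ^+ 2); last by rewrite exprVn.
  apply: (@mode_energy_rate K eta _ _ _ _ _ _ _ (z 1%N t) (z k t) (z k.+2 t)
    (y 1%N t) (y k t) (y k.+2 t)) => //.
  - exact: p_close.
  - exact: q_close.
  - apply: le_trans (bilinear_bound _ _ _ _ _ _ _ _ _ _ _ _) _ => //; by rewrite ?normrN.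
  - rewrite normrN.
    apply: le_trans (bilinear_bound _ _ _ _ _ _ _ _ _ _ _ _) _ => //; rewrite ?normrN//.
    by rewrite ?normrN /z /D /D'; lra.
  - by apply: z_y.
  - by apply: z_y => //; exact: ltnW.
  (* Mode [N + 1] lies outside the energy and is only bounded by 4; the weight turns this into a
     source of order [1 / N]. *)
  - have [kN1|kN1] := eqVneq k.+1 N.
      rewrite /y -kN1 ltnn andbF add0r mulr1.
      by apply: le_trans (z_le4 _ _) _; rewrite lerDr mulr_ge0.
    rewrite mulr0 addr0; apply: z_y => //.
    by rewrite ltn_neqAle kN1 kN.
rewrite /denergy; apply: le_trans (ler_sum _ (fun (k : 'I_N) _ => term k (ltn_ord k))) _.
rewrite !big_split/= -!mulr_sumr big_split/= sumr_const card_ord.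
(* [W] vanishes at 0 and at [N + 1], so both shifted sums are at most the main one. The neighbours
   then cost a half in all, against the remaining dissipation [3 / 4]. *)
have SW : \sum_(k < N) W k t <= \sum_(k < N) W k.+1 t.
  have := big_ord_recl N (fun k : 'I_N.+1 => W k t) : \sum_(k < N.+1) W k t = _.
  have W0 : W 0%N t = 0 by rewrite /W.
  rewrite big_ord_recr/= W0 add0r => <-.
  by rewrite lerDl.
have SW' : \sum_(k < N) W k.+2 t <= \sum_(k < N) W k.+1 t.
  have := big_ord_recl N (fun k : 'I_N.+1 => W k.+1 t) : \sum_(k < N.+1) W k.+1 t = _.
  have W0 : W N.+1 t = 0 by rewrite /W ltnn andbF.
  rewrite big_ord_recr/= W0 addr0 => ->.
  by rewrite lerDr.
have EW : \sum_(k < N) k.+1%:R ^- 2 * W k.+1 t = energy t.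
  by apply: eq_bigr => k _; rewrite /W /= ltn_ord.
have W1E : W 1%N t <= energy t.
  rewrite -EW -(prednK N_gt0) big_ord_recl/= expr1n invr1 mul1r lerDl.
  by apply: sumr_ge0 => k _; rewrite mulr_ge0// invr_ge0 exprn_ge0.
have W1S : W 1%N t * \sum_(k < N) k.+1%:R ^- 2 <= energy t * 2.
  by apply: ler_pM => //; [apply: sumr_ge0 => k _; rewrite invr_ge0 exprn_ge0|exact: sum_inv_sqr].
have Se : \sum_(k < N) k.+1%:R^-1 * (k.+1 == N)%:R = N%:R^-1 :> R.
  rewrite -(prednK N_gt0) big_ord_recr/= big1 ?add0r ?eqxx ?mulr1// => k _.
  by rewrite eqSS (ltn_eqF (ltn_ord k)) mulr0.
rewrite EW Se.
have K2 : 0 <= K ^+ 2 by exact: sqr_ge0.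
have K2W := ler_wpM2l K2 W1S.
set S0 := \sum_(k < N) W k t in SW *; set S1 := \sum_(k < N) W k.+1 t in SW SW' *.
set S2 := \sum_(k < N) W k.+2 t in SW' *; set S3 := \sum_(k < N) k.+1%:R ^- 2 in K2W W1S *.
have S10 : 0 <= S1 by apply: sumr_ge0.
rewrite -[_ *+ N]mulr_natr.
have -> : 16 * K ^+ 2 * W 1%N t * S3 = 16 * (K ^+ 2 * (W 1%N t * S3)) by ring.
have -> : 8 * K ^+ 2 * energy t = 8 * (K ^+ 2 * energy t) by ring.
have -> : 40 * K ^+ 2 * energy t = 40 * (K ^+ 2 * energy t) by ring.
move: K2W; have -> : K ^+ 2 * (energy t * 2) = 2 * (K ^+ 2 * energy t) by ring.
set X := K ^+ 2 * (W _ _ * _); set Y := K ^+ 2 * energy t.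
set Z := (6 + 48 * K) * eta * N%:R; set U := 24 * K / N%:R.
rewrite mulrA -/Z => h; lra.
Qed.

(** The Gronwall bound for an initial energy at most [2 * N * eta]. For fixed [N], only the term of
    order [1 / N] survives as [eta] tends to 0. *)
Definition comparison_bound : R :=
  (2 * N%:R * eta + ((6 + 48 * K) * eta * N%:R + 24 * K / N%:R) * T) * expR (40 * K ^+ 2 * T).

Lemma mode_comparison k t : (k < N)%N -> 0 <= t <= T ->
  `|A k.+1 t - a k.+1 t| <= eta + k.+1%:R * Num.sqrt comparison_bound /\
  `|B k.+1 t - b k.+1 t| <= eta + k.+1%:R * Num.sqrt comparison_bound.
Proof.
move=> kN tT.
have E0 : energy 0 <= 2 * N%:R * eta.
  rewrite /energy (_ : 2 * N%:R * eta = \sum_(j < N) (2 * eta)); last first.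
    by rewrite sumr_const card_ord -[RHS]mulr_natr mulrAC.
  apply: ler_sum => j _; rewrite /p /q !cintxx !addr0.
  have sq (x : R) : `|x| <= eta -> x ^+ 2 <= eta.
    move=> xe; rewrite -real_normK ?num_real// expr2.
    by apply: le_trans (_ : eta * 1 <= _); [apply: ler_pM => //; exact: le_trans xe _|rewrite mulr1].
  apply: le_trans (_ : 1 * (2 * eta) <= _); last by rewrite mul1r.
  apply: ler_pM; rewrite ?invr_ge0 ?exprn_ge0 ?addr_ge0 ?sqr_ge0//.
    by rewrite invf_le1 ?exprn_gt0 ?ltr0n// exprn_ege1// ler1n.
  by have := sq _ (A_init (ltn_ord j)); have := sq _ (B_init (ltn_ord j)); lra.
have en0 s : 0 <= energy s.
  apply: sumr_ge0 => j _; rewrite mulr_ge0 ?invr_ge0 ?exprn_ge0//.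
  by rewrite addr_ge0// sqr_ge0.
have k0 : 0 <= (6 + 48 * K) * eta * N%:R + 24 * K / N%:R.
  by rewrite addr_ge0// ?divr_ge0 ?mulr_ge0// addr_ge0// mulr_ge0.
have C0 : 0 <= 40 * K ^+ 2 by rewrite mulr_ge0// sqr_ge0.
have Et : energy t <= comparison_bound.
  have h1 s : s \in `]0, T[ -> is_derive s 1 energy (denergy s).
    by rewrite in_itv/= => /andP[s0 _]; exact: energy_is_derive.
  have h2 s : s \in `]0, T[ -> denergy s <= 40 * K ^+ 2 * energy s + ((6 + 48 * K) * eta * N%:R + 24 * K / N%:R).
    by rewrite in_itv/= => /andP[s0 sT]; apply: energy_rate; rewrite !ltW.
  have tT' : t \in `[0, T] by rewrite in_itv.
  apply: le_trans (gronwall C0 k0 T_ge0 (en0 0) energy_continuous h1 h2 tT') _.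
  by rewrite ler_wpM2r ?expR_ge0// lerD2r.
have kn0 : 0 < k.+1%:R :> R by rewrite ltr0n.
have pq : p k t ^+ 2 + q k t ^+ 2 <= k.+1%:R ^+ 2 * comparison_bound.
  have : k.+1%:R ^- 2 * (p k t ^+ 2 + q k t ^+ 2) <= comparison_bound.
    apply: le_trans Et; rewrite /energy (bigD1 (Ordinal kN))//= lerDl.
    apply: sumr_ge0 => j _; rewrite mulr_ge0 ?invr_ge0 ?exprn_ge0//.
    by rewrite addr_ge0// sqr_ge0.
  by rewrite ler_pdivrMl// exprn_gt0.
have sqr_bound (x : R) : x ^+ 2 <= k.+1%:R ^+ 2 * comparison_bound ->
    `|x| <= k.+1%:R * Num.sqrt comparison_bound.
  move=> h; rewrite -sqrtr_sqr -{1}[k.+1%:R](gtr0_norm kn0) -sqrtr_sqr -sqrtrM ?sqr_ge0//.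
  by rewrite ler_wsqrtr.
have p2 := sqr_ge0 (p k t); have q2 := sqr_ge0 (q k t).
split.
  rewrite -(subrK (p k t) (A k.+1 t - a k.+1 t)); apply: le_trans (ler_normD _ _) _.
  by apply: lerD; [exact: p_close|apply: sqr_bound; lra].
rewrite -(subrK (q k t) (B k.+1 t - b k.+1 t)); apply: le_trans (ler_normD _ _) _.
by apply: lerD; [exact: q_close|apply: sqr_bound; lra].
Qed.

End comparison.
End mode_stability.

(** * The graph term *)

Section empirical_modes.
Variable R : realType.

Lemma empirical_unit n (x : nat -> torus R) : (0 < n)%N -> empirical n x setT = 1%E.
Proof.
move=> n0; rewrite (_ : empirical n x setT = ((n%:R^-1)%:E * \sum_(j < n) \d_(x j) setT)%E)//.
under eq_bigr do rewrite diracT.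
rewrite sumEFin sumr_const card_ord -EFinM mulVf//.
by rewrite pnatr_eq0 -lt0n.
Qed.

(** The integral is computed for the nonnegative function [1 + wave], to which the formulas for sums
    and multiples of measures apply. *)
Lemma mode_empirical n (x : nat -> torus R) k phi : (0 < n)%N ->
  mode (empirical n x) k phi = n%:R^-1 * \sum_(j < n) wave 1 k phi (x j).
Proof.
move=> n0; have mu1 := empirical_unit x n0.
have nn : n%:R != 0 :> R by rewrite pnatr_eq0 -lt0n.
have w0 y : 0 <= 1 + wave 1 k phi y :> R.
  by have := norm_wave_le 1 k phi y; rewrite normr1 ler_norml => /andP[]; lra.
have mw : measurable_fun setT (fun y => 1 + wave 1 k phi y : R).
  by apply: measurable_funD => //; exact: wave_measurable.
have : \int[empirical n x]_y (1 + wave 1 k phi y) = 1 + mode (empirical n x) k phi.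
  rewrite (Rintegral_bmD mu1) ?Rintegral_unit_cst//; last exact: wave_bm.
  by split; [exact: measurable_cst|exists 1 => y; rewrite normr1].
rewrite /Rintegral {1}/empirical ge0_integral_mscale//=; last 2 first.
- by apply/measurable_EFinP.
- by move=> y _; rewrite lee_fin.
rewrite ge0_integral_measure_sum//=; last 2 first.
- by move=> y _; rewrite lee_fin.
- by apply/measurable_EFinP.
have dE (j : nat) : (\int[\d_(x j)]_y (1 + wave 1 k phi y)%:E = (1 + wave 1 k phi (x j))%:E)%E.
  rewrite integral_dirac//; last by apply/measurable_EFinP.
  by rewrite diracT mul1e.
under eq_bigr do rewrite dE.
rewrite sumEFin -EFinM /= big_split/= sumr_const card_ord mulrDr mulVf// => /addrI <-.
by [].
Qed.

End empirical_modes.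

Section graph_error.
Variable R : realType.
Context (n : nat) (xi : 'M[nat]_n) (p : R).
Notation m i j := ((xi i j)%:R / p - 1 : R).

Definition cut_form (s t : 'I_n -> R) : R :=
  (n%:R ^+ 2)^-1 * \sum_(i < n) \sum_(j < n) m i j * s i * t j.

(** The value at 0 is 1, so that signs are always vertices of the cube. *)
Let sign (x : R) : R := if 0 <= x then 1 else -1.

Let sign_mul (s x : R) : `|s| <= 1 -> s * x <= sign x * x.
Proof.
move=> s1; apply: le_trans (ler_norm _) _; rewrite normrM /sign.
have := normr_ge0 x; case: (leP 0 x) => x0 ?.
  by rewrite (ger0_norm x0) ler_wpM2r.
by rewrite (ltr0_norm x0) mulN1r ler_piMl// ltW// oppr_gt0.
Qed.

Let sign_pm (x : R) : sign x = 1 \/ sign x = -1.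
Proof. by rewrite /sign; case: ifP; [left|right]. Qed.

Let cut_form_pm (s t : 'I_n -> R) : (forall i, s i = 1 \/ s i = -1) ->
  (forall i, t i = 1 \/ t i = -1) -> cut_form s t <= cut_discrepancy xi p.
Proof.
move=> s1 t1; apply: ub_le_sup; last by exists s, t; split.
exists ((n%:R ^+ 2)^-1 * \sum_(i < n) \sum_(j < n) `|m i j|) => _ [s' [t' [s'1 t'1 ->]]].
rewrite ler_wpM2l ?invr_ge0 ?sqr_ge0//.
apply: ler_sum => i _; apply: ler_sum => j _; apply: le_trans (ler_norm _) _.
by rewrite !normrM; case: (s'1 i) => ->; case: (t'1 j) => ->; rewrite ?normrN normr1 !mulr1.
Qed.

(* a linear form on a cube is maximal at a vertex *)
Lemma cut_form_le (s t : 'I_n -> R) : (forall i, `|s i| <= 1) -> (forall i, `|t i| <= 1) ->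
  cut_form s t <= cut_discrepancy xi p.
Proof.
move=> s1 t1.
pose s' i := sign (\sum_(j < n) m i j * t j).
pose t' j := sign (\sum_(i < n) m i j * s' i).
apply: le_trans (_ : cut_form s' t <= _).
  rewrite ler_wpM2l//; apply: ler_sum => i _.
  have E u : \sum_(j < n) m i j * u * t j = u * \sum_(j < n) m i j * t j.
    by rewrite mulr_sumr; apply: eq_bigr => j _; ring.
  by rewrite !E sign_mul.
apply: le_trans (_ : cut_form s' t' <= _).
  rewrite ler_wpM2l// exchange_big/= [leRHS]exchange_big/=; apply: ler_sum => j _.
  have E u : \sum_(i < n) m i j * s' i * u = u * \sum_(i < n) m i j * s' i.
    by rewrite mulr_sumr; apply: eq_bigr => i _; ring.
  by rewrite !E sign_mul.
by apply: cut_form_pm => ?; exact: sign_pm.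
Qed.

Lemma norm_cut_form_le (s t : 'I_n -> R) :
  (forall i, `|s i| <= 1) -> (forall i, `|t i| <= 1) ->
  `|cut_form s t| <= cut_discrepancy xi p.
Proof.
move=> s1 t1; rewrite ler_norml cut_form_le// andbT lerNl.
have -> : - cut_form s t = cut_form (fun i => - s i) t.
  rewrite /cut_form -mulrN -sumrN; congr (_ * _); apply: eq_bigr => i _.
  by rewrite -sumrN; apply: eq_bigr => j _; ring.
by apply: cut_form_le => // i; rewrite normrN.
Qed.

Definition graph_weights (K : R) (i j : 'I_n) : R := (n%:R * p)^-1 * (xi i j)%:R * - K.

Variable K : R.
Hypothesis K_ge0 : 0 <= K.
Notation mean u := (n%:R^-1 * \sum_(i < n) u i).

(** The addition formula separates [i] from [j]. Writing [xi / p] as [1 + (xi / p - 1)], the part 1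
    yields products of means, which close into the mean-field system, and the rest is a difference
    of cut forms. *)
Lemma gen_split (k phi : R) (y : 'I_n -> R) :
  gen (graph_weights K) k phi y = - (k ^+ 2 / 2) * mean_cos k phi y +
  K * k * (mean (fun i => sin (k * y i + phi) * sin (y i)) * mean (fun j => cos (y j)) -
           mean (fun i => sin (k * y i + phi) * cos (y i)) * mean (fun j => sin (y j))) +
  K * k * (cut_form (fun i => sin (k * y i + phi) * sin (y i)) (fun j => cos (y j)) -
           cut_form (fun i => sin (k * y i + phi) * cos (y i)) (fun j => sin (y j))).
Proof.
have cfE (s t : 'I_n -> R) : cut_form s t + mean s * mean t =
    (n%:R ^+ 2)^-1 * \sum_i \sum_j (xi i j)%:R / p * s i * t j.
  rewrite /cut_form mulrACA -invfM -expr2 -mulrDr; congr (_ * _).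
  rewrite mulr_suml -big_split/=; apply: eq_bigr => i _.
  by rewrite mulr_sumr -big_split/=; apply: eq_bigr => j _; ring.
set C := fun j => cos (y j); set S := fun j => sin (y j).
set u := fun i => _ * sin (y i); set v := fun i => _ * cos (y i).
transitivity (- (k ^+ 2 / 2) * mean_cos k phi y +
  K * k * ((cut_form u C + mean u * mean C) - (cut_form v S + mean v * mean S))); last by ring.
rewrite !cfE -mulrBr -sumrB /gen big_split/= mulrDr; congr (_ + _).
  by rewrite /mean_cos -mulr_sumr; ring.
rewrite -(mulrA K) !mulr_sumr; apply: eq_bigr => i _.
rewrite -sumrB /drift !mulr_sumr -sumrN !mulr_sumr; apply: eq_bigr => j _.
rewrite /graph_weights /u /v /C /S sinB; set s := sin (_ + _).
by rewrite !invfM; ring.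
Qed.

Let graph_part_le (k phi : R) (y : 'I_n -> R) :
  `|cut_form (fun i => sin (k * y i + phi) * sin (y i)) (fun j => cos (y j)) -
    cut_form (fun i => sin (k * y i + phi) * cos (y i)) (fun j => sin (y j))| <=
  2 * cut_discrepancy xi p.
Proof.
have s1 (z : R) : `|sin z| <= 1 by rewrite ler_norml sin_geN1 sin_le1.
have c1 (z : R) : `|cos z| <= 1 by rewrite ler_norml cos_geN1 cos_le1.
apply: le_trans (ler_normB _ _) _; rewrite mulr_natl mulr2n.
by apply: lerD; apply: norm_cut_form_le => // i; rewrite normrM mulr_ile1.
Qed.

(** Product-to-sum formulas turn the products of means into the modes [k] and [k.+2] next to mode
    [k.+1]. The bound holds for every configuration [y], which is what permits initial data
    depending on the graph. *)
Lemma gen_field_cos (k : nat) (y : 'I_n -> R) :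
  `|gen (graph_weights K) k.+1%:R 0 y -
    field_cos K (fun j => mean_cos j%:R 0 y) (fun j => mean_cos j%:R (- (pi / 2)) y) k| <=
  2 * K * k.+1%:R * cut_discrepancy xi p.
Proof.
rewrite gen_split /field_cos.
have cE (z : R) : cos (z + - (pi / 2)) = sin z by rewrite cosBpihalf.
have E1 : mean_cos 1%N%:R 0 y = mean (fun i => cos (y i)).
  by rewrite /mean_cos; under eq_bigr do rewrite mul1r addr0.
have E2 : mean_cos 1%N%:R (- (pi / 2)) y = mean (fun i => sin (y i)).
  by rewrite /mean_cos; under eq_bigr do rewrite mul1r cE.
rewrite E1 E2; set C := mean (fun i => cos (y i)); set S := mean (fun i => sin (y i)).
set u := fun i => _ * sin (y i); set v := fun i => _ * cos (y i).
have mu : mean u = (mean_cos k%:R 0 y - mean_cos k.+2%:R 0 y) / 2.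
  rewrite /mean_cos -mulrBr -sumrB -mulrA mulr_suml; congr (_ * _).
  apply: eq_bigr => i _; rewrite /u !addr0.
  have -> : k.+2%:R * y i = k.+1%:R * y i + y i by rewrite -[k.+2%:R]natr1; ring.
  have -> : k%:R * y i = k.+1%:R * y i - y i by rewrite -[k.+1%:R]natr1; ring.
  by rewrite cosB cosD; lra.
have mv : mean v = (mean_cos k.+2%:R (- (pi / 2)) y + mean_cos k%:R (- (pi / 2)) y) / 2.
  rewrite /mean_cos -mulrDr -big_split/= -mulrA mulr_suml; congr (_ * _).
  apply: eq_bigr => i _; rewrite /v !addr0 !cE.
  have -> : k.+2%:R * y i = k.+1%:R * y i + y i by rewrite -[k.+2%:R]natr1; ring.
  have -> : k%:R * y i = k.+1%:R * y i - y i by rewrite -[k.+1%:R]natr1; ring.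
  by rewrite sinB sinD; lra.
rewrite mu mv.
have := graph_part_le k.+1%:R 0 y; rewrite -/u -/v => h.
set cf := cut_form u _ - cut_form v _ in h *.
rewrite (_ : _ - _ = K * k.+1%:R * cf); last by ring.
rewrite normrM ger0_norm ?mulr_ge0// (_ : 2 * _ * _ * _ = K * k.+1%:R * (2 * cut_discrepancy xi p)).
  by rewrite ler_wpM2l// mulr_ge0.
by ring.
Qed.

Lemma gen_field_sin (k : nat) (y : 'I_n -> R) :
  `|gen (graph_weights K) k.+1%:R (- (pi / 2)) y -
    field_sin K (fun j => mean_cos j%:R 0 y) (fun j => mean_cos j%:R (- (pi / 2)) y) k| <=
  2 * K * k.+1%:R * cut_discrepancy xi p.
Proof.
rewrite gen_split /field_sin.
have cE (z : R) : cos (z + - (pi / 2)) = sin z by rewrite cosBpihalf.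
have E1 : mean_cos 1%N%:R 0 y = mean (fun i => cos (y i)).
  by rewrite /mean_cos; under eq_bigr do rewrite mul1r addr0.
have E2 : mean_cos 1%N%:R (- (pi / 2)) y = mean (fun i => sin (y i)).
  by rewrite /mean_cos; under eq_bigr do rewrite mul1r cE.
rewrite E1 E2; set C := mean (fun i => cos (y i)); set S := mean (fun i => sin (y i)).
set u := fun i => _ * sin (y i); set v := fun i => _ * cos (y i).
have sE (z : R) : sin (z + - (pi / 2)) = - cos z by rewrite sinBpihalf.
have mu : mean u = - (mean_cos k.+2%:R (- (pi / 2)) y - mean_cos k%:R (- (pi / 2)) y) / 2.
  rewrite /mean_cos -mulrBr -sumrB -mulrN -sumrN -mulrA mulr_suml; congr (_ * _).
  apply: eq_bigr => i _; rewrite /u !cE sE.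
  have -> : k.+2%:R * y i = k.+1%:R * y i + y i by rewrite -[k.+2%:R]natr1; ring.
  have -> : k%:R * y i = k.+1%:R * y i - y i by rewrite -[k.+1%:R]natr1; ring.
  by rewrite sinB sinD; lra.
have mv : mean v = - (mean_cos k.+2%:R 0 y + mean_cos k%:R 0 y) / 2.
  rewrite /mean_cos -mulrDr -big_split/= -mulrN -sumrN -mulrA mulr_suml; congr (_ * _).
  apply: eq_bigr => i _; rewrite /v !addr0 sE.
  have -> : k.+2%:R * y i = k.+1%:R * y i + y i by rewrite -[k.+2%:R]natr1; ring.
  have -> : k%:R * y i = k.+1%:R * y i - y i by rewrite -[k.+1%:R]natr1; ring.
  by rewrite cosB cosD; lra.
rewrite mu mv.
have := graph_part_le k.+1%:R (- (pi / 2)) y; rewrite -/u -/v => h.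
set cf := cut_form u _ - cut_form v _ in h *.
rewrite (_ : _ - _ = K * k.+1%:R * cf); last by ring.
rewrite normrM ger0_norm ?mulr_ge0// (_ : 2 * _ * _ * _ = K * k.+1%:R * (2 * cut_discrepancy xi p)).
  by rewrite ler_wpM2l// mulr_ge0.
by ring.
Qed.

End graph_error.

(** * Lifting the oscillator paths to the real line *)

Section path_lift.
Variable R : realType.

(** Paths are continuous for nonnegative times only. Freezing them before 0 gives functions
    continuous on the whole line, as the calculus above requires. *)
Lemma ray_extension_continuous (V : topologicalType) (f : R -> V) :
  {within `[0, +oo[, continuous f} -> continuous (fun t : R => f (Num.max t 0)).
Proof.
move=> /subspace_continuousP fc t; set m := Num.max t 0.
have m0 (s : R) : `[0, +oo[%classic (Num.max s 0) by rewrite /= in_itv/= le_max lexx orbT.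
have mc : (fun s : R => Num.max s 0) @ t --> m.
  exact: (@continuous_max R R id (cst 0) t (@cvg_id _ _) (@cvg_cst _ _ _ _ _)).
move=> U fU; have := fc m (m0 _) U fU.
move=> wU.
have h : \forall s \near t, `[0, +oo[%classic (Num.max s 0) -> U (f (Num.max s 0)) := mc _ wU.
by apply: filterS h => s; apply; exact: m0.
Qed.

Lemma cint_continuous_ray (f : R -> R) : continuous f ->
  {within `[0, +oo[, continuous (cint f 0)}.
Proof.
move=> fc; apply/subspace_continuousP => x; rewrite /= in_itv/= andbT => x0.
have x10 : 0 <= x + 1 by rewrite addr_ge0.
have /subspace_continuousP h := cint_continuous fc x10.
have xx1 : `[0, (x + 1)]%classic x by rewrite /= in_itv/= x0/= lerDl ler01.
move=> U fU.
have wU : \forall y \near x, `[0, (x + 1)]%classic y -> U (cint f 0 y) := h x xx1 U fU.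
have lt1 : \forall y \near x, y < x + 1 by apply: lt_nbhsl; rewrite ltrDl.
have wU' : \forall y \near x, `[0, +oo[%classic y -> U (cint f 0 y).
  apply: filterS2 wU lt1 => y; rewrite /= !in_itv/= andbT => Uy y1 y0.
  by apply: Uy; rewrite y0/= ltW.
exact: wU'.
Qed.

Context (n : nat) (xi : 'M[nat]_n) (p K : R).
Variables (theta : nat -> R -> torus R) (b : nat -> R -> R).
Hypothesis theta_continuous : forall i : 'I_n, {within `[0, +oo[, continuous (theta i)}.
Hypothesis b_continuous : forall i : 'I_n, {within `[0, +oo[, continuous (b i)}.
Hypothesis theta_eq : forall (i : 'I_n) t, 0 <= t -> theta i t = theta i 0 +
  torus_pi (\int[lebesgue_measure]_(s in `[0, t])
    ((n%:R * p)^-1 * \sum_(j < n) (xi i j)%:R * coupling K (theta i s - theta j s))) +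
  torus_pi (b i t).

Lemma path_lift : exists x : 'I_n -> R -> R,
  [/\ forall i, continuous (x i),
      forall i t, 0 <= t -> x i t = (repr (theta i 0) : R) +
        cint (fun s => drift (graph_weights xi p K) (x^~ s) i) 0 t + b i t
    & forall i t, 0 <= t -> torus_pi (x i t) = theta i t].
Proof.
pose D (i : 'I_n) (s : R) := (n%:R * p)^-1 * \sum_(j < n) (xi i j)%:R *
  coupling K (theta i (Num.max s 0) - theta j (Num.max s 0)).
have Dc i : continuous (D i).
  have wc c k phi (j : 'I_n) : continuous (fun s : R => wave c k phi (theta j (Num.max s 0))).
    move=> s; apply: (@continuous_comp R (torus R) R (fun s : R => theta j (Num.max s 0)) (wave c k phi)).
      exact: (ray_extension_continuous (@theta_continuous j)).
    exact: wave_continuous.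
  move=> s; apply: cvgM; first exact: cvg_cst.
  apply: (@continuous_sum R R 'I_n) => j t; apply: cvgM; first exact: cvg_cst.
  rewrite /continuous_at; under eq_fun do rewrite couplingE; rewrite couplingE.
  by apply: cvgM; [exact: cvg_cst|apply: cvgB; apply: cvgM; exact: wc].
pose x (i : 'I_n) (t : R) := (repr (theta i 0) : R) + cint (D i) 0 (Num.max t 0) + b i (Num.max t 0).
have xE i t : 0 <= t -> x i t = (repr (theta i 0) : R) + cint (D i) 0 t + b i t.
  by move=> t0; rewrite /x max_l.
have xpi i t : 0 <= t -> torus_pi (x i t) = theta i t.
  move=> t0; rewrite xE// (theta_eq i t0) !torus_piD torus_pi_repr; congr (_ + torus_pi _ + _).
  by apply: eq_cint => s /andP[s0 _]; rewrite /D max_l.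
exists x; split=> // [i s|i t t0].
  apply: cvgD; first apply: cvgD; first exact: cvg_cst.
    exact: (ray_extension_continuous (cint_continuous_ray (@Dc i))).
  exact: (ray_extension_continuous (@b_continuous i)).
rewrite xE//; congr (_ + _ + _); apply: eq_cint => s /andP[s0 _].
rewrite /D max_l// /drift mulr_sumr; apply: eq_bigr => j _.
by rewrite -!xpi// coupling_pi /graph_weights; ring.
Qed.

End path_lift.

Lemma mean_cos_mode (R : realType) (n : nat) (theta : nat -> torus R) (x : 'I_n -> R) k phi :
  (0 < n)%N -> (forall i : 'I_n, torus_pi (x i) = theta i) ->
  mean_cos k%:R phi x = mode (empirical n theta) k phi.
Proof.
move=> n0 xpi; rewrite mode_empirical// /mean_cos; congr (_ * _).
by apply: eq_bigr => i _; rewrite -xpi wave_pi mul1r.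
Qed.

(** * Convergence *)

Section mckean_vlasov_modes.
Variable R : realType.

Lemma wave_mul (c : R) k (u v : R) (x : torus R) :
  wave c k.+1 u x * wave 1 1 v x = wave (c / 2) k.+2 (u + v) x + wave (c / 2) k (u - v) x.
Proof.
rewrite /wave; set y : R := repr x.
have -> : k.+2%:R * y + (u + v) = (k.+1%:R * y + u) + (1%N%:R * y + v).
  by rewrite -[k.+2%:R]natr1; ring.
have -> : k%:R * y + (u - v) = (k.+1%:R * y + u) - (1%N%:R * y + v).
  by rewrite -[k.+1%:R]natr1; ring.
by set a := k.+1%:R * y + u; set b := _ + v; rewrite (cosD a) (cosB a); field.
Qed.

Variables (K : R) (nu : probability (torus R) R).
Notation A := (fun j => mode nu j 0).
Notation B := (fun j => mode nu j (- (pi / 2))).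

Let nu1 : nu setT = 1%E. Proof. exact: probability_setT. Qed.

(** The convolution sees the measure only through its first mode, so the weak equation tested on
    waves is a closed quadratic system. *)
Lemma torus_conv_coupling x : torus_conv (coupling K) nu x =
  - K * A 1%N * wave 1 1 (- (pi / 2)) x + K * B 1%N * wave 1 1 0 x.
Proof.
rewrite /torus_conv.
transitivity (\int[nu]_y (wave (- K * wave 1 1 (- (pi / 2)) x) 1 0 y +
    wave (K * wave 1 1 0 x) 1 (- (pi / 2)) y)).
  by apply: eq_Rintegral => y _; rewrite couplingE /wave; ring.
rewrite (Rintegral_bmD nu1); [|exact: wave_bm|exact: wave_bm].
by rewrite !(Rintegral_wave _ _ _ nu1); ring.
Qed.

Definition wave_generator k phi : R :=
  2^-1 * \int[nu]_x torus_derive (torus_derive (wave 1 k phi)) x +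
  \int[nu]_x (torus_derive (wave 1 k phi) x * torus_conv (coupling K) nu x).

Lemma wave_generatorE k phi : wave_generator k.+1 phi =
  - (k.+1%:R ^+ 2 / 2) * mode nu k.+1 phi + K * k.+1%:R / 2 *
   (A 1%N * (mode nu k (phi) - mode nu k.+2 phi) +
    B 1%N * (mode nu k.+2 (phi + pi / 2) + mode nu k (phi + pi / 2))).
Proof.
have modeDpi j u : mode nu j (u + pi) = - mode nu j u.
  rewrite (mode_phase _ _ nu1) [in RHS](mode_phase _ _ nu1) cosDpi sinDpi; ring.
rewrite /wave_generator torus_wave_derive torus_wave_derive.
rewrite (Rintegral_wave _ _ _ nu1).
set c : R := 1 * k.+1%:R; set al := - K * A 1%N; set be := K * B 1%N.
transitivity (2^-1 * (c * k.+1%:R * mode nu k.+1 (phi + pi / 2 + pi / 2)) +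
  \int[nu]_x (al * (wave (c / 2) k.+2 (phi + pi / 2 + - (pi / 2)) x +
                    wave (c / 2) k (phi + pi / 2 - - (pi / 2)) x) +
    be * (wave (c / 2) k.+2 (phi + pi / 2 + 0) x + wave (c / 2) k (phi + pi / 2 - 0) x))).
  congr (_ + _); apply: eq_Rintegral => x _.
  rewrite torus_conv_coupling -/al -/be -!wave_mul; ring.
rewrite (Rintegral_bmD nu1); last 2 first.
- by apply: bounded_measurableZ; apply: bounded_measurableD; exact: wave_bm.
- by apply: bounded_measurableZ; apply: bounded_measurableD; exact: wave_bm.
rewrite !(Rintegral_bmZ nu1); last 2 first.
- by apply: bounded_measurableD; exact: wave_bm.
- by apply: bounded_measurableD; exact: wave_bm.
rewrite !(Rintegral_bmD nu1); try exact: wave_bm.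
rewrite !(Rintegral_wave _ _ _ nu1).
have -> : phi + pi / 2 + pi / 2 = phi + pi by field.
have -> : phi + pi / 2 + - (pi / 2) = phi by ring.
have -> : phi + pi / 2 - - (pi / 2) = phi + pi by field.
by rewrite addr0 subr0 !modeDpi /c /al /be; field.
Qed.

Lemma wave_generator_cos k : wave_generator k.+1 0 = field_cos K A B k.
Proof.
have h j : mode nu j (0 + pi / 2) = - B j.
  by rewrite add0r (mode_phase _ _ nu1) cos_pihalf sin_pihalf; ring.
by rewrite wave_generatorE !h /field_cos; ring.
Qed.

Lemma wave_generator_sin k : wave_generator k.+1 (- (pi / 2)) = field_sin K A B k.
Proof. by rewrite wave_generatorE addNr /field_sin; ring. Qed.

End mckean_vlasov_modes.

Lemma mckean_vlasov_mode (R : realType) (K : R) mu0 (mu : R -> probability (torus R) R) :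
  is_McKean_Vlasov_solution K mu0 mu ->
  [/\ forall k phi, continuous (fun t : R => mode (mu (Num.max t 0)) k phi),
      forall k phi, mode (mu 0) k phi = mode mu0 k phi
    & forall k phi t, 0 <= t -> mode (mu t) k phi = mode (mu 0) k phi +
        cint (fun s => wave_generator K (mu s) k phi) 0 t].
Proof.
move=> [muc mu00 mueq]; split=> [k phi|k phi|k phi t t0].
- by apply: (ray_extension_continuous (muc _ _)); exact: wave_continuous.
- by rewrite /mode /Rintegral; congr fine; apply: eq_measure_integral => A mA _; exact: mu00.
- exact: (mueq _ (wave_torus_smooth 1 k phi) t t0).
Qed.

(** * Closeness of the modes along one path *)

Section modes_close.
Variable R : realType.
Context (n : nat) (xi : 'M[nat]_n) (p K eta T : R) (N : nat).
Variables (mu0 : probability (torus R) R) (mu : R -> probability (torus R) R).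
Variable x : 'I_n -> R -> R.
Hypotheses (n_gt0 : (0 < n)%N) (K_ge0 : 0 <= K) (N_gt0 : (0 < N)%N).
Hypotheses (eta_ge0 : 0 <= eta) (eta_le1 : eta <= 1) (T_ge0 : 0 <= T).
Hypothesis mu_solution : is_McKean_Vlasov_solution K mu0 mu.
Hypothesis x_continuous : forall i, continuous (x i).
Hypothesis cut_le : 2 * K * N%:R * cut_discrepancy xi p * T <= eta / 2.
Hypothesis residual_small : forall k phi t, (k < N)%N -> phi = 0 \/ phi = - (pi / 2) ->
  0 <= t <= T -> `|residual (graph_weights xi p K) x k.+1%:R phi t| <= eta / 2.
Hypothesis init_small : forall k phi, (k < N)%N -> phi = 0 \/ phi = - (pi / 2) ->
  `|mean_cos k.+1%:R phi (x^~ 0) - mode mu0 k.+1 phi| <= eta.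

Let mean_cos_continuous k phi : continuous (fun t => mean_cos k phi (x^~ t)).
Proof.
move=> t; apply: cvgM; first exact: cvg_cst.
apply: (@continuous_sum R R 'I_n) => i s.
apply: continuous_comp; last exact: continuous_cos.
by apply: cvgD; [apply: cvgM; [exact: cvg_cst|exact: x_continuous]|exact: cvg_cst].
Qed.

Let norm_mean_cos_le1 k phi t : `|mean_cos k phi (x^~ t)| <= 1.
Proof.
rewrite /mean_cos normrM ger0_norm ?invr_ge0// mulrC ler_pdivrMr ?ltr0n// mul1r.
apply: le_trans (ler_norm_sum _ _ _) _.
apply: le_trans (_ : \sum_(i < n) 1 <= _); last by rewrite sumr_const card_ord.
by apply: ler_sum => i _; rewrite ler_norml cos_geN1 cos_le1.
Qed.

Let mean_cos0 phi t : mean_cos 0 phi (x^~ t) = cos phi.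
Proof.
rewrite /mean_cos; under eq_bigr do rewrite mul0r add0r.
by rewrite sumr_const card_ord -[X in _ * X]mulr_natl mulrA mulVf ?mul1r// pnatr_eq0 -lt0n.
Qed.

Let A (k : nat) (t : R) : R := mean_cos k%:R 0 (x^~ t).
Let B (k : nat) (t : R) : R := mean_cos k%:R (- (pi / 2)) (x^~ t).

(** Half of [eta] pays for the martingale residual and half for the graph term integrated up to
    [T]. *)
Let approx (F : R -> R) k phi t : (k < N)%N -> phi = 0 \/ phi = - (pi / 2) -> 0 <= t <= T ->
  continuous F ->
  (forall s, `|gen (graph_weights xi p K) k.+1%:R phi (x^~ s) - F s| <=
     2 * K * k.+1%:R * cut_discrepancy xi p) ->
  `|mean_cos k.+1%:R phi (x^~ t) - mean_cos k.+1%:R phi (x^~ 0) - cint F 0 t| <= eta.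
Proof.
move=> kN hphi tT Fc Fle; have /andP[t0 tT'] := tT.
set G := fun s => gen (graph_weights xi p K) k.+1%:R phi (x^~ s) in Fle.
have Gc : continuous G by exact: path_gen_continuous.
have := residual_small kN hphi tT; rewrite /residual -/G => rle.
set m := mean_cos _ _ _ - mean_cos _ _ _ in rle *.
rewrite -(subrK (cint G 0 t) m) -addrA; apply: le_trans (ler_normD _ _) _.
rewrite [eta](splitr eta); apply: lerD => //.
rewrite -cintB//; apply: le_trans (norm_cint_le _ t0 (fun s _ => Fle s)) _.
  by move=> s; apply: cvgB; [exact: Gc|exact: Fc].
apply: le_trans cut_le; rewrite subr0.
have c0 : 0 <= cut_discrepancy xi p.
  apply: le_trans (norm_cut_form_le xi p (s := fun=> 0) (t := fun=> 0) _ _) => //;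
    by move=> i; rewrite normr0.
apply: ler_pM => //; first by rewrite !mulr_ge0.
by rewrite ler_wpM2r// ler_wpM2l ?mulr_ge0// ler_nat.
Qed.

Lemma modes_close k t : (k < N)%N -> 0 <= t <= T ->
  `|A k.+1 t - mode (mu t) k.+1 0| <= eta + k.+1%:R * Num.sqrt (comparison_bound K eta T N) /\
  `|B k.+1 t - mode (mu t) k.+1 (- (pi / 2))| <=
     eta + k.+1%:R * Num.sqrt (comparison_bound K eta T N).
Proof.
move=> kN tT; have /andP[t0 _] := tT.
have [muc mu00 mueq] := mckean_vlasov_mode mu_solution.
pose a k (s : R) := mode (mu (Num.max s 0)) k 0.
pose b k (s : R) := mode (mu (Num.max s 0)) k (- (pi / 2)).
have m1 s : (mu s) setT = 1%E by exact: probability_setT.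
have fieldc (u v : nat -> R -> R) j : (forall i, continuous (u i)) -> (forall i, continuous (v i)) ->
  continuous (fun s => field_cos K (u^~ s) (v^~ s) j) /\
  continuous (fun s => field_sin K (u^~ s) (v^~ s) j) by exact: field_continuous.
have Ac j : continuous (A j) by exact: mean_cos_continuous.
have Bc j : continuous (B j) by exact: mean_cos_continuous.
have atE j phi : mode (mu t) j phi = mode (mu (Num.max t 0)) j phi by rewrite max_l.
rewrite !atE; apply: (@mode_comparison R K eta T N A B a b) => //.
- by move=> j; exact: muc.
- by move=> j; exact: muc.
- by move=> *; exact: norm_mean_cos_le1.
- by move=> *; exact: norm_mean_cos_le1.
- by move=> *; exact: norm_mode_le1 (m1 _).
- by move=> *; exact: norm_mode_le1 (m1 _).
- by move=> s; rewrite /a (mode0 _ (m1 _)) /A mean_cos0.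
- by move=> s; rewrite /b (mode0 _ (m1 _)) /B mean_cos0.
- by move=> j jN; rewrite /a /b max_l// mu00; apply: init_small => //; left.
- by move=> j jN; rewrite /a /b max_l// mu00; apply: init_small => //; right.
- move=> j s jN sT; apply: approx => //; first by left.
    exact: (fieldc A B j Ac Bc).1.
  by move=> r; exact: gen_field_cos.
- move=> j s jN sT; apply: approx => //; first by right.
    exact: (fieldc A B j Ac Bc).2.
  by move=> r; exact: gen_field_sin.
- move=> j s s0; rewrite /a /b !max_l// (mueq _ _ s s0); congr (_ + _).
  by apply: eq_cint => r /andP[r0 _]; rewrite max_l// wave_generator_cos.
- move=> j s s0; rewrite /a /b !max_l// (mueq _ _ s s0); congr (_ + _).
  by apply: eq_cint => r /andP[r0 _]; rewrite max_l// wave_generator_sin.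
Qed.

End modes_close.

(** * Inner probability and intersections of events *)

Section inner_probability.
Context (R : realType) (d : measure_display) (Omega : measurableType d).
Variable P : probability Omega R.

Lemma inner_prob_le1 (E : set Omega) : (inner_prob P E <= 1)%E.
Proof. by apply: ge_ereal_sup => _ [A [mA _] <-]; exact: probability_le1. Qed.

Lemma probability_setI_ge (A B : set Omega) (a b : R) : measurable A -> measurable B ->
  ((1 - a)%:E <= P A)%E -> ((1 - b)%:E <= P B)%E -> ((1 - (a + b))%:E <= P (A `&` B))%E.
Proof.
move=> mA mB.
have C (S : set Omega) (s : R) : measurable S -> ((1 - s)%:E <= P S)%E = (P (~` S) <= s%:E)%E.
  move=> mS; rewrite probability_setC//.
  by rewrite -[P S]fineK ?fin_num_measure// !EFinB -EFinB !lee_fin; apply/idP/idP => ?; lra.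
rewrite !C//; last exact: measurableI.
move=> Aa Bb; rewrite setCI; apply: le_trans (measureU2 _ _ _) _; try exact: measurableC.
by rewrite EFinD leeD.
Qed.

Lemma probability_bigcap_ge (F : nat -> set Omega) (a : nat -> R) m :
  (forall k, (k < m)%N -> measurable (F k) /\ ((1 - a k)%:E <= P (F k))%E) ->
  measurable (\big[setI/setT]_(k < m) F k) /\
  ((1 - \sum_(k < m) a k)%:E <= P (\big[setI/setT]_(k < m) F k))%E.
Proof.
elim: m => [|m IH] h; first by rewrite !big_ord0 subr0 probability_setT.
have [mI leI] := IH (fun k km => h k (ltnW km)).
have [mF leF] := h m (ltnSn m).
rewrite !big_ord_recr/=; split; first exact: measurableI.
exact: probability_setI_ge.
Qed.

(** [E] need not be an event. A measurable subset of [E], intersected with [S], is a measurable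
    subset of [F] and loses at most [a]. *)
Lemma inner_prob_setI_le (E S F : set Omega) (a : R) : measurable S ->
  ((1 - a)%:E <= P S)%E -> E `&` S `<=` F -> (inner_prob P E - a%:E <= inner_prob P F)%E.
Proof.
move=> mS aS ESF; rewrite leeBlDr//; apply: ge_ereal_sup => _ [A [mA AE] <-].
have mAS : measurable (A `&` S) by exact: measurableI.
rewrite -leeBlDr//.
apply: le_trans (_ : P (A `&` S) <= _)%E; last first.
  apply: ereal_sup_ubound; exists (A `&` S) => //; split=> //.
  by apply: subset_trans ESF; exact: setSI.
have pA : ((1 - (1 - fine (P A)))%:E <= P A)%E by rewrite subKr fineK ?fin_num_measure.
apply: le_trans (probability_setI_ge mA mS pA aS).
by rewrite -[P A]fineK ?fin_num_measure// -EFinB lee_fin/=; lra.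
Qed.

End inner_probability.

Lemma comparison_parameters (R : realType) (K T kap : R) (N0 : nat) :
  0 <= K -> 0 < T -> 0 < kap -> (0 < N0)%N ->
  exists2 N : nat, (N0 <= N)%N & exists2 eta : R, 0 < eta <= 1 &
    eta + N0%:R * Num.sqrt (comparison_bound K eta T N) <= kap.
Proof.
move=> K0 T0 kap0 N00.
have n00 : 0 < N0%:R :> R by rewrite ltr0n.
pose E := expR (40 * K ^+ 2 * T); have E0 : 0 < E := expR_gt0 _.
(* The target for [comparison_bound]: multiplied by [N0], its root is half of [kap]. *)
pose del := (kap / (2 * N0%:R)) ^+ 2.
have del0 : 0 < del by rewrite exprn_gt0// divr_gt0// mulr_gt0.
(* For [N] at least [M], the term of [comparison_bound] in [1 / N] is at most [del / 2]. *)
pose M := 48 * K * T * E / del.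
have T0' := ltW T0; have E0' := ltW E0; have del0' := ltW del0.
pose N := (maxn N0 (Num.trunc M).+1).
have N0N : (N0 <= N)%N by exact: leq_maxl.
have Npos : 0 < N%:R :> R by rewrite ltr0n (leq_trans N00).
have MN : M <= N%:R.
  apply: le_trans (ltW (truncnS_gt M)) _; by rewrite ler_nat leq_maxr.
(* The coefficient of [eta] in [comparison_bound], fixed once [N] is. *)
pose L := (2 * N%:R + (6 + 48 * K) * N%:R * T) * E.
have L0 : 0 < L.
  by rewrite mulr_gt0// ltr_pwDl ?mulr_gt0// !mulr_ge0// addr_ge0// mulr_ge0.
have [eta [eta0 eta1 etak etaL]] : exists eta : R,
    [/\ 0 < eta, eta <= 1, eta <= kap / 2 & eta * L <= del / 2].
  exists (Num.min 1 (Num.min (kap / 2) (del / 2 / L))); split.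
  - by rewrite !lt_min ltr01 !divr_gt0.
  - by rewrite ge_min lexx.
  - by rewrite !ge_min lexx !orbT.
  - by rewrite -ler_pdivlMr// !ge_min lexx !orbT.
exists N => //; exists eta; first by rewrite eta0.
have cb : comparison_bound K eta T N <= del.
  have -> : comparison_bound K eta T N = eta * L + 24 * K * T * E / N%:R.
    by rewrite /comparison_bound /L -/E; field; rewrite gt_eqF.
  have : 24 * K * T * E / N%:R <= del / 2.
    rewrite ler_pdivrMr//; move: MN; rewrite /M ler_pdivrMr//; lra.
  by move: etaL; lra.
have sq : Num.sqrt (comparison_bound K eta T N) <= kap / (2 * N0%:R).
  apply: le_trans (ler_wsqrtr cb) _.
  by rewrite /del sqrtr_sqr ger0_norm// divr_ge0// ltW.
have : N0%:R * Num.sqrt (comparison_bound K eta T N) <= N0%:R * (kap / (2 * N0%:R)).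
  by rewrite ler_wpM2l// ltW.
have -> : N0%:R * (kap / (2 * N0%:R)) = kap / 2 by field; rewrite gt_eqF.
by move: etak; lra.
Qed.

(** * The estimate for one fixed graph *)

Section one_graph.
Context (R : realType) (d : measure_display) (Omega : measurableType d).
Variables (P : probability Omega R) (K : R) (n : nat) (xi : 'M[nat]_n) (p : R).
Variables (B : nat -> R -> Omega -> R) (theta : nat -> R -> Omega -> torus R).
Variables (mu0 : probability (torus R) R) (mu : R -> probability (torus R) R).
Variables (T eps kap eta : R) (N0 N : nat).
Hypotheses (n_gt0 : (0 < n)%N) (K_ge0 : 0 <= K) (T_gt0 : 0 < T).
Hypotheses (B_iid : iid_Brownian_motions P B) (theta_system : oscillator_system P K xi p B theta).
Hypothesis mu_solution : is_McKean_Vlasov_solution K mu0 mu.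
Hypotheses (N0_gt0 : (0 < N0)%N) (N0N : (N0 <= N)%N) (eta01 : 0 < eta <= 1).
Hypothesis modes_dist : forall nu nu' : {measure set (torus R) -> \bar R},
  nu setT = 1%E -> nu' setT = 1%E ->
  (forall k, (0 < k <= N0)%N -> `|mode nu k 0 - mode nu' k 0| <= kap /\
     `|mode nu k (- (pi / 2)) - mode nu' k (- (pi / 2))| <= kap) ->
  (Hm1_dist nu nu' <= eps%:E)%E.
Hypothesis bound_le : eta + N0%:R * Num.sqrt (comparison_bound K eta T N) <= kap.
Hypothesis cut_le : 2 * K * N%:R * cut_discrepancy xi p * T <= eta / 2.

Let N_gt0 : (0 < N)%N := leq_trans N0_gt0 N0N.

(** The deterministic comparison is run on every path with good initial data, small martingales and
    a regular solution. The initial tolerance is [eta / (2 pi N)] because mode [k] costs a factor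
    [2 pi k]. The loss of probability is summed over the first [N] modes and over the two phases. *)
Lemma inner_prob_step :
  (inner_prob P [set w | (Hm1_dist (empirical n (fun j => theta j 0%R w)) mu0 <=
      (eta / (N%:R * (2 * pi)))%:E)%E] -
    (\sum_(k < N) (2 * k.+1%:R ^+ 2 * T / (n%:R * (eta / 2) ^+ 2) +
                  2 * k.+1%:R ^+ 2 * T / (n%:R * (eta / 2) ^+ 2)))%:E <=
   inner_prob P [set w | (ereal_sup [set Hm1_dist (empirical n (fun j => theta j t w)) (mu t)
                 | t in `[0%R, T]] <= eps%:E)%E])%E.
Proof.
have /andP[eta0 eta1] := eta01; have eta20 : 0 < eta / 2 by rewrite divr_gt0.
have [theta_measurable theta_indep theta_good] := theta_system.
pose theta0 i := theta i 0.
have theta0_measurable (i : 'I_n) : measurable_fun setT (theta0 i) by exact: theta_measurable.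
pose a := graph_weights xi p K.
pose F k := survive_io B theta0 a n_gt0 k.+1 0 T (eta / 2) `&`
  survive_io B theta0 a n_gt0 k.+1 (- (pi / 2)) T (eta / 2).
pose dk k : R := 2 * k.+1%:R ^+ 2 * T / (n%:R * (eta / 2) ^+ 2).
have [|mS leS] := @probability_bigcap_ge R d Omega P F (fun k => dk k + dk k) N.
  move=> k kN; have m phi := survive_io_measurable B_iid a n_gt0 theta0_measurable k.+1 phi (eta / 2) T_gt0.
  split; first exact: measurableI.
  apply: probability_setI_ge => //; exact: survive_io_prob.
(* The exceptional sets of the system and of the countably many Brownian paths are merged into one
   null set [Z]. *)
have : \forall w \ae P, (forall i : 'I_n,
        {within `[0, +oo[, continuous (fun t => theta i t w)} /\
        forall t, 0 <= t ->
          theta i t w = theta i 0 w +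
            torus_pi (\int[lebesgue_measure]_(s in `[0, t])
              ((n%:R * p)^-1 * \sum_(j < n) (xi i j)%:R *
                 coupling K (theta i s w - theta j s w))) +
            torus_pi (B i t w)) /\
   forall i, B i 0 w = 0 /\ {within `[0, +oo[, continuous ((B i)^~ w)}.
  apply: filterI => //; apply/ae_foralln => i.
  by have [/(_ i)[]] := B_iid.
move=> [Z [mZ PZ goodZ]].
have mG : measurable (~` Z) by exact: measurableC.
have leG : ((1 - 0)%:E <= P (~` Z))%E by rewrite probability_setC// PZ subr0 sube0.
have := probability_setI_ge mS mG leS leG; rewrite addr0 => leSG.
apply: (inner_prob_setI_le (measurableI _ _ mS mG) leSG) => w [/= init [Sw Zw]].
have [theta_w B_w] : (forall i : 'I_n,
        {within `[0, +oo[, continuous (fun t => theta i t w)} /\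
        forall t, 0 <= t ->
          theta i t w = theta i 0 w +
            torus_pi (\int[lebesgue_measure]_(s in `[0, t])
              ((n%:R * p)^-1 * \sum_(j < n) (xi i j)%:R *
                 coupling K (theta i s w - theta j s w))) +
            torus_pi (B i t w)) /\
   forall i, B i 0 w = 0 /\ {within `[0, +oo[, continuous ((B i)^~ w)}.
  by apply: contrapT => /goodZ.
have [x [xc xeq xpi]] := @path_lift R n xi p K (fun i t => theta i t w) (fun i t => B i t w)
  (fun i => (theta_w i).1) (fun i => (B_w i).2) (fun i => (theta_w i).2).
have xmode k phi t : 0 <= t ->
    mean_cos k%:R phi (x^~ t) = mode (empirical n (fun j => theta j t w)) k phi.
  by move=> t0; apply: mean_cos_mode => // i; exact: xpi.
have res k phi t : (k < N)%N -> phi = 0 \/ phi = - (pi / 2) ->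
    0 <= t <= T -> `|residual a x k.+1%:R phi t| <= eta / 2.
  move=> kN hphi tT; move: Sw; rewrite -bigcap_mkord => /(_ k kN)[S1 S2].
  have sv : survive_io B theta0 a n_gt0 k.+1 phi T (eta / 2) w by case: hphi => ->.
  by apply: (survive_io_residual T_gt0 sv) => // i; exact: (B_w i).1.
have pi0 : 0 < 2 * pi :> R by rewrite mulr_gt0// pi_gt0.
have ini k phi : (k < N)%N -> phi = 0 \/ phi = - (pi / 2) ->
    `|mean_cos k.+1%:R phi (x^~ 0) - mode mu0 k.+1 phi| <= eta.
  move=> kN _; rewrite xmode//.
  apply: le_trans (Hm1_dist_mode phi (empirical_unit _ n_gt0) (probability_setT mu0) _ init) _ => //.
  have N0' : 0 < N%:R :> R by rewrite ltr0n.
  have -> : k.+1%:R * (2 * pi) * (eta / (N%:R * (2 * pi))) = k.+1%:R / N%:R * eta.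
    by move: pi0; set q := 2 * pi => q0; field; rewrite !gt_eqF.
  by rewrite ler_piMl ?(ltW eta0)// ler_pdivrMr// mul1r ler_nat.
have close := modes_close n_gt0 K_ge0 N_gt0 (ltW eta0) eta1 (ltW T_gt0) mu_solution xc cut_le
  res ini.
apply: ge_ereal_sup => _ [t /= tT <-]; move: tT; rewrite in_itv/= => tT.
have /andP[t0 _] := tT.
apply: modes_dist; [exact: empirical_unit|exact: probability_setT|].
case=> [//|k] kN0; have [h1 h2] := close k t (leq_trans kN0 N0N) tT.
rewrite -!xmode//.
have le : eta + k.+1%:R * Num.sqrt (comparison_bound K eta T N) <= kap.
  by apply: le_trans bound_le; rewrite lerD2l ler_wpM2r ?sqrtr_ge0// ler_nat.
by split; [exact: le_trans h1 le|exact: le_trans h2 le].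
Qed.

End one_graph.

Theorem theorem2p1 (R : realType) (d : measure_display) (Omega : measurableType d)
  (P : probability Omega R) (K : R)
  (xi : forall n : nat, 'M[nat]_n) (p : nat -> R)
  (B : nat -> R -> Omega -> R)
  (theta : nat -> nat -> R -> Omega -> torus R)
  (mu0 : probability (torus R) R) (mu : R -> probability (torus R) R)
  (K_ge0 : 0 <= K)
  (xi_le : forall (n : nat) (i j : 'I_n), (xi n i j <= n)%N)
  (p_gt0_le1 : forall n, 0 < p n <= 1)
  (graph_cvg : cut_discrepancy (xi n) (p n) @[n --> \oo] --> (0 : R))
  (B_iid : iid_Brownian_motions P B)
  (theta_system : forall n, oscillator_system P K (xi n) (p n) B (theta n))
  (mu_solution : is_McKean_Vlasov_solution K mu0 mu)
  (initial_cvg : forall eps0 : R, 0 < eps0 ->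
     inner_prob P [set w |
       (Hm1_dist (empirical n (fun j => theta n j 0%R w)) mu0 <= eps0%:E)%E]
       @[n --> \oo] --> 1%E) :
  forall T : R, 0 < T -> forall eps : R, 0 < eps ->
    inner_prob P [set w |
      (ereal_sup [set Hm1_dist (empirical n (fun j => theta n j t w)) (mu t)
                 | t in `[0%R, T]] <= eps%:E)%E]
      @[n --> \oo] --> 1%E.
Proof.
move=> T T0 eps eps0.
(* Order of choice: [eps] fixes the number [N0] of modes to control and their tolerance [kap]; these
   fix the truncation [N] and then [eta]; only [n] remains to be taken large. *)
have [N0 N00 [kap kap0 modes_dist]] := modes_Hm1_dist eps0.
have [N N0N [eta eta01 bound_le]] := comparison_parameters K_ge0 T0 kap0 N00.
have /andP[eta0 _] := eta01.
have N_gt0 : 0 < N%:R :> R by rewrite ltr0n (leq_trans N00).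
pose e0 := eta / (N%:R * (2 * pi)) : R.
have e00 : 0 < e0 by rewrite divr_gt0// !mulr_gt0// pi_gt0.
(* [C / n] is the total probability lost to the [2 * N] martingales. *)
pose C : R := \sum_(k < N) (2 * k.+1%:R ^+ 2 * T / (eta / 2) ^+ 2 +
                            2 * k.+1%:R ^+ 2 * T / (eta / 2) ^+ 2).
have inv_cvg : n%:R^-1 @[n --> \oo] --> (0 : R).
  by rewrite -cvg_shiftS; exact: cvg_harmonic.
have Cn_cvg : (C * n%:R^-1)%:E @[n --> \oo] --> 0%E.
  apply: cvg_EFin; first by near=> n.
  by rewrite -(mulr0 C); apply: cvgM => //; exact: cvg_cst.
have cut_small : \forall n \near \oo, 2 * K * N%:R * cut_discrepancy (xi n) (p n) * T <= eta / 2.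
  have h : (2 * K * N%:R * cut_discrepancy (xi n) (p n) * T) @[n --> \oo] --> (0 : R).
    rewrite -(mul0r T) -(mulr0 (2 * K * N%:R)).
    by apply: cvgM; [apply: cvgM; [exact: cvg_cst|exact: graph_cvg]|exact: cvg_cst].
  have eta20 : 0 < eta / 2 by rewrite divr_gt0.
  near=> n; apply: le_trans (ler_norm _) _.
  by near: n; exact: (cvgr0_norm_le _ h _ eta20).
apply: (@squeeze_cvge _ _ _ _ (fun n => inner_prob P [set w |
   (Hm1_dist (empirical n (fun j => theta n j 0%R w)) mu0 <= e0%:E)%E] - (C * n%:R^-1)%:E)%E
   _ (fun=> 1%E)).
- near=> n; rewrite inner_prob_le1 andbT.
  have n0 : (0 < n)%N by near: n; exact: nbhs_infty_gt.
  have -> : C * n%:R^-1 = \sum_(k < N) (2 * k.+1%:R ^+ 2 * T / (n%:R * (eta / 2) ^+ 2) +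
                  2 * k.+1%:R ^+ 2 * T / (n%:R * (eta / 2) ^+ 2)).
    rewrite mulr_suml; apply: eq_bigr => k _.
    by set e := (eta / 2) ^+ 2; rewrite mulrDl -(mulrA _ e^-1) -invfM (mulrC e).
  by apply: (inner_prob_step n0 K_ge0 T0 B_iid (theta_system n) mu_solution N00 N0N eta01
    modes_dist bound_le); near: n.
- rewrite -[X in _ --> X]sube0; apply: cvgeB => //; exact: initial_cvg.
- exact: cvg_cst.
Unshelve. all: by end_near. Qed.
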